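(* Let $n\geqslant 1$, let $b_1,b_2:[0,\infty)\to[0,\infty)$ be continuous, nonnegative and summable functions (i.e. $b_1,b_2\in \mathcal{C}([0,\infty))\cap L^1([0,\infty))$), and let $p,q>1$ satisfy $$\max\left\{\frac{p+1}{pq-1},\frac{q+1}{pq-1}\right\}\geqslant \frac{n-1}{2}.$$ Let $R>0$ and assume that $u_0,v_0\in H^1(\mathbb{R}^n)$ and $u_1,v_1\in L^2(\mathbb{R}^n)$ are nonnegative functions, compactly supported in $B_R$, such that $u_1\not\equiv 0$ and $v_1\not\equiv 0$. Then there exists a positive constant $\varepsilon_0=\varepsilon_0(u_0,u_1,v_0,v_1,n,p,q,b_1,b_2,R)$ and a positive constant $C$ independent of $\varepsilon$ such that for any $\varepsilon\in(0,\varepsilon_0]$ the following holds. If $(u,v)$ is an energy solution, with lifespan $T=T(\varepsilon)$, of the Cauchy problem $$\begin{cases} u_{tt}-\Delta u +b_1(t)u_t = |\partial_t v|^p, & x\in \mathbb{R}^n,\ t>0,\\ v_{tt}-\Delta v +b_2(t)v_t = |\partial_t u|^q, & x\in \mathbb{R}^n,\ t>0,\\ (u,u_t,v,v_t)(0,x)=(\varepsilon u_0,\varepsilon u_1,\varepsilon v_0,\varepsilon v_1)(x), & x\in\mathbb{R}^n, \end{cases}$$ satisfying $$\operatorname{supp} u,\ \operatorname{supp} v\subset\{(t,x)\in[0,T)\times\mathbb{R}^n: |x|\leqslant t+R\},$$ then $(u,v)$ blows up in finite time, and moreover the lifespan satisfies the upper bound $$T(\varepsilon)\leqslant \begin{cases}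 C\,\varepsilon^{-1/\Upsilon(n,p,q)} & \text{if } \Upsilon(n,p,q)>0,\\ \exp\big(C\varepsilon^{-(pq-1)}\big) & \text{if } \Upsilon(n,p,q)=0,\ p\neq q,\\ \exp\big(C\varepsilon^{-(p-1)}\big) & \text{if } \Upsilon(n,p,q)=0,\ p=q,\end{cases}$$ where $\Upsilon(n,p,q)=\max\{\Lambda(n,p,q),\Lambda(n,q,p)\}$ and $\Lambda(n,p,q)=\frac{p+1}{pq-1}-\frac{n-1}{2}$.
   Context: $B_R$ is the ball in $\mathbb{R}^n$ of radius $R$ around the origin. The lifespan $T(\varepsilon)$ is the maximal existence time of the solution, and blow-up in finite time means $T(\varepsilon)<\infty$. Definition (energy solution). Let $u_0,v_0\in H^1(\mathbb{R}^n)$ and $u_1,v_1\in L^2(\mathbb{R}^n)$. We say that $(u,v)$ is an energy solution on $[0,T)$ of the Cauchy problem $$\begin{cases} u_{tt}-\Delta u +b_1(t)u_t = |\partial_t v|^p, & x\in \mathbb{R}^n,\ t>0,\\ v_{tt}-\Delta v +b_2(t)v_t = |\partial_t u|^q, & x\in \mathbb{R}^n,\ t>0,\\ (u,u_t,v,v_t)(0,x)=(\varepsilon u_0,\varepsilon u_1,\varepsilon v_0,\varepsilon v_1)(x), & x\in\mathbb{R}^n, \end{cases}$$ if $$u\in \mathcal{C}([0,T),H^1(\mathbb{R}^n))\cap \mathcal{C}^1([0,T),L^2(\mathbb{R}^n)),\quad \partial_t u\in L^q_{\mathrm{loc}}([0,T)\times\mathbb{R}^n),$$ $$v\in \mathcal{C}([0,T),H^1(\mathbb{R}^n))\cap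 \mathcal{C}^1([0,T),L^2(\mathbb{R}^n)),\quad \partial_t v\in L^p_{\mathrm{loc}}([0,T)\times\mathbb{R}^n)$$ satisfy $u(0,x)=\varepsilon u_0(x)$, $v(0,x)=\varepsilon v_0(x)$ in $H^1(\mathbb{R}^n)$ and the equalities $$\int_0^t\!\int_{\mathbb{R}^n}|\partial_t v(s,x)|^p\phi(s,x)\,dx\,ds=\int_{\mathbb{R}^n}\partial_t u(t,x)\phi(t,x)\,dx-\int_{\mathbb{R}^n}\varepsilon u_1(x)\phi(0,x)\,dx-\int_0^t\!\int_{\mathbb{R}^n}\partial_t u(s,x)\phi_s(s,x)\,dx\,ds$$ $$\qquad+\int_0^t\!\int_{\mathbb{R}^n}\nabla u(s,x)\cdot\nabla\phi(s,x)\,dx\,ds+\int_0^t\!\int_{\mathbb{R}^n}b_1(s)\partial_t u(s,x)\phi(s,x)\,dx\,ds$$ and $$\int_0^t\!\int_{\mathbb{R}^n}|\partial_t u(s,x)|^q\psi(s,x)\,dx\,ds=\int_{\mathbb{R}^n}\partial_t v(t,x)\psi(t,x)\,dx-\int_{\mathbb{R}^n}\varepsilon v_1(x)\psi(0,x)\,dx-\int_0^t\!\int_{\mathbb{R}^n}\partial_t v(s,x)\psi_s(s,x)\,dx\,ds$$ $$\qquad+\int_0^t\!\int_{\mathbb{R}^n}\nabla v(s,x)\cdot\nabla\psi(s,x)\,dx\,ds+\int_0^t\!\int_{\mathbb{R}^n}b_2(s)\partial_t v(s,x)\psi(s,x)\,dx\,ds$$ for any test functions $\phi,\psi\in\mathcal{C}_0^\infty([0,T)\times\mathbb{R}^n)$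 and any $t\in[0,T)$. *)

(* Defs.v *)
From HB Require Import structures.
From mathcomp Require Import all_boot all_order all_algebra.
From mathcomp Require Import all_classical all_reals all_analysis.

Set Implicit Arguments.
Unset Strict Implicit.
Unset Printing Implicit Defensive.

Import Order.TTheory GRing.Theory Num.Theory.
Import numFieldNormedType.Exports.

Local Open Scope classical_set_scope.
Local Open Scope ring_scope.

Definition rV_display : measure_display.
Proof. exact. Qed.

Definition rV_coord (R : realType) n (i : 'I_n) (x : 'rV[R]_n) :
  measurableTypeR R := x ord0 i.

(* The sigma-algebra generated by the coordinates, i.e. the Borel one. *)
Section measurable_rV.
Context (R : realType) (n : nat).

Let rV_set0 : g_sigma_preimage (@rV_coord R n) set0.
Proof. exact: sigma_algebra0. Qed.

Let rV_setC A : g_sigma_preimage (@rV_coord R n) A ->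
  g_sigma_preimage (@rV_coord R n) (~` A).
Proof. exact: sigma_algebraC. Qed.

Let rV_bigcup (F : (set 'rV[R]_n)^nat) :
  (forall i, g_sigma_preimage (@rV_coord R n) (F i)) ->
  g_sigma_preimage (@rV_coord R n) (\bigcup_i (F i)).
Proof. exact: sigma_algebra_bigcup. Qed.

HB.instance Definition _ := @isMeasurable.Build rV_display
  'rV[R]_n (g_sigma_preimage (@rV_coord R n)) rV_set0 rV_setC rV_bigcup.

End measurable_rV.

Lemma measurable_rV_coord (R : realType) n (i : 'I_n) :
  measurable_fun [set: 'rV[R]_n] (@rV_coord R n i).
Proof.
move=> _ Y mY; rewrite setTI; apply: sub_sigma_algebra => /=.
rewrite -bigcup_seq/=; exists i => /=; first by rewrite mem_index_enum.
by exists Y => //; rewrite setTI.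
Qed.

Lemma measurable_fun_rVP d (T : measurableType d) (R : realType) n
    (f : T -> 'rV[R]_n) :
  (forall i, measurable_fun [set: T] (@rV_coord R n i \o f)) ->
  measurable_fun [set: T] f.
Proof.
move=> mf.
have : g_sigma_preimage (fun i => @rV_coord R n i \o f) `<=` measurable.
  apply: smallest_sub; first exact: sigma_algebra_measurable.
  case: n f mf => [|n] f mf; first by rewrite big_ord0.
  rewrite -bigcup_mkord_ord; apply: bigcup_sub => i Ii.
  by move=> A [B mB <-]; exact: mf.
rewrite g_sigma_preimage_comp => prefS _ A mA.
by apply: prefS; exists A.
Qed.

Definition rV_cons (R : realType) n (z : measurableTypeR R * 'rV[R]_n) :
  'rV[R]_n.+1 := row_mx (const_mx z.1 : 'rV[R]_1) z.2.

Definition rV_uncons (R : realType) n (x : 'rV[R]_n.+1) :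
  measurableTypeR R * 'rV[R]_n := (rV_coord ord0 x, @rsubmx R 1 1 n x).

Lemma rV_consK (R : realType) n : cancel (@rV_cons R n) (@rV_uncons R n).
Proof.
move=> [a y]; congr pair; last exact: row_mxKr.
transitivity ((row_mx (const_mx a : 'rV[R]_1) y) ord0 (lshift n ord0)).
  by rewrite /rV_coord; congr (fun_of_matrix _ _ _); exact/val_inj.
by rewrite row_mxEl mxE.
Qed.

Lemma measurable_rV_cons (R : realType) n :
  measurable_fun [set: measurableTypeR R * 'rV[R]_n] (@rV_cons R n).
Proof.
apply: measurable_fun_rVP => i; rewrite -(splitK (i : 'I_(1 + n))).
case: (fintype.split _) => j.
  rewrite (_ : _ \o _ = fst); first exact: measurable_fst.
  by apply/funext => -[a y]; transitivity ((const_mx a : 'rV[R]_1) ord0 j);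
    [exact: row_mxEl|rewrite mxE].
rewrite (_ : _ \o _ = @rV_coord R n j \o snd).
  by apply: measurableT_comp; [exact: measurable_rV_coord|exact: measurable_snd].
by apply/funext => -[a y]; exact: row_mxEr.
Qed.

Lemma measurable_rV_uncons (R : realType) n :
  measurable_fun [set: 'rV[R]_n.+1] (@rV_uncons R n).
Proof.
apply: measurable_fun_pair; first exact: measurable_rV_coord.
apply: measurable_fun_rVP => i.
rewrite (_ : _ \o _ = @rV_coord R n.+1 (@rshift 1 n i)).
  exact: measurable_rV_coord.
by apply/funext => x; rewrite /= /rV_coord mxE.
Qed.

Section rV_lebesgueS.
Context (R : realType) (n : nat)
  (m : {sigma_finite_measure set 'rV[R]_n -> \bar R}).

Definition rV_lebesgueS : set 'rV[R]_n.+1 -> \bar R :=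
  pushforward (lebesgue_measure \x m)%E (@rV_cons R n).

Let rV_lebesgueS0 : rV_lebesgueS set0 = 0%E.
Proof. by rewrite /rV_lebesgueS /pushforward preimage_set0 measure0. Qed.

Let rV_lebesgueS_ge0 A : (0 <= rV_lebesgueS A)%E.
Proof. exact: (measure_ge0 (lebesgue_measure \x m)%E). Qed.

Let rV_lebesgueS_sigma_additive : semi_sigma_additive rV_lebesgueS.
Proof.
move=> F mF tF mUF; rewrite /rV_lebesgueS /pushforward preimage_bigcup.
apply: (@measure_semi_sigma_additive _ _ _ (lebesgue_measure \x m)%E).
- by move=> i; rewrite -[X in measurable X]setTI; exact: measurable_rV_cons.
- apply/trivIsetP => /= i j _ _ ij; rewrite -preimage_setI.
  by move/trivIsetP : tF => /(_ _ _ _ _ ij) ->//; rewrite preimage_set0.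
- by rewrite -preimage_bigcup -[X in measurable X]setTI;
    exact: measurable_rV_cons.
Qed.

HB.instance Definition _ := isMeasure.Build _ _ _ rV_lebesgueS
  rV_lebesgueS0 rV_lebesgueS_ge0 rV_lebesgueS_sigma_additive.

Let rV_lebesgueS_sigma_finite : sigma_finite setT rV_lebesgueS.
Proof.
have /sigma_finiteP[F [TF ndF Foo]] := sigma_finiteT (@lebesgue_measure R).
have /sigma_finiteP[G [TG ndG Goo]] := sigma_finiteT m.
exists (fun i => @rV_uncons R n @^-1` (F i `*` G i)).
  rewrite -preimage_bigcup (_ : \bigcup_i _ = setT) ?preimage_setT//.
  apply/seteqP; split => // -[x y] _.
  have [i _ Fix] : (\bigcup_i F i) x by rewrite -TF.
  have [j _ Gjy] : (\bigcup_i G i) y by rewrite -TG.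
  exists (maxn i j) => //; split => /=.
    by move: x Fix; exact/subsetPset/ndF/leq_maxl.
  by move: y Gjy; exact/subsetPset/ndG/leq_maxr.
move=> i; have [mF Fi] := Foo i; have [mG Gi] := Goo i; split.
  rewrite -[X in measurable X]setTI; apply: measurable_rV_uncons => //.
  exact: measurableX.
rewrite /rV_lebesgueS /pushforward -comp_preimage.
rewrite (_ : _ \o _ = id); last by apply/funext => z /=; rewrite rV_consK.
rewrite (product_measure1E (@lebesgue_measure R)) //.
by rewrite lte_mul_pinfty // ge0_fin_numE.
Qed.

HB.instance Definition _ := @Measure_isSigmaFinite.Build _ _ _ rV_lebesgueS
  rV_lebesgueS_sigma_finite.

End rV_lebesgueS.


(* n-dimensional Lebesgue measure on the Borel sets, as an iterated product of
   the one-dimensional one. *)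
Fixpoint rV_lebesgue (R : realType) n :
    {sigma_finite_measure set 'rV[R]_n -> \bar R} :=
  match n with
  | 0 => \d_(0 : 'rV[R]_0)
  | n'.+1 => rV_lebesgueS (rV_lebesgue R n')
  end.
Arguments rV_lebesgue {R n}.

Lemma measurable_rV_box (R : realType) n (A : 'I_n -> set R) :
  (forall i, measurable (A i)) ->
  measurable [set x : 'rV[R]_n | forall i, A i (x ord0 i)].
Proof.
move=> mA.
rewrite (_ : [set _ | _] = \bigcap_(i in [set: 'I_n]) (@rV_coord R n i @^-1` A i)).
  apply: fin_bigcap_measurable => // i _.
  by rewrite -[X in measurable X]setTI; apply: measurable_rV_coord => //; exact: mA.
by apply/seteqP; split => x /= Ax i; [move=> _; exact: Ax|exact: (Ax i I)].
Qed.

Lemma rV_lebesgue_box (R : realType) n (A : 'I_n -> set R) :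
  (forall i, measurable (A i)) ->
  rV_lebesgue [set x : 'rV[R]_n | forall i, A i (x ord0 i)] =
  (\prod_(i < n) lebesgue_measure (A i))%E.
Proof.
elim: n A => [|n IHn] A mA.
  rewrite big_ord0 [LHS]/= diracE mem_set //.
  by move=> [].
rewrite big_ord_recl -(IHn (A \o lift ord0)) => [|i]; last exact: mA.
transitivity ((@lebesgue_measure R \x @rV_lebesgue R n)%E
    (A ord0 `*` [set x : 'rV[R]_n | forall i, A (lift ord0 i) (x ord0 i)])); last first.
  apply: product_measure1E; first exact: mA.
  exact: (@measurable_rV_box R n (A \o lift ord0) (fun i => mA _)).
rewrite [LHS]/= /rV_lebesgueS /pushforward; congr (product_measure1 _ _ _).
apply/seteqP; split => -[a y] /=.
  move=> Aay; split => [|i].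
    have := Aay ord0; congr (A _ _).
    by have /(congr1 fst) := rV_consK (a, y).
  have := Aay (lift ord0 i); congr (A _ _).
  rewrite (_ : lift ord0 i = @rshift 1 n i); first exact: row_mxEr.
  exact/val_inj.
move=> [Aa Ay] i; have [j ->|->] := unliftP ord0 i.
  have := Ay j; congr (A _ _); apply/esym.
  rewrite (_ : lift ord0 j = @rshift 1 n j); first exact: row_mxEr.
  exact/val_inj.
have := Aa; congr (A _ _); apply/esym.
by have /(congr1 fst) := rV_consK (a, y).
Qed.

Definition spacetime_lebesgue (R : realType) n :
  {measure set (measurableTypeR R * 'rV[R]_n) -> \bar R} :=
  (lebesgue_measure \x rV_lebesgue)%E.
Arguments spacetime_lebesgue {R n}.

(* The Euclidean norm: the library norm on ['rV] is the sup norm. *)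
Definition enorm (R : realType) n (x : 'rV[R]_n) : R :=
  Num.sqrt (\sum_(i < n) x ord0 i ^+ 2).

(* In finite dimension, all iterated directional derivatives up to order [k]
   exist and are continuous iff [f] is of class C^k. *)
Fixpoint Ck (R : realType) (V : normedModType R) (k : nat) (f : V -> R) : Prop :=
  continuous f /\
  if k is k'.+1 then
    forall v, (forall x, derivable f x v) /\ Ck k' (fun x => 'D_v f x)
  else True.

Definition smooth (R : realType) (V : normedModType R) (f : V -> R) :=
  forall k, Ck k f.

Definition csupport (R : realType) (V : normedModType R) (f : V -> R) : set V :=
  closure [set x | f x != 0].

Definition test_fun (R : realType) n (phi : 'rV[R]_n -> R) :=
  smooth phi /\ compact (csupport phi).

(* [T] ranges over the extended reals, so that [time_ivl +oo] is [0, +oo). *)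
Definition time_ivl (R : realType) (T : \bar R) : set R :=
  [set t | 0 <= t /\ (t%:E < T)%E].

Definition spacetime (R : realType) n (T : \bar R) : set (R * 'rV[R]_n) :=
  [set z | time_ivl T z.1].

(* Elements of C_0^oo([0,T) x R^n) are smooth up to [t = 0] and need not vanish
   there; they are represented by a smooth extension to negative times, and
   only their values and derivatives at times [t >= 0] are ever used. *)
Definition spacetime_test_fun (R : realType) n (T : \bar R)
    (phi : R * 'rV[R]_n -> R) :=
  [/\ smooth phi, compact (csupport phi) &
      csupport phi `<=` [set z | (z.1%:E < T)%E]].

Definition dtime (R : realType) n (phi : R * 'rV[R]_n -> R) : R * 'rV[R]_n -> R :=
  fun z => 'D_(1, 0) phi z.

Definition dspace (R : realType) n (i : 'I_n) (phi : R * 'rV[R]_n -> R) :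
    R * 'rV[R]_n -> R :=
  fun z => 'D_(0, delta_mx ord0 i) phi z.

(* Lebesgue and Sobolev classes are represented by Borel functions; equalities
   between classes are stated almost everywhere. *)
Definition L2 (R : realType) n : set ('rV[R]_n -> R) :=
  [set f | f \in Lfun rV_lebesgue 2%:E].

Definition L2norm (R : realType) n (f : 'rV[R]_n -> R) : \bar R :=
  'N[rV_lebesgue]_2%:E[EFin \o f]%E.

Definition weak_partial (R : realType) n (i : 'I_n) (f g : 'rV[R]_n -> R) :=
  forall phi, test_fun phi ->
    \int[rV_lebesgue]_x (f x * 'D_(delta_mx ord0 i) phi x) =
    - \int[rV_lebesgue]_x (g x * phi x).

Definition H1 (R : realType) n : set ('rV[R]_n -> R) :=
  [set f | L2 f /\ forall i, exists2 g, L2 g & weak_partial i f g].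

(* The weak partial derivative of an [H1] function, unique up to null sets; the
   default value is only taken outside [H1]. *)
Definition wderiv (R : realType) n (i : 'I_n) (f : 'rV[R]_n -> R) :
    'rV[R]_n -> R :=
  xget (cst 0) [set g | L2 g /\ weak_partial i f g].

(* Equivalent to the usual Hilbert norm, and used only for convergence. *)
Definition H1norm (R : realType) n (f : 'rV[R]_n -> R) : \bar R :=
  (L2norm f + \sum_(i < n) L2norm (wderiv i f))%E.

Definition C0_L2 (R : realType) n (J : set R) (f : R -> 'rV[R]_n -> R) :=
  (forall t, J t -> L2 (f t)) /\
  (forall t, J t -> L2norm (f s \- f t) @[s --> within J (nbhs t)] --> 0%E).

Definition C0_H1 (R : realType) n (J : set R) (f : R -> 'rV[R]_n -> R) :=
  (forall t, J t -> H1 (f t)) /\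
  (forall t, J t -> H1norm (f s \- f t) @[s --> within J (nbhs t)] --> 0%E).

(* [f] belongs to C^1(J, L^2), with time derivative [ft] (one-sided at the end
   points of [J]). *)
Definition C1_L2 (R : realType) n (J : set R) (f ft : R -> 'rV[R]_n -> R) :=
  [/\ C0_L2 J f, C0_L2 J ft &
    forall t, J t ->
      L2norm ((s - t)^-1 \*: (f s \- f t) \- ft t)
        @[s --> within J t^'] --> 0%E].

Definition Lloc (R : realType) n (p : R) (D : set (R * 'rV[R]_n))
    (f : R * 'rV[R]_n -> R) :=
  measurable_fun D f /\
  forall K, compact K -> K `<=` D ->
    (\int[spacetime_lebesgue]_(z in K) (`|f z| `^ p)%:E < +oo)%E.

(* Support of a function on [D] defined up to null sets: the complement in [D]
   of the largest relatively open set on which it vanishes almost everywhere.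
   [ae] is the filter of almost-everywhere true properties of the measure. *)
Definition ess_support (R : realType) (X : topologicalType) (ae : set_system X)
    (D : set X) (f : X -> R) : set X :=
  [set x | D x /\
    forall U, open U -> U x -> ~ ae [set y | D y -> U y -> f y = 0]].

Definition supp_rV (R : realType) n (f : 'rV[R]_n -> R) : set 'rV[R]_n :=
  ess_support (almost_everywhere rV_lebesgue) setT f.

Definition supp_spacetime (R : realType) n (T : \bar R)
    (u : R -> 'rV[R]_n -> R) : set (R * 'rV[R]_n) :=
  ess_support (almost_everywhere spacetime_lebesgue) (spacetime T)
    (fun z => u z.1 z.2).

(* Weak form of w_tt - Laplacian w + b(t) w_t = F, w_t(0) = w1, where [wt] is
   the time derivative of [w]. *)
Definition weak_wave_eq (R : realType) n (T : \bar R) (b : R -> R)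
    (F : R -> 'rV[R]_n -> R) (w1 : 'rV[R]_n -> R) (w wt : R -> 'rV[R]_n -> R) :=
  forall phi, spacetime_test_fun T phi -> forall t, time_ivl T t ->
    \int[lebesgue_measure]_(s in `[0, t])
      \int[rV_lebesgue]_x (F s x * phi (s, x)) =
    \int[rV_lebesgue]_x (wt t x * phi (t, x))
    - \int[rV_lebesgue]_x (w1 x * phi (0, x))
    - \int[lebesgue_measure]_(s in `[0, t])
        \int[rV_lebesgue]_x (wt s x * dtime phi (s, x))
    + \int[lebesgue_measure]_(s in `[0, t])
        \int[rV_lebesgue]_x (\sum_(i < n) wderiv i (w s) x * dspace i phi (s, x))
    + \int[lebesgue_measure]_(s in `[0, t])
        \int[rV_lebesgue]_x (b s * wt s x * phi (s, x)).

Definition energy_solution (R : realType) n (b1 b2 : R -> R) (p q eps : R)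
    (u0 u1 v0 v1 : 'rV[R]_n -> R) (T : \bar R) (u v : R -> 'rV[R]_n -> R) :=
  (0 < T)%E /\
  exists ut vt : R -> 'rV[R]_n -> R,
    [/\ [/\ C0_H1 (time_ivl T) u, C1_L2 (time_ivl T) u ut &
            Lloc q (spacetime T) (fun z => ut z.1 z.2)],
        [/\ C0_H1 (time_ivl T) v, C1_L2 (time_ivl T) v vt &
            Lloc p (spacetime T) (fun z => vt z.1 z.2)],
        {ae rV_lebesgue, forall x, u 0 x = eps * u0 x},
        {ae rV_lebesgue, forall x, v 0 x = eps * v0 x} &
        weak_wave_eq T b1 (fun s x => `|vt s x| `^ p) (fun x => eps * u1 x) u ut
        /\
        weak_wave_eq T b2 (fun s x => `|ut s x| `^ q) (fun x => eps * v1 x) v vt].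

(* [T] is the maximal existence time of the solution [(u, v)].  Solutions are
   total functions of time whose values from [T] on are irrelevant, so a pair
   that solves the problem on [0, T) and cannot be continued as a solution
   beyond [T] has lifespan [T], whichever values it takes from [T] on. *)
Definition lifespan (R : realType) n (b1 b2 : R -> R) (p q eps : R)
    (u0 u1 v0 v1 : 'rV[R]_n -> R) (u v : R -> 'rV[R]_n -> R) (T : \bar R) :=
  energy_solution b1 b2 p q eps u0 u1 v0 v1 T u v /\
  forall T', energy_solution b1 b2 p q eps u0 u1 v0 v1 T' u v -> (T' <= T)%E.

Definition Lambda (R : realType) (n : nat) (p q : R) : R :=
  (p + 1) / (p * q - 1) - (n%:R - 1) / 2.

Definition Upsilon (R : realType) (n : nat) (p q : R) : R :=
  Num.max (Lambda n p q) (Lambda n q p).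

(* Damping coefficients in C([0,oo)) and L^1([0,oo)), nonnegative. *)
Definition damping (R : realType) (b : R -> R) :=
  [/\ {within `[0, +oo[, continuous b},
      forall t, 0 <= t -> 0 <= b t &
      lebesgue_measure.-integrable `[0, +oo[ (EFin \o b)].

Definition nonneg_ae (R : realType) n (f : 'rV[R]_n -> R) :=
  {ae rV_lebesgue, forall x, 0 <= f x}.

Definition compactly_supported_in_ball (R : realType) n (r : R)
    (f : 'rV[R]_n -> R) :=
  compact (supp_rV f) /\ supp_rV f `<=` [set x | enorm x <= r].

(* Main.v *)
(* Each equation is paired with the plane wave W(t, x) = exp(x_0 - t), a positive
   solution of the free wave equation whose mass on the cone |x| <= t + r is
   O((1 + t)^((n - 1) / 2)).  Since the damping is summable, the functional
   int u_t W dominates a constant times X(t) = eps int u_1 W(0, .) +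
   int_0^t int |v_t|^p W, and int v_t W dominates the corresponding Y(t).
   Jensen's inequality on the cone turns this into X' >= c (1 + t)^-a Y^p and
   Y' >= c (1 + t)^-d X^q with a = (n - 1)(p - 1) / 2, d = (n - 1)(q - 1) / 2.
   Iterating the two inequalities inside [t, 2 t] shows that X(2 t) cannot be
   finite once X(t)^(pq - 1) t^E, E = 1 + p - (a + p d) = (pq - 1) Lambda, exceeds
   a constant.  This gives the bound when Lambda > 0; when Lambda = 0, a single
   pass gives X(2 t) >= X(t) + k X(t)^(pq), which reaches that constant after
   O(eps^-(pq - 1)) doublings (with exponent p instead of pq when p = q). *)

Require Import Defs.
From HB Require Import structures.
From mathcomp Require Import all_boot all_order all_algebra.
From mathcomp Require Import all_classical all_reals all_analysis.
From mathcomp Require Import measurable_realfun.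
From mathcomp Require Import ring lra.
Import Order.TTheory GRing.Theory Num.Theory.
Import numFieldNormedType.Exports.
Local Open Scope classical_set_scope.
Local Open Scope ring_scope.

Set Implicit Arguments.
Unset Strict Implicit.
Unset Printing Implicit Defensive.

(** * Coupled growth inequalities and dyadic iteration *)

(** A wave depending on one coordinate has explicit derivatives and a mass that reduces to an
    integral over slices, so no spherical means are needed. It is not compactly supported, hence it
    is cut off beyond a radius [rho > t1 + r], where the solution vanishes up to time [t1]. As [rho]
    depends on [t1], every constant has to be shown independent of it. The support hypothesis
    concerns a class of functions on space-time and must first be transferred to each time slice of
    [u] and of its time derivative. Write A and B for the means of [u] and [ut] against the wave and
    P for the integrated source. Then A' = B - A and (A + B - P)' = - b B. Without damping and
    source, A + B is constant and B relaxes to (A + B) / 2, whence the 2 in [damping_factor]; the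
    multiplier exp (int_0^t b) absorbs the damping as long as B is nonnegative. The source is merely
    integrable in time, so only B - P is differentiated and the growth inequalities are kept in
    integrated form. All bounds hold for each [t1] below the lifespan, which yields its finiteness
    as well. *)

Lemma powR_le (R : realType) (r x y : R) :
  0 <= r -> 0 <= x -> x <= y -> x `^ r <= y `^ r.
Proof.
move=> r0 x0 xy; apply: ge0_ler_powR => //; rewrite nnegrE//.
exact: le_trans xy.
Qed.

Lemma powR_add (R : realType) (x r s : R) :
  0 < x -> x `^ (r + s) = x `^ r * x `^ s.
Proof. by move=> x0; rewrite powRD//; apply/implyP => _; rewrite gt_eqF. Qed.

Lemma powRXn (R : realType) (x s : R) j : 0 <= x -> (x ^+ j) `^ s = (x `^ s) ^+ j.
Proof.
move=> x0; rewrite -(powR_mulrn _ x0) -(powR_mulrn j (powR_ge0 x s)).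
exact: powRAC.
Qed.

Lemma powRV (R : realType) (x s : R) : 0 <= x -> (x^-1) `^ s = (x `^ s)^-1.
Proof. by move=> x0; rewrite -powR_inv1// -powRrM mulN1r powRN. Qed.

Lemma powRN_le (R : realType) (r x y : R) :
  0 <= r -> 0 < x -> x <= y -> y `^ (- r) <= x `^ (- r).
Proof.
move=> r0 x0 xy; have y0 : 0 < y by exact: lt_le_trans xy.
by rewrite !powRN lef_pV2 ?posrE ?powR_gt0//; apply: powR_le => //; exact: ltW.
Qed.

Lemma powRN_ge1 (R : realType) (x s : R) :
  0 < x -> x <= 1 -> 0 <= s -> 1 <= x `^ (- s).
Proof. by move=> x0 x1 s0; have := powRN_le s0 x0 x1; rewrite powR1. Qed.

Lemma lt_powRV (R : realType) (x m K : R) :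
  0 < m -> 0 < K -> x `^ m < K -> x < K `^ m^-1.
Proof.
move=> m0 K0; rewrite !ltNge; apply: contra => Kx.
rewrite -[K](powRr1 (ltW K0)) -(mulVf (lt0r_neq0 m0)) powRrM.
by apply: powR_le Kx; rewrite ?powR_ge0 ?(ltW m0).
Qed.

(** Integrated form of X' >= c (1 + t)^-a Y^p. The weight is taken at the right end and [Y] at the
    left end, where they are smallest, so neither differentiability nor continuity of [X] and [Y] is
    asked for. *)
Definition power_growth (R : realType) (c a p t1 : R) (X Y : R -> R) :=
  forall s t, 0 <= s -> s <= t -> t <= t1 ->
    X s + c * (t - s) * (1 + t) `^ (- a) * (Y s) `^ p <= X t.

Section growth.
Context (R : realType).
Implicit Types (p q a d c : R) (X Y : R -> R).

Lemma power_growth_homo c a p t1 X Y : 0 <= c -> power_growth c a p t1 X Y ->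
  forall s t, 0 <= s -> s <= t -> t <= t1 -> X s <= X t.
Proof.
move=> c0 g s t s0 st tt1; apply: le_trans (g _ _ s0 st tt1).
by rewrite lerDl !mulr_ge0 ?powR_ge0// subr_ge0.
Qed.

(* [Y] gains on [s, s + h], then [X] on [s + h, s + 2 h]; up to time
   [2 t] the weights are bounded below by powers of [3 t]. *)
Lemma power_growth_step p q a d c X Y t1 t s h :
  1 < p -> 1 < q -> 0 <= a -> 0 <= d -> 0 < c ->
  power_growth c a p t1 X Y -> power_growth c d q t1 Y X ->
  0 <= X 0 -> 0 <= Y 0 ->
  1 <= t -> t <= s -> 0 <= h -> s + h *+ 2 <= 2 * t -> 2 * t <= t1 ->
  X s + c * c `^ p * 3 `^ (- (a + p * d)) * t `^ (- (a + p * d))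
        * h `^ (1 + p) * X s `^ (p * q) <= X (s + h *+ 2).
Proof.
move=> p1 q1 a0 d0 c0 gX gY X0 Y0 t1' ts h0 sh tt1.
have s0 : 0 <= s by lra.
have hh : h *+ 2 = h + h by rewrite mulr2n.
have Xs : 0 <= X s.
  by apply: le_trans X0 _; apply: (power_growth_homo (ltW c0) gX) => //; lra.
have Ys : 0 <= Y s.
  by apply: le_trans Y0 _; apply: (power_growth_homo (ltW c0) gY) => //; lra.
have t0 : 0 < t by lra.
have weight b u : 0 <= b -> 0 <= u -> u <= 2 * t ->
    (3 * t) `^ (- b) <= (1 + u) `^ (- b).
  by move=> b0 u0 u2; apply: powRN_le b0 _ _; lra.
have Y1 : c * h * (3 * t) `^ (- d) * X s `^ q <= Y (s + h).
  have /(le_trans _) : Y s + c * (s + h - s) * (1 + (s + h)) `^ (- d) * X s `^ q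
      <= Y (s + h) by apply: gY => //; lra.
  apply; rewrite [s + h - s](_ : _ = h); last by ring.
  rewrite -[leLHS]add0r lerD// ler_wpM2r ?powR_ge0// ler_wpM2l ?weight//.
  - by rewrite mulr_ge0// ltW.
  - by rewrite addr_ge0.
  - by rewrite hh in sh; lra.
have Xh : X s <= X (s + h).
  by apply: (power_growth_homo (ltW c0) gX) => //; lra.
have /(le_trans _) : X (s + h) + c * (s + h *+ 2 - (s + h)) *
    (1 + (s + h *+ 2)) `^ (- a) * Y (s + h) `^ p <= X (s + h *+ 2).
  by apply: gX; lra.
apply; rewrite lerD//.
have -> : s + h *+ 2 - (s + h) = h by rewrite hh; ring.
apply: (@le_trans _ _ (c * h * (3 * t) `^ (- a) *
    (c * h * (3 * t) `^ (- d) * X s `^ q) `^ p)); last first.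
  have ? : 0 <= c * h by rewrite mulr_ge0// ltW.
  apply: ler_pM.
  - by rewrite mulr_ge0 ?powR_ge0.
  - exact: powR_ge0.
  - by rewrite ler_wpM2l// weight//; lra.
  - by rewrite powR_le// ?mulr_ge0 ?powR_ge0//; lra.
have p3 b : 0 <= (3 * t) `^ b by exact: powR_ge0.
have ch : 0 <= c * h by rewrite mulr_ge0// ltW.
rewrite (@powRM _ _ _ _ (mulr_ge0 ch (p3 _)) (powR_ge0 _ _)).
rewrite (@powRM _ _ _ p ch (p3 _)) (@powRM _ _ _ p (ltW c0) h0).
rewrite !(@powRM _ 3 t _ (ler0n _ _) (ltW t0)).
rewrite (@powRM _ _ _ p (powR_ge0 _ _) (powR_ge0 _ _)) -!powRrM.
(* Splitting [h ^ (1 + p)] into [h * h ^ p] by [powR_add] requires a positive base. *)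
have [->|hn0] := eqVneq h 0.
  by rewrite powR0 ?mulr0 ?mul0r//; lra.
have hp : 0 < h by rewrite lt_neqAle eq_sym hn0.
have -> : - (a + p * d) = - a + (- d) * p by ring.
rewrite !powR_add// powRr1// [q * p]mulrC.
set A := _ `^ _; set B := _ `^ _; set C := _ `^ _.
by rewrite le_eqVlt; apply/orP; left; apply/eqP; ring.
Qed.

(** If the bound failed at [t], the double steps between the times [t * (2 - 2 ^ -j)] would each
    multiply [X] by at least a fixed [L > 1]. All these times stay below [2 * t], so [X (2 * t)]
    would exceed every [X t * L ^ j]. *)
Lemma power_growth_blowup p q a d c :
  1 < p -> 1 < q -> 0 <= a -> 0 <= d -> 0 < c ->
  exists2 K : R, 0 < K & forall X Y t1 t,
    power_growth c a p t1 X Y -> power_growth c d q t1 Y X ->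
    0 < X 0 -> 0 <= Y 0 -> 1 <= t -> 2 * t <= t1 ->
    X t `^ (p * q - 1) * t `^ (1 + p - (a + p * d)) < K.
Proof.
move=> p1 q1 a0 d0 c0.
have pq1 : 1 < p * q by nra.
set m := p * q - 1; have m0 : 0 < m by rewrite /m; lra.
have [k [k0 kE]] : exists k, 0 < k /\ c * c `^ p * 3 `^ (- (a + p * d)) = k.
  by eexists; split; last reflexivity; rewrite !mulr_gt0 ?powR_gt0//; lra.
(* Halving the step length costs a factor [2 ^ (1 + p)] in the gain, while multiplying [X] by [L]
   brings back [L ^ m] relative to linear growth. This [L] makes the two cancel exactly. *)
pose L := 2 `^ ((1 + p) / m).
have L1 : 1 < L.
  rewrite -(powRr0 2) /L /powR; case: ifP => [/eqP|_]; first by lra.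
  by rewrite ltr_expR mul0r mulr_gt0 ?ln_gt0 ?divr_gt0//; lra.
have L0 : 0 < L by lra.
have Lm : L `^ m = 2 `^ (1 + p) by rewrite /L -powRrM divfK// gt_eqF.
(* The initial step length is [t / 4], whence the power of 4; with this threshold the first double
   step already gains the factor [L]. *)
exists (L * 4 `^ (1 + p) / k); first by rewrite divr_gt0// mulr_gt0// powR_gt0.
move=> X Y t1 t gX gY X0 Y0 t1' tt1; rewrite ltNge; apply/negP => big.
have t0 : 0 < t by lra.
pose s j := t * (2 - 2^-1 ^+ j).
have half j : 0 < (2^-1 : R) ^+ j <= 1.
  by rewrite exprn_gt0 ?exprn_ile1//=; lra.
have Xt : 0 < X t.
  by apply: lt_le_trans X0 _; apply: (power_growth_homo (ltW c0) gX); lra.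
have main j : X t * L ^+ j <= X (s j).
  elim: j => [|j IH].
    by rewrite expr0 mulr1 /s expr0 (_ : 2 - 1 = 1 :> R) ?mulr1//; lra.
  have /andP[h0 h1] := half j.
  pose h := t * 4^-1 * 2^-1 ^+ j.
  have sj : s j.+1 = s j + h *+ 2 by rewrite /s /h exprS mulr2n; field.
  rewrite sj.
  have := @power_growth_step p q a d c X Y t1 t (s j) h p1 q1 a0 d0 c0 gX gY.
  have hge0 : 0 <= h by rewrite !mulr_ge0 ?ltW//; lra.
  move=> /(_ (ltW X0) Y0 t1').
  have ts : t <= s j by rewrite /s; nra.
  have st2 : s j + h *+ 2 <= 2 * t.
    by have := half j.+1; rewrite -sj /s; nra.
  move=> /(_ ts hge0 st2 tt1); rewrite kE; apply: le_trans.
  have Xtj : 0 < X t * L ^+ j by rewrite mulr_gt0// exprn_gt0.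
  have Xs0 : 0 < X (s j) by exact: lt_le_trans IH.
  (* The old value [X (s j)] is dropped: the gain alone exceeds [L] times the lower bound. *)
  rewrite -[leLHS]add0r lerD ?(ltW Xs0)//.
  apply: (@le_trans _ _ (k * t `^ (- (a + p * d)) * h `^ (1 + p) *
     (X t * L ^+ j) `^ (p * q))); last first.
    apply: ler_wpM2l; first by rewrite !mulr_ge0 ?powR_ge0 ?(ltW k0)//.
    by apply: powR_le => //; [lra|exact: ltW].
  have i4 : 0 <= (4^-1 : R) by rewrite invr_ge0.
  rewrite /h [(_ * 2^-1 ^+ j) `^ _]powRM ?mulr_ge0 ?(ltW t0) ?(ltW h0)//.
  rewrite [(t * _) `^ _]powRM ?(ltW t0)//.
  have -> : p * q = m + 1 by rewrite /m; ring.
  rewrite (@powR_add _ _ m 1 Xtj) powRr1 ?(ltW Xtj)//.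
  rewrite [(X t * _) `^ m]powRM ?(ltW Xt) ?exprn_ge0 ?(ltW L0)//.
  rewrite !powRXn ?invr_ge0 ?(ltW L0)// !powRV// Lm exprVn.
  have f0 : 0 < (4 : R) `^ (1 + p) by rewrite powR_gt0.
  move: big; rewrite (powR_add _ _ t0) (ler_pdivrMr _ _ k0) exprS.
  have g0 : 0 < ((2 : R) `^ (1 + p)) ^+ j by rewrite exprn_gt0// powR_gt0.
  set u := X t `^ m; set v := 4 `^ _; set w := (2 `^ _) ^+ j.
  set z := t `^ (- _); set y := t `^ _ => big.
  have -> : k * z * (y * v^-1 * w^-1) * (u * w * (X t * L ^+ j))
     = k * z * y * u / v * (X t * L ^+ j).
    by field; rewrite !gt_eqF.
  rewrite mulrCA ler_wpM2r ?(ltW Xtj)// ler_pdivlMr//.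
  by apply: le_trans big _; rewrite le_eqVlt; apply/orP; left; apply/eqP; ring.
have bound j : X t * L ^+ j <= X (2 * t).
  apply: le_trans (main j) _; apply: (power_growth_homo (ltW c0) gX) => //.
    by rewrite mulr_ge0 ?(ltW t0)//; have := half j; lra.
  by rewrite /s; have := half j; nra.
have bern j : 1 + (L - 1) * j%:R <= L ^+ j.
  elim: j => [|j IH]; first by rewrite mulr0 addr0 expr0.
  rewrite exprS -natr1; apply: (@le_trans _ _ (L * (1 + (L - 1) * j%:R))).
    have : 0 <= (L - 1) * (L - 1) * j%:R by rewrite !mulr_ge0//; lra.
    nra.
  by rewrite ler_pM2l.
have : exists j : nat, X (2 * t) < X t * (1 + (L - 1) * j%:R).
  exists (Num.bound (`|X (2 * t)| / (X t * (L - 1)))).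
  have L10 : 0 <= L - 1 by lra.
  have := archi_boundP (divr_ge0 (normr_ge0 (X (2 * t)))
    (mulr_ge0 (ltW Xt) L10)).
  rewrite ltr_pdivrMr ?mulr_gt0//; last lra.
  set b := _%:R; move=> H1.
  apply: le_lt_trans (ler_norm _) _; apply: lt_trans H1 _; nra.
move=> [j]; apply/negP; rewrite -leNgt; apply: le_trans (bound j).
by rewrite ler_pM2l.
Qed.

(* [x ^ (1 - m)] decreases by a fixed amount at each step as long as [x < K]. *)
Lemma superlinear_recurrence (m k K : R) : 1 < m -> 0 < k -> 0 < K ->
  exists2 C : R, 0 < C & forall (x : nat -> R) (e : R) N,
    0 < e -> e <= x 0%N ->
    (forall j, (j < N)%N -> x j + k * x j `^ m <= x j.+1) ->
    C * e `^ (- (m - 1)) <= N%:R ->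
    exists2 j, (j <= N)%N & K <= x j.
Proof.
move=> m1 k0 K0; set s := m - 1; have s0 : 0 < s by rewrite /s; lra.
pose Z := K `^ s; have Z0 : 0 < Z by exact: powR_gt0.
(* With y = x^s <= Z, the inequality ln (1 + v) >= v / (1 + v) at v = k y gives ln (1 + k y) >= k1
   y. Then exp (- w) <= 1 / (1 + w) = 1 - w / (1 + w) at w = s k1 y gives (1 + k y)^-s <= 1 - k2 y.
   Multiplied by x^-s = 1 / y, this is a decrease by [k2]. *)
pose k1 := k / (1 + k * Z).
have kZ : 0 < 1 + k * Z by rewrite addr_gt0 ?mulr_gt0.
have k10 : 0 < k1 by exact: divr_gt0.
have sk1 : 0 < s * k1 by exact: mulr_gt0.
have skZ : 0 < 1 + s * k1 * Z by rewrite addr_gt0 ?(mulr_gt0 sk1 Z0).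
pose k2 := s * k1 / (1 + s * k1 * Z).
have k20 : 0 < k2 by exact: divr_gt0.
exists k2^-1; first by rewrite invr_gt0.
move=> x e N e0 ex rec big; apply: contrapT => none.
have xK j : (j <= N)%N -> x j < K.
  by move=> jN; rewrite ltNge; apply/negP => Kx; apply: none; exists j.
have xe j : (j <= N)%N -> e <= x j.
  elim: j => // j IH jN; apply: le_trans (IH (ltnW jN)) _.
  by apply: le_trans (rec _ jN); rewrite lerDl mulr_ge0 ?powR_ge0 ?ltW.
have bnd j : (j <= N)%N -> x j `^ (- s) <= e `^ (- s) - k2 * j%:R.
  elim: j => [_|j IH jN].
    by rewrite mulr0 subr0; apply: powRN_le => //; exact: ltW.
  have := IH (ltnW jN); set z := x j.
  have z0 : 0 < z by apply: lt_le_trans (xe _ (ltnW jN)).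
  have zK : z < K by exact: xK (ltnW jN).
  have := rec _ jN; rewrite -/z.
  have -> : m = 1 + s by rewrite /s; ring.
  rewrite powR_add// powRr1 ?(ltW z0)//.
  set y := z `^ s; have y0 : 0 < y by exact: powR_gt0.
  have yZ : y <= Z by rewrite /y /Z; apply: powR_le; rewrite ?ltW.
  have -> : z + k * (z * y) = z * (1 + k * y) by ring.
  have ky : 0 < 1 + k * y by rewrite addr_gt0 ?mulr_gt0.
  move=> step IHj.
  apply: (@le_trans _ _ ((z * (1 + k * y)) `^ (- s))).
    have zk : 0 < z * (1 + k * y) by exact: mulr_gt0.
    by apply: powRN_le step => //; exact: ltW.
  rewrite powRM ?(ltW z0) ?(ltW ky)//.
  have expo : (1 + k * y) `^ (- s) <= 1 - k2 * y.
    have lnk : k1 * y <= ln (1 + k * y).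
      have : ln (1 + k * y)^-1 <= (1 + k * y)^-1 - 1.
        have := @le_ln1Dx R ((1 + k * y)^-1 - 1).
        rewrite [1 + (_ - 1)]addrC subrK.
        by apply; rewrite ltrBrDr addNr invr_gt0.
      rewrite lnV ?posrE// lerNl; apply: le_trans.
      have -> : - ((1 + k * y)^-1 - 1) = k * y / (1 + k * y).
        by field; rewrite gt_eqF.
      rewrite /k1 mulrAC ler_pM2l ?mulr_gt0// lef_pV2 ?posrE//.
      by rewrite lerD2l ler_pM2l.
    have -> : (1 + k * y) `^ (- s) = (expR (s * ln (1 + k * y)))^-1.
      by rewrite powRN /powR gt_eqF.
    have sk : 0 < 1 + s * (k1 * y) by rewrite mulrA addr_gt0 ?(mulr_gt0 sk1 y0).
    apply: (@le_trans _ _ (1 + s * (k1 * y))^-1).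
      rewrite lef_pV2 ?posrE ?expR_gt0//.
      by apply: le_trans (expR_ge1Dx _); rewrite lerD2l ler_pM2l.
    have -> : (1 + s * (k1 * y))^-1 = 1 - s * k1 / (1 + s * (k1 * y)) * y.
      by field; rewrite gt_eqF.
    rewrite lerD2l lerN2 ler_pM2r// /k2 (ler_pM2l sk1).
    by rewrite lef_pV2 ?posrE// lerD2l mulrA (ler_pM2l sk1).
  apply: (@le_trans _ _ (z `^ (- s) * (1 - k2 * y))).
    by rewrite ler_wpM2l ?powR_ge0.
  have -> : z `^ (- s) * (1 - k2 * y) = z `^ (- s) - k2.
    by rewrite powRN -/y; field; rewrite gt_eqF.
  by rewrite -natr1; lra.
have : 0 < x N `^ (- s) by rewrite powR_gt0//; apply: lt_le_trans (xe N _).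
have := bnd N (leqnn _).
have : e `^ (- s) <= k2 * N%:R by rewrite -ler_pdivrMl.
lra.
Qed.

(** Sampling [x] at the times [2 ^ j] turns the doubling inequality into [superlinear_recurrence].
    The number of samples below [t1] is logarithmic in [t1], so a bound on it becomes an exponential
    bound on [t1]. *)
Lemma dyadic_lifespan (m k K c1 : R) : 1 < m -> 0 < k -> 0 < K -> 0 < c1 ->
  exists2 C : R, 0 < C & forall (x : R -> R) (e t1 : R),
    0 < e -> e <= 1 -> c1 * e <= x 1 ->
    (forall t, 1 <= t -> 2 * t <= t1 -> x t + k * x t `^ m <= x (2 * t)) ->
    (forall t, 1 <= t -> 2 * t <= t1 -> x t < K) ->
    t1 <= expR (C * e `^ (- (m - 1))).
Proof.
move=> m1 k0 K0 c10.
have [C0 C00 rec] := superlinear_recurrence m1 k0 K0.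
pose D := C0 * c1 `^ (- (m - 1)).
have D0 : 0 < D by rewrite mulr_gt0 ?powR_gt0.
have l2 : 0 < ln (2 : R) by rewrite ln_gt0 ?ltr1n.
(* The recurrence takes N <= D w + 1 doublings with w = e^-(m - 1), and the last one has to end
   before [t1], so 2^(N + 1) <= t1 is needed. Since e <= 1 gives w >= 1, N + 1 <= (D + 2) w. *)
exists ((D + 2) * ln 2); first by rewrite mulr_gt0// addr_gt0.
move=> x e t1 e0 e1 xe step xK; rewrite leNgt; apply/negP => big.
set w := e `^ (- (m - 1)) in big.
have w1 : 1 <= w.
  by apply: powRN_ge1 => //; lra.
have Dw0 : 0 <= D * w by rewrite mulr_ge0 ?ltW//; lra.
pose N := (Num.truncn (D * w)).+1.
have NDw : D * w <= N%:R by rewrite ltW// /N truncnS_gt.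
have NDw1 : N%:R <= D * w + 1 by rewrite /N -natr1 lerD2r truncn_le.
have tN : 2 * 2 ^+ N <= t1.
  rewrite -exprS; apply: le_trans (ltW big).
  have -> : (2 : R) ^+ N.+1 = expR (ln 2 * N.+1%:R).
    by rewrite expRM lnK ?posrE// powR_mulrn.
  rewrite ler_expR mulrC [leRHS]mulrAC (ler_pM2r l2) -natr1.
  by apply: (@le_trans _ _ (D * w + 2)); [lra|nra].
have pow1 j : 1 <= (2 : R) ^+ j by rewrite exprn_ege1// ler1n.
have powN j : (j <= N)%N -> 2 * (2 : R) ^+ j <= t1.
  move=> jN; apply: le_trans tN; rewrite ler_pM2l//.
  by rewrite ler_weXn2l// ler1n.
have [j jN] : exists2 j, (j <= N)%N & K <= x (2 ^+ j).
  apply: (rec (fun j => x (2 ^+ j)) (c1 * e)) => //.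
  - by rewrite mulr_gt0.
  - by move=> j jN; rewrite exprS step// powN// ltnW.
  - by rewrite powRM ?(ltW e0) ?(ltW c10)// mulrA.
by rewrite leNgt xK// powN.
Qed.

(** At the time t = B e^(- m / E) the powers of [e] in (c1 e)^m t^E cancel, and [B] is large enough
    for the product to reach the threshold of [power_growth_blowup]. The maximum with 1 in [B]
    ensures t >= 1 for e <= 1, and the factor 2 in the constant leaves room for the interval
    [t, 2 t]. *)
Lemma lifespan_subcritical p q a d c c1 :
  1 < p -> 1 < q -> 0 <= a -> 0 <= d -> 0 < c -> 0 < c1 ->
  0 < 1 + p - (a + p * d) ->
  exists2 C : R, 0 < C & forall X Y e t1,
    0 < e -> e <= 1 ->
    power_growth c a p t1 X Y -> power_growth c d q t1 Y X ->
    c1 * e <= X 0 -> 0 <= Y 0 ->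
    t1 <= C * e `^ (- ((p * q - 1) / (1 + p - (a + p * d)))).
Proof.
move=> p1 q1 a0 d0 c0 c10 E0.
have [K K0 blow] := power_growth_blowup p1 q1 a0 d0 c0.
set E := 1 + p - (a + p * d) in E0 blow *; set m := p * q - 1 in blow *.
have m0 : 0 < m by rewrite /m; nra.
pose B := Num.max 1 ((K / c1 `^ m) `^ E^-1).
have B1 : 1 <= B by rewrite le_max lexx.
have B0 : 0 < B by lra.
have BE : K / c1 `^ m <= B `^ E.
  have Kc : 0 <= K / c1 `^ m by rewrite divr_ge0 ?powR_ge0 ?(ltW K0).
  rewrite -[leLHS](powRr1 Kc) -(mulVf (lt0r_neq0 E0)) powRrM.
  by apply: powR_le; rewrite ?powR_ge0 ?(ltW E0)// le_max lexx orbT.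
exists (2 * B); first by rewrite mulr_gt0.
move=> X Y e t1 e0 e1 gX gY X0 Y0; rewrite leNgt -mulrA; apply/negP => big.
set t := B * _ in big.
have w1 : 1 <= e `^ (- (m / E)).
  by apply: powRN_ge1 => //; rewrite divr_ge0 ?ltW.
have t1' : 1 <= t by rewrite /t; nra.
have X00 : 0 < X 0 by apply: lt_le_trans X0; exact: mulr_gt0.
have := blow X Y t1 t gX gY X00 Y0 t1' (ltW big).
apply/negP; rewrite -leNgt.
apply: (@le_trans _ _ ((c1 * e) `^ m * t `^ E)).
  rewrite /t !powRM ?powR_ge0 ?(ltW B0) ?(ltW c10) ?(ltW e0)//.
  rewrite -[(e `^ _) `^ E]powRrM mulNr divfK ?gt_eqF// powRN.
  move: BE; rewrite ler_pdivrMr ?powR_gt0// => /le_trans; apply.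
  rewrite le_eqVlt; apply/orP; left; apply/eqP.
  by field; rewrite gt_eqF ?powR_gt0.
rewrite ler_wpM2r ?powR_ge0// powR_le ?mulr_ge0 ?(ltW m0) ?(ltW c10) ?(ltW e0)//.
apply: le_trans X0 _; apply: (power_growth_homo (ltW c0) gX) => //; lra.
Qed.

(** When the exponent E vanishes, one double step across [t, 2 t] has a gain in which all powers of
    [t] cancel. The doubling inequality is then autonomous, with exponent [p * q], and the blow-up
    threshold no longer depends on time. *)
Lemma lifespan_critical p q a d c c1 :
  1 < p -> 1 < q -> 0 <= a -> 0 <= d -> 0 < c -> 0 < c1 ->
  1 + p - (a + p * d) = 0 ->
  exists2 C : R, 0 < C & forall X Y e t1,
    0 < e -> e <= 1 ->
    power_growth c a p t1 X Y -> power_growth c d q t1 Y X ->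
    c1 * e <= X 0 -> 0 <= Y 0 ->
    t1 <= expR (C * e `^ (- (p * q - 1))).
Proof.
move=> p1 q1 a0 d0 c0 c10 E0.
have [K K0 blow] := power_growth_blowup p1 q1 a0 d0 c0.
have m0 : 1 < p * q by nra.
(* Gain constant of [power_growth_step] for h = t / 2; the last factor is the one coming from h^(1 +
   p). *)
pose k := c * c `^ p * 3 `^ (- (a + p * d)) * 2^-1 `^ (1 + p).
have k0 : 0 < k by rewrite /k !mulr_gt0 ?powR_gt0.
have KK0 : 0 < K `^ (p * q - 1)^-1 by exact: powR_gt0.
have [C C0 dya] := dyadic_lifespan m0 k0 KK0 c10.
exists C => // X Y e t1 e0 e1 gX gY X0 Y0.
have [t12|t12] := leP t1 1.
  apply: le_trans t12 _; rewrite -expR0 ler_expR.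
  by rewrite mulr_ge0 ?powR_ge0// ltW.
have X00 : 0 < X 0 by apply: lt_le_trans X0; exact: mulr_gt0.
apply: (dya X) => //.
- by apply: le_trans X0 _; apply: (power_growth_homo (ltW c0) gX) => //; lra.
- move=> t t1' tt1.
  have t0 : 0 < t by lra.
  have := @power_growth_step p q a d c X Y t1 t t (2^-1 * t) p1 q1 a0 d0 c0 gX
    gY (ltW X00) Y0 t1' (lexx _).
  have -> : t + (2^-1 * t) *+ 2 = 2 * t by rewrite mulr2n; field.
  move=> /(_ _ (lexx _) tt1)/wrap[|]; first by rewrite mulr_ge0// ltW.
  rewrite powRM ?invr_ge0 ?(ltW t0)//; apply: le_trans.
  rewrite lerD2l le_eqVlt; apply/orP; left; apply/eqP.
  set z := X t `^ _; set y := 2^-1 `^ _.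
  have : t `^ (- (a + p * d)) * t `^ (1 + p) = 1.
    by rewrite -powR_add// addrC E0 powRr0.
  set A := t `^ _; set B := t `^ _ => AB; rewrite /k -/y.
  rewrite -[X in X * y * z]mulr1 -AB; ring.
- move=> t t1' tt1.
  have := blow X Y t1 t gX gY X00 Y0 t1' tt1.
  by rewrite E0 powRr0 mulr1; apply: lt_powRV => //; rewrite subr_gt0.
Qed.

(** Both inequalities now have the same exponent, so min (X, Y) satisfies a single one. It gains
    with power [p] over one doubling, instead of [p * p] after passing through the other unknown,
    and this improves the exponent of the lifespan. *)
Lemma lifespan_critical_diag p c c1 : 1 < p -> 0 < c -> 0 < c1 ->
  exists2 C : R, 0 < C & forall X Y e t1,
    0 < e -> e <= 1 ->
    power_growth c 1 p t1 X Y -> power_growth c 1 p t1 Y X ->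
    c1 * e <= X 0 -> c1 * e <= Y 0 ->
    t1 <= expR (C * e `^ (- (p - 1))).
Proof.
move=> p1 c0 c10.
have [K K0 blow] := power_growth_blowup p1 p1 ler01 ler01 c0.
have m0 : 1 < p * p by nra.
(* The 3 comes from t / (1 + 2 t) >= 1 / 3 for t >= 1, the length of [t, 2 t] times the weight at
   its right end. *)
have k0 : 0 < c / 3 by rewrite divr_gt0.
have KK0 : 0 < K `^ (p * p - 1)^-1 by exact: powR_gt0.
have [C C0 dya] := dyadic_lifespan p1 k0 KK0 c10.
exists C => // X Y e t1 e0 e1 gX gY X0 Y0.
have [t12|t12] := leP t1 1.
  apply: le_trans t12 _; rewrite -expR0 ler_expR.
  by rewrite mulr_ge0 ?powR_ge0// ltW.
have X00 : 0 < X 0 by apply: lt_le_trans X0; exact: mulr_gt0.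
have Y00 : 0 < Y 0 by apply: lt_le_trans Y0; exact: mulr_gt0.
have step (U V : R -> R) t : power_growth c 1 p t1 U V -> 0 <= U t -> 0 <= V t ->
    1 <= t -> 2 * t <= t1 ->
    Num.min (U t) (V t) + c / 3 * Num.min (U t) (V t) `^ p <= U (2 * t).
  move=> gU U0 V0 t1' tt1; have := gU t (2 * t).
  have t0 : 0 <= t by lra.
  have t2 : t <= 2 * t by lra.
  move=> /(_ t0 t2 tt1); apply: le_trans; rewrite lerD ?ge_min ?lexx//.
  apply: ler_pM; rewrite ?powR_ge0 ?(ltW k0)//.
    rewrite powR_inv1; last lra.
    rewrite -mulrA ler_pM2l// ler_pdivlMr; last lra.
    lra.
  by apply: powR_le; rewrite ?le_min ?U0 ?ge_min ?lexx ?orbT//; lra.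
have pos t : 1 <= t -> t <= t1 -> 0 < X t /\ 0 < Y t.
  move=> t1' tt1; have t0 : 0 <= t by lra.
  split; [apply: lt_le_trans X00 _|apply: lt_le_trans Y00 _].
    exact: (power_growth_homo (ltW c0) gX).
  exact: (power_growth_homo (ltW c0) gY).
apply: (dya (fun t => Num.min (X t) (Y t))) => //.
- rewrite le_min; apply/andP; split.
    by apply: le_trans X0 _; apply: (power_growth_homo (ltW c0) gX) => //; lra.
  by apply: le_trans Y0 _; apply: (power_growth_homo (ltW c0) gY) => //; lra.
- move=> t t1' tt1; have [|Xt Yt] := pos t t1'; first lra.
  by rewrite le_min; apply/andP; split; [|rewrite minC];
    apply: step => //; exact: ltW.
- move=> t t1' tt1; have [|Xt Yt] := pos t t1'; first lra.
  rewrite gt_min; apply/orP; left.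
  have := blow X Y t1 t gX gY X00 (ltW Y00) t1' tt1.
  have -> : 1 + p - (1 + p * 1) = 0 by ring.
  by rewrite powRr0 mulr1; apply: lt_powRV => //; rewrite subr_gt0.
Qed.

End growth.

(** * A damped linear ODE *)

Lemma is_derive_ndecr (R : realType) (f df : R -> R) (a b : R) :
  (forall x, a < x < b -> is_derive x 1 f (df x)) ->
  (forall x, a < x < b -> 0 <= df x) ->
  {within `[a, b], continuous f} ->
  forall x y, a <= x -> x <= y -> y <= b -> f x <= f y.
Proof.
move=> dfE df0 cf; apply: ger0_derive1_ndecr cf => x; rewrite in_itv/= => xab.
- by have := dfE x xab; case.
- by rewrite derive1E; have := dfE x xab => -[_ ->]; exact: df0.
Qed.

Section damped_ode.
Context (R : realType) (t1 K : R) (A B P M b : R -> R).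
Hypotheses (t1_ge0 : 0 <= t1)
  (cA : {within `[0, t1], continuous A}) (cB : {within `[0, t1], continuous B})
  (cP : {within `[0, t1], continuous P}) (cM : {within `[0, t1], continuous M})
  (dA : forall t, 0 < t < t1 -> is_derive t 1 A (B t - A t))
  (dQ : forall t, 0 < t < t1 -> is_derive t 1 (B \- P) (A t - (1 + b t) * B t))
  (dM : forall t, 0 < t < t1 -> is_derive t 1 M (b t * M t))
  (b_ge0 : forall t, 0 < t < t1 -> 0 <= b t)
  (M_ge1 : forall t, 0 <= t <= t1 -> 1 <= M t)
  (M_leK : forall t, 0 <= t <= t1 -> M t <= K)
  (M0 : M 0 = 1) (P0 : P 0 = 0)
  (P_ndecr : forall s t, 0 <= s -> s <= t -> t <= t1 -> P s <= P t)
  (A0 : 0 <= A 0) (B0 : 0 < B 0).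

(** As long as B >= 0, the function e^x A is nondecreasing, so A >= 0. Hence M (A + B - P + P s),
    with P frozen at the end point, is nondecreasing as well, because its derivative is M b (A + P s
    - P); this gives M (A + B) >= B 0 + P s. Finally e^(2 x) (M (B - P + P t) - (B 0 + P t) / 2) is
    nondecreasing on [0, t] and nonnegative at 0. The rate 2 and the half are those of the undamped
    relaxation of B towards (A + B) / 2. *)
Let step t : 0 <= t <= t1 -> (forall s, 0 < s < t -> 0 <= B s) ->
  (B 0 + P t) / 2 <= M t * B t.
Proof.
move=> /andP[t0 tt1] Bge0.
have sub (f : R -> R) : {within `[0, t1], continuous f} ->
    {within `[0, t], continuous f}.
  apply: continuous_subspaceW; apply: subset_itvl.
  by rewrite bnd_simp.
have lt1 s : 0 < s < t -> 0 < s < t1.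
  by move=> /andP[-> st] /=; exact: lt_le_trans st tt1.
have cE : {within `[0, t], continuous (@expR R)}.
  by apply: continuous_subspaceT; exact: continuous_expR.
have Age0 s : 0 <= s -> s <= t -> 0 <= A s.
  move=> s0 st; rewrite -(pmulr_rge0 _ (expR_gt0 s)).
  have h0 : 0 <= expR 0 * A 0 by rewrite mulr_ge0 ?expR_ge0.
  apply: (le_trans h0).
  apply: (@is_derive_ndecr _ (expR * A) (fun s => expR s * B s) 0 t) => //.
  - move=> x xt; have /dA dAx := lt1 _ xt.
    by apply: is_derive_eq; rewrite /GRing.scale /=; ring.
  - by move=> x xt; rewrite mulr_ge0 ?expR_ge0 ?Bge0.
  - move=> x; apply: continuousM; [exact: cE|exact: (sub _ cA)].
have Mt1 s : 0 <= s -> s <= t -> 1 <= M s.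
  by move=> s0 st; rewrite M_ge1// s0 (le_trans st).
have S_ge s : 0 <= s -> s <= t -> B 0 + P s <= M s * (A s + B s).
  move=> s0 st.
  have cAQ : {within `[0, t], continuous (M * (A + (B \- P) + cst (P s)))}.
    move=> x; apply: continuousM; first exact: (sub _ cM).
    apply: continuousD; last exact: cst_continuous.
    apply: continuousD; first exact: (sub _ cA).
    by apply: continuousB; [exact: (sub _ cB)|exact: (sub _ cP)].
  have ss : {within `[0, s], continuous (M * (A + (B \- P) + cst (P s)))}.
    by apply: continuous_subspaceW cAQ; apply: subset_itvl; rewrite bnd_simp.
  have H := @is_derive_ndecr _ (M * (A + (B \- P) + cst (P s)))
    (fun x => M x * b x * (A x + (P s - P x))) 0 s.
  have /= : (M * (A + (B \- P) + cst (P s))) 0 <= (M * (A + (B \- P) + cst (P s))) s.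
    apply: H => // x /andP[x0 xs].
    - have xt : 0 < x < t by rewrite x0 (lt_le_trans xs).
      have xt1 := lt1 _ xt; have := dA xt1; have := dQ xt1; have := dM xt1.
      move=> ? ? ?; apply: is_derive_eq; rewrite /GRing.scale /= /cst.
      rewrite !fctE/=; ring.
    - have xt : 0 < x < t by rewrite x0 (lt_le_trans xs).
      rewrite !mulr_ge0 ?b_ge0 ?lt1//.
        by have := Mt1 x (ltW x0) (le_trans (ltW xs) st); lra.
      rewrite addr_ge0 ?Age0 ?(ltW x0)//; first by case/andP: xt => _ /ltW.
      by rewrite subr_ge0; apply: P_ndecr; [exact: ltW|exact: ltW|exact: le_trans tt1].
  rewrite !fctE /cst /= M0 P0 mul1r => H1.
  have -> : M s * (A s + B s) = M s * (A s + (B s - P s) + P s) by ring.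
  by apply: le_trans H1; have := A0; lra.
have cG : {within `[0, t], continuous
  (expR * expR * (M * ((B \- P) + cst (P t)) - cst ((B 0 + P t) / 2)))}.
  move=> x; apply: continuousM.
    by apply: continuousM; exact: cE.
  apply: continuousB; last exact: cst_continuous.
  apply: continuousM; first exact: (sub _ cM).
  apply: continuousD; last exact: cst_continuous.
  by apply: continuousB; [exact: (sub _ cB)|exact: (sub _ cP)].
pose G := expR * expR * (M * ((B \- P) + cst (P t)) - cst ((B 0 + P t) / 2)).
have : G 0 <= G t.
  apply: (@is_derive_ndecr _ G (fun x => expR x * expR x *
    (M x * (A x + B x) + (2 + b x) * M x * (P t - P x) - (B 0 + P t))) 0 t) => //.
  - move=> x xt; have xt1 := lt1 _ xt; have := dQ xt1; have := dM xt1.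
    move=> ? ?; apply: is_derive_eq; rewrite /GRing.scale /= /cst.
    rewrite !fctE/=.
    set c := (B 0 + P t) / 2.
    have -> : B 0 + P t = c + c by rewrite /c; lra.
    by ring.
  - move=> x xt; have /andP[x0 xt'] := xt.
    rewrite !mulr_ge0 ?expR_ge0//.
    have := S_ge x (ltW x0) (ltW xt').
    have := Mt1 x (ltW x0) (ltW xt').
    have := b_ge0 (lt1 _ xt).
    have : P x <= P t by apply: P_ndecr => //; exact: ltW.
    set m := M x; set bx := b x; set pp := P x => pt b0 m1 S.
    have : 2 * (P t - pp) <= (2 + bx) * m * (P t - pp).
      by apply: ler_wpM2r; [lra|nra].
    lra.
rewrite /G !fctE /cst /= M0 P0 expR0 mul1r !mul1r => GG.
have : 0 <= expR t * expR t * (M t * (B t - P t + P t) - (B 0 + P t) / 2).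
  apply: le_trans GG; have : 0 <= P t by rewrite -P0 P_ndecr.
  by have := B0; lra.
by rewrite pmulr_rge0 ?mulr_gt0 ?expR_gt0// subrK subr_ge0.
Qed.

(** Continuity argument removing the sign condition of [step]: let [u] be the supremum of the times
    up to which B >= 0. There [step] gives B u > 0 strictly, so by continuity B stays positive a
    little longer, which is absurd if u < t1. [M <= K] then turns the bound on [M t * B t] into one
    on [B t]. *)
Lemma damped_ode_lb t : 0 <= t <= t1 -> B 0 + P t <= 2 * K * B t.
Proof.
move=> tt1.
have P_ge0 s : 0 <= s <= t1 -> 0 <= P s by move=> /andP[? ?]; rewrite -P0 P_ndecr.
pose S := [set s | 0 <= s <= t1 /\ forall x, 0 < x < s -> 0 <= B x].
have S0 : S 0.
  split; first by rewrite lexx.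
  by move=> x /andP[x0 x0']; have := lt_trans x0 x0'; rewrite ltxx.
have hS : has_sup S.
  by split; [exists 0|exists t1 => s [/andP[_ ?] _]].
pose u := sup S.
have u0 : 0 <= u by exact: (sup_upper_bound hS).
have ut1 : u <= t1 by apply: ge_sup; [exists 0|move=> s [/andP[_ ?] _]].
have Bu s : 0 < s < u -> 0 <= B s.
  move=> /andP[s0 su].
  have us : 0 < u - s by lra.
  have [v [_ Bv]] := sup_adherent us hS; rewrite -/u subKr => sv.
  by apply: Bv; rewrite s0.
have Sall s : 0 < s < t1 -> 0 <= B s.
  have [ut|ut] := leP t1 u.
    by move=> /andP[s0 st]; apply: Bu; rewrite s0 (lt_le_trans st).
  have Bupos : 0 < B u.
    have uu : 0 <= u <= t1 by rewrite u0.
    have := step uu Bu; have := M_ge1 uu; have := P_ge0 _ uu; have := B0.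
    set m := M u => ? ? ? H.
    rewrite ltNge; apply/negP => Bneg.
    have : m * B u <= 0 by apply: mulr_ge0_le0; lra.
    by lra.
  exfalso.
  have : \forall s \near within `[0, t1] (nbhs u), 0 < B s.
    have /subspace_continuousP/(_ u) := cB.
    rewrite /= in_itv/= u0 ut1 => /(_ isT) /cvgr_gt; exact.
  rewrite near_withinE => -[e /= e0 He].
  pose v := Num.min t1 (u + e / 2).
  have uv : u < v by rewrite lt_min ut/= ltrDl divr_gt0.
  have Sv : S v.
    split; first by rewrite (le_trans u0 (ltW uv))/= ge_min lexx.
    move=> x /andP[x0]; rewrite lt_min => /andP[xt1 xe].
    have [xu|ux] := ltP x u; first by apply: Bu; rewrite x0.
    apply/ltW/He; rewrite /= ?in_itv/= ?(ltW x0) ?(ltW xt1)//.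
    by rewrite /ball/= ler0_norm; lra.
  have : v <= u by exact: (sup_upper_bound hS).
  lra.
have Bt : (B 0 + P t) / 2 <= M t * B t.
  apply: step => // s /andP[s0 st]; apply: Sall; rewrite s0 (lt_le_trans st)//.
  by case/andP: tt1.
have := P_ge0 _ tt1; have := M_ge1 tt1; have := M_leK tt1; have := B0.
set m := M t in Bt * => ? ? ? ?.
have B_ge0 : 0 <= B t.
  rewrite leNgt; apply/negP => Bneg.
  have : m * B t <= 0 by apply: mulr_ge0_le0; lra.
  by lra.
have : m * B t <= K * B t by apply: ler_wpM2r.
lra.
Qed.

End damped_ode.

(** * Smoothness in several variables *)

Section Ck_theory.
Context (R : realType).
Implicit Types (V W : normedModType R).

(** Passing to the line through [x] reduces chain rules to one variable, where directional
    derivatives suffice and no total differentiability of [f] is involved. *)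
Lemma is_derive_lineP V (f : V -> R) x v (df : R) :
  is_derive x v f df <-> is_derive (0 : R) 1 (fun t : R => f (t *: v + x)) df.
Proof.
split=> -[fx <-].
  apply: DeriveDef; first exact: (proj1 (derivable1P _ _ _) fx).
  rewrite /derive; set g1 := fun h => h^-1 *: _; set g2 := fun h => h^-1 *: _.
  suff -> : g1 = g2 by [].
by rewrite funeqE /g1 /g2 => h /=; rewrite addr0 scale0r add0r [_%:A]mulr1.
apply: DeriveDef; first exact: (proj2 (derivable1P _ _ _) fx).
rewrite /derive; set g1 := fun h => h^-1 *: _; set g2 := fun h => h^-1 *: _.
suff -> : g1 = g2 by [].
by rewrite funeqE /g1 /g2 => h /=; rewrite addr0 scale0r add0r [_%:A]mulr1.
Qed.

Lemma is_derive_comp1 V (h : R -> R) (f : V -> R) x v (dh df : R) :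
  is_derive (f x) 1 h dh -> is_derive x v f df ->
  is_derive x v (h \o f) (dh * df).
Proof.
move=> hh /is_derive_lineP hf; apply/is_derive_lineP.
apply: (@is_derive1_comp R h (fun t => f (t *: v + x)) 0 dh df) => //.
by rewrite scale0r add0r.
Qed.

Lemma is_derive_scalel (h : R -> R) (x v dh : R) :
  is_derive x 1 h dh -> is_derive x v h (dh * v).
Proof.
move=> hh; rewrite -[h]/(h \o (@id R)).
by apply: is_derive_comp1 => //; exact: is_derive_id.
Qed.

Lemma is_derive_linear V W (L : {linear V -> W}) (f : W -> R) x v (df : R) :
  is_derive (L x) (L v) f df -> is_derive x v (f \o L) df.
Proof.
move=> /is_derive_lineP hf; apply/is_derive_lineP.
by under eq_fun do rewrite /= linearP.
Qed.

Lemma Ck_continuous V k (f : V -> R) : Ck k f -> continuous f.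
Proof. by case: k => [|k] []. Qed.

Lemma Ck_pred V k (f : V -> R) : Ck k.+1 f -> Ck k f.
Proof.
elim: k f => [|k IH] f [cf df]; first by split.
by split=> // v; have [dv Cv] := df v; split=> //; exact: IH.
Qed.

Lemma CkS V k (f : V -> R) (df : V -> V -> R) : continuous f ->
  (forall x v, is_derive x v f (df v x)) -> (forall v, Ck k (df v)) -> Ck k.+1 f.
Proof.
move=> cf dfE Cdf; split=> // v; split=> [x|]; first by have [] := dfE x v.
by rewrite (_ : (fun x => _) = df v)//; apply/funext => x; have [] := dfE x v.
Qed.

Lemma Ck_derive V k (f : V -> R) x v :
  Ck k.+1 f -> is_derive x v f ('D_v f x).
Proof. by move=> [_ /(_ v)[/(_ x) ? _]]; exact: derivableP. Qed.

Lemma Ck_D V k (f : V -> R) v : Ck k.+1 f -> Ck k (fun x => 'D_v f x).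
Proof. by move=> [_ /(_ v)[]]. Qed.

Lemma Ck_cst V k (c : R) : Ck k (fun _ : V => c).
Proof.
elim: k c => [|k IH] c; first by split=> //; exact: cst_continuous.
by apply: (@CkS _ _ _ (fun _ _ => 0)) => //; exact: cst_continuous.
Qed.

Lemma Ck_add V k (f g : V -> R) : Ck k f -> Ck k g -> Ck k (fun x => f x + g x).
Proof.
elim: k f g => [|k IH] f g Cf Cg.
  by split=> // x; apply: cvgD; [exact: Ck_continuous Cf _|exact: Ck_continuous Cg _].
apply: (@CkS _ _ _ (fun v x => 'D_v f x + 'D_v g x)).
- by move=> x; apply: cvgD; [exact: Ck_continuous Cf _|exact: Ck_continuous Cg _].
- by move=> x v; apply: (is_deriveD (f := f) (g := g)); [exact: Ck_derive Cf|exact: Ck_derive Cg].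
- by move=> v; apply: IH; exact: Ck_D.
Qed.

Lemma Ck_mul V k (f g : V -> R) : Ck k f -> Ck k g -> Ck k (fun x => f x * g x).
Proof.
elim: k f g => [|k IH] f g Cf Cg.
  by split=> // x; apply: cvgM; [exact: Ck_continuous Cf _|exact: Ck_continuous Cg _].
apply: (@CkS _ _ _ (fun v x => f x * 'D_v g x + g x * 'D_v f x)).
- by move=> x; apply: cvgM; [exact: Ck_continuous Cf _|exact: Ck_continuous Cg _].
- by move=> x v; apply: (is_deriveM (f := f) (g := g)); [exact: Ck_derive Cf|exact: Ck_derive Cg].
- by move=> v; apply: Ck_add; apply: IH; (exact: Ck_D || exact: Ck_pred).
Qed.

Lemma Ck_sum V k n (f : 'I_n -> V -> R) : (forall i, Ck k (f i)) ->
  Ck k (fun x => \sum_(i < n) f i x).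
Proof.
elim: n f => [|n IH] f Cf.
  by under eq_fun do rewrite big_ord0; exact: Ck_cst.
under eq_fun do rewrite big_ord_recl.
by apply: Ck_add => //; exact: IH.
Qed.

Lemma Ck_comp1 V k (h : R -> R) (f : V -> R) :
  Ck k h -> Ck k f -> Ck k (fun x => h (f x)).
Proof.
elim: k h f => [|k IH] h f Ch Cf.
  by split=> // x; apply: continuous_comp; [exact: Ck_continuous Cf _|
    exact: Ck_continuous Ch _].
apply: (@CkS _ _ _ (fun v x => 'D_1 h (f x) * 'D_v f x)).
- by move=> x; apply: continuous_comp; [exact: Ck_continuous Cf _|
    exact: Ck_continuous Ch _].
- by move=> x v; apply: is_derive_comp1; [exact: Ck_derive Ch|exact: Ck_derive Cf].
- move=> v; apply: Ck_mul; last exact: Ck_D.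
  by apply: (IH (fun y => 'D_1 h y) f); [exact: Ck_D|exact: Ck_pred].
Qed.

Lemma Ck_linear V W k (L : {linear V -> W}) (f : W -> R) :
  continuous L -> Ck k f -> Ck k (fun x => f (L x)).
Proof.
move=> cL; elim: k f => [|k IH] f Cf.
  by split=> // x; apply: continuous_comp; [exact: cL|exact: Ck_continuous Cf _].
apply: (@CkS _ _ _ (fun v x => 'D_(L v) f (L x))).
- by move=> x; apply: continuous_comp; [exact: cL|exact: Ck_continuous Cf _].
- by move=> x v; apply: is_derive_linear; exact: Ck_derive Cf.
- by move=> v; apply: (IH (fun y => 'D_(L v) f y)); exact: Ck_D.
Qed.

Lemma Ck_id k : Ck k (fun x : R => x).
Proof.
case: k => [|k]; first by split=> // x; exact: cvg_id.
have ci : continuous (fun x : R => x) by move=> x; exact: cvg_id.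
have di (x v : R) : is_derive x v (fun x : R => x) v by exact: is_derive_id.
have Cc (v : R) : Ck k (fun _ : R => v) by exact: Ck_cst.
exact: (CkS ci di Cc).
Qed.

Lemma Ck_inv V k (f : V -> R) : (forall x, f x != 0) -> Ck k f ->
  Ck k (fun x => (f x)^-1).
Proof.
move=> f0; elim: k => [|k IH] Cf.
  by split=> // x; apply: cvgV => //; exact: Ck_continuous Cf _.
apply: (@CkS _ _ _ (fun v x => - 1 * ((f x)^-1 * (f x)^-1 * 'D_v f x))).
- by move=> x; apply: cvgV => //; exact: Ck_continuous Cf _.
- move=> x v; have /(@derivableV _ _ f x v (f0 x)) dV : derivable f x v.
    by have [] := Ck_derive x v Cf.
  split=> //; rewrite (deriveV (f0 x)); last by have [] := Ck_derive x v Cf.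
  by rewrite /GRing.scale /= expr2 invfM; ring.
- move=> v; apply: Ck_mul; first exact: Ck_cst.
  by apply: Ck_mul; last exact: Ck_D; apply: Ck_mul; apply: IH; exact: Ck_pred.
Qed.

Lemma Ck_expR k : Ck k (@expR R).
Proof.
elim: k => [|k IH]; first by split=> //; exact: continuous_expR.
apply: (@CkS _ _ _ (fun v x => expR x * v)); first exact: continuous_expR.
- by move=> x v; apply: is_derive_scalel; exact: is_derive_expR.
- by move=> v; apply: Ck_mul => //; exact: Ck_cst.
Qed.

End Ck_theory.

(** * A smooth step function *)

Section smooth_step.
Context (R : realType).

(** The powers are included because the span of this family is closed under differentiation: one
    induction, over all [k] at once, then gives smoothness of every order. *)
Definition flat (k : nat) (x : R) : R := if 0 < x then x ^- k * expR (- x^-1) else 0.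

(** One term of the exponential series at 1 / x suffices. The difference quotient of [flat k] at 0
    is [flat k.+1] itself, so this bound yields the vanishing derivative there. *)
Lemma flat_le k (x : R) : `|flat k x| <= k.+1`!%:R * `|x|.
Proof.
rewrite /flat; case: ifPn => [x0|_]; last by rewrite normr0 mulr_ge0.
have xk : 0 <= x ^- k by rewrite invr_ge0 exprn_ge0 ?ltW.
rewrite ger0_norm ?mulr_ge0 ?expR_ge0// (gtr0_norm x0) expRN.
rewrite ler_pdivrMr ?expR_gt0//.
have := @expR_ge1Dxn R x^-1 k; rewrite invr_ge0 (ltW x0) => /(_ isT) H.
apply: (@le_trans _ _ (k.+1`!%:R * x * (x^-1 ^+ k.+1 / k.+1`!%:R))).
  rewrite exprVn exprS le_eqVlt; apply/orP; left; apply/eqP.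
  by field; rewrite expf_neq0 ?gt_eqF//= ltr0n fact_gt0.
apply: ler_wpM2l; first by rewrite mulr_ge0 ?ltW.
by apply: le_trans H; rewrite lerDr.
Qed.

Lemma is_derive_flat k (x : R) :
  is_derive x 1 (flat k) (flat k.+2 x - k%:R * flat k.+1 x).
Proof.
have [x0|x0|->] := ltgtP x 0.
- have E : \near x, (fun=> 0) x = flat k x.
    near=> y; rewrite /flat ifF//; apply/negbTE; rewrite -leNgt.
    by apply: ltW; near: y; exact: lt_nbhsl.
  apply: (@near_eq_is_derive _ _ _ (fun=> 0) (flat k) x 1 _ E).
  rewrite /flat ltNge (ltW x0)/= mulr0 subr0.
  exact: is_derive_cst.
- have E : \near x, (fun y => y^-1 ^+ k * expR (- y^-1)) x = flat k x.
    near=> y; rewrite /flat ifT ?exprVn//.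
    by near: y; apply: (cvgr_gt x cvg_id).
  have := @near_eq_is_derive R R R (fun y : R => y^-1 ^+ k * expR (- y^-1))
    (flat k) x 1 _ E; apply.
  have dV : is_derive x 1 (fun y : R => y^-1) (- x ^- 2 *: 1).
    by apply: (@is_deriveV _ id); rewrite gt_eqF.
  have := is_deriveX k dV; rewrite exprfctE => dX.
  have dE : is_derive x 1 (fun y : R => expR (- y^-1))
      (expR (- x^-1) * (- (- x ^- 2 *: 1))).
    exact: is_derive_comp1.
  have := is_deriveM dX dE; rewrite mulrfctE => H.
  apply: (is_derive_eq H).
  rewrite /flat x0 /GRing.scale /= !exprVn.
  case: k {E dX H} => [|k]; rewrite /= ?mulr0n ?mul0r ?mulr0.
    by rewrite !expr0; field; rewrite gt_eqF.
  rewrite !exprS -natr1; field.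
  by rewrite expf_neq0 gt_eqF.
- have cv : (fun h : R => h^-1 *: ((flat k \o shift 0) (h *: 1) - flat k 0))
      @ 0^' --> (0 : R).
    have E h : h^-1 *: ((flat k \o shift 0) (h *: 1) - flat k 0) = flat k.+1 h.
      rewrite /= addr0 /flat ltxx subr0 /GRing.scale /= mulr1.
      case: ifPn => h0; last by rewrite mulr0.
      by rewrite exprS invfM mulrA.
    under eq_fun do rewrite E.
    apply/cvgr0Pnorm_lt => e e0; near=> h.
    apply: le_lt_trans (flat_le _ _) _.
    rewrite -ltr_pdivlMl ?ltr0n ?fact_gt0// mulrC.
    near: h; apply: dnbhs0_lt.
    by rewrite divr_gt0// ltr0n fact_gt0.
  rewrite /flat ltxx mulr0 subr0 -/(flat k).
  apply: DeriveDef; first by apply/cvg_ex; exists 0.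
  exact/cvg_lim.
Unshelve. all: by end_near. Qed.

Lemma Ck_flat n k : Ck n (flat k).
Proof.
elim: n k => [|n IH] k; have cf : continuous (flat k).
- by move=> x; apply/differentiable_continuous/derivable1_diffP;
    have [] := is_derive_flat k x.
- by [].
- by move=> x; apply/differentiable_continuous/derivable1_diffP;
    have [] := is_derive_flat k x.
have df (x v : R) := is_derive_scalel v (is_derive_flat k x).
apply: (CkS cf df) => v; apply: Ck_mul; last exact: Ck_cst.
rewrite (_ : (fun x => _) =
  (fun x => flat k.+2 x + (fun x => - k%:R * flat k.+1 x) x)); last first.
  by apply/funext => x; rewrite mulNr.
by apply: Ck_add => //; apply: Ck_mul => //; exact: Ck_cst.
Qed.

Definition smooth_step (x : R) : R := flat 0 x / (flat 0 x + flat 0 (1 - x)).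

Lemma flat0_ge0 x : 0 <= flat 0 x.
Proof. by rewrite /flat; case: ifP => // _; rewrite expr0 invr1 mul1r expR_ge0. Qed.

Lemma flat0_gt0 x : 0 < x -> 0 < flat 0 x.
Proof. by rewrite /flat => ->; rewrite expr0 invr1 mul1r expR_gt0. Qed.

Lemma flat0_sum_gt0 x : 0 < flat 0 x + flat 0 (1 - x).
Proof.
have [x0|x0] := ltP 0 x; first by rewrite ltr_pwDl ?flat0_gt0 ?flat0_ge0.
by rewrite ltr_wpDl ?flat0_ge0 ?flat0_gt0//; lra.
Qed.

Lemma Ck_smooth_step k : Ck k smooth_step.
Proof.
apply: Ck_mul; first exact: Ck_flat.
apply: Ck_inv => [x|]; first by rewrite gt_eqF ?flat0_sum_gt0.
apply: Ck_add; first exact: Ck_flat.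
apply: (@Ck_comp1 _ R^o k (flat 0) (fun x => 1 - x)); first exact: Ck_flat.
apply: Ck_add; first exact: Ck_cst.
have : Ck k (fun x : R => -1 * x) by apply: Ck_mul; [exact: Ck_cst|exact: Ck_id].
by under eq_fun do rewrite mulN1r.
Qed.

Lemma smooth_step_ge0 x : 0 <= smooth_step x.
Proof. by rewrite divr_ge0 ?flat0_ge0// ltW// flat0_sum_gt0. Qed.

Lemma smooth_step_le1 x : smooth_step x <= 1.
Proof. by rewrite ler_pdivrMr ?flat0_sum_gt0// mul1r lerDl flat0_ge0. Qed.

Lemma smooth_step_eq0 x : x <= 0 -> smooth_step x = 0.
Proof. by move=> x0; rewrite /smooth_step {1}/flat ltNge x0 mul0r. Qed.

Lemma smooth_step_eq1 x : 1 <= x -> smooth_step x = 1.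
Proof.
move=> x1; rewrite /smooth_step; have -> : flat 0 (1 - x) = 0.
  by rewrite /flat subr_gt0 ltNge x1.
by rewrite addr0 divff// gt_eqF// flat0_gt0//; lra.
Qed.

End smooth_step.

(** * The plane-wave test function *)

Section tensor.
Context (R : realType) (n : nat).
Implicit Types (th : R -> R) (w : 'rV[R]_n -> R).

Lemma Ck_coord k (i : 'I_n) : Ck k (fun x : 'rV[R]_n => x ord0 i).
Proof.
have lin : linear (fun x : 'rV[R]_n => x ord0 i : R^o) by move=> a x y; rewrite !mxE.
pose L := GRing.isLinear.Build _ _ _ _ _ lin.
pose LL : {linear 'rV[R]_n -> R^o} := HB.pack (fun x : 'rV[R]_n => x ord0 i : R^o) L.
apply: (@Ck_linear R _ R^o k LL (fun x : R => x)); last exact: Ck_id.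
exact: coord_continuous.
Qed.

Lemma Ck_tensor k th w : Ck k th -> Ck k w ->
  Ck k (fun z : R * 'rV[R]_n => th z.1 * w z.2).
Proof.
move=> Cth Cw.
apply: (@Ck_mul R (R * 'rV[R]_n)%type k (fun z => th z.1) (fun z => w z.2)).
  apply: (@Ck_linear R (R^o * 'rV[R]_n)%type R^o k fst) => //.
  by move=> z; exact: cvg_fst.
apply: (@Ck_linear R (R^o * 'rV[R]_n)%type 'rV[R]_n k snd) => //.
by move=> z; exact: cvg_snd.
Qed.

Lemma dtime_tensor th w s x : derivable th s 1 ->
  dtime (fun z : R * 'rV[R]_n => th z.1 * w z.2) (s, x) = 'D_1 th s * w x.
Proof.
move=> dth; have [_ E] : is_derive ((s, x) : R * 'rV[R]_n) (1, 0)
    (fun z : R * 'rV[R]_n => th z.1 * w z.2) (w x * 'D_1 th s).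
  apply/is_derive_lineP => /=.
  under eq_fun do rewrite scaler0 add0r mulrC.
  have /is_derive_lineP H := derivableP dth.
  exact: (is_deriveZ (w x) H).
by rewrite /dtime E mulrC.
Qed.

Lemma dspace_tensor th w i s x : derivable w x (delta_mx ord0 i) ->
  dspace i (fun z : R * 'rV[R]_n => th z.1 * w z.2) (s, x) =
  th s * 'D_(delta_mx ord0 i) w x.
Proof.
move=> dw; have [_ E] : is_derive ((s, x) : R * 'rV[R]_n) (0, delta_mx ord0 i)
    (fun z : R * 'rV[R]_n => th z.1 * w z.2) (th s * 'D_(delta_mx ord0 i) w x).
  apply/is_derive_lineP => /=.
  under eq_fun do rewrite scaler0 add0r.
  have /is_derive_lineP H := derivableP dw.
  exact: (is_deriveZ (th s) H).
by rewrite /dspace E.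
Qed.

End tensor.

Lemma csupport_derive (R : realType) (V : normedModType R) (f : V -> R) v :
  csupport (fun x => 'D_v f x) `<=` csupport f.
Proof.
rewrite /csupport.
rewrite [X in _ `<=` X](proj1 (closure_id _) (@closed_closure _ _)).
apply: closure_subset => x /=; apply: contra_neqP => xf.
have fx : \forall y \near x, 0 = f y.
  have : nbhs x (~` closure [set x | f x != 0]).
    by apply: open_nbhs_nbhs; split=> //; apply: closed_openC; exact: closed_closure.
  apply: filterS => y /= yf; apply/eqP; rewrite eq_sym; apply: contra_notT yf => fy.
  exact: subset_closure.
rewrite -(near_eq_derive (f := fun=> 0) v fx).
by have [] := is_derive_cst (0 : R) x v.
Qed.

Lemma compact_csupport (R : realType) (V : normedModType R) (f : V -> R) A :
  compact A -> (forall x, f x != 0 -> A x) -> csupport f `<=` A /\ compact (csupport f).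
Proof.
move=> cA fA; have sA : csupport f `<=` A.
  have /closure_id -> : closed A.
    by apply: compact_closed => //; exact: norm_hausdorff.
  exact: closure_subset.
by split=> //; apply: subclosed_compact cA sA; exact: closed_closure.
Qed.

Lemma compact_box (R : realType) n (rho : R) :
  compact [set x : 'rV[R]_n | forall i, `[- rho, rho]%classic (x ord0 i)].
Proof.
by apply: (@rV_compact R n (fun=> `[- rho, rho]%classic)) => i; exact: segment_compact.
Qed.

Section cutoffs.
Context (R : realType) (n : nat).

(* The plane wave [exp (x_0 - t)] solves the free wave equation; it is cut off
   in space beyond the ball of radius [rho], and in time after [t1]. *)
Definition space_weight (rho : R) (x : 'rV[R]_n.+1) : R :=
  expR (x ord0 ord0) * smooth_step (rho ^+ 2 + 1 - enorm x ^+ 2).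

Definition time_weight (t1 t2 : R) (t : R) : R :=
  expR (- t) * (smooth_step (2 * (t2 - t) / (t2 - t1)) * smooth_step (t + 2)).

Lemma enorm_ge0 m (x : 'rV[R]_m) : 0 <= enorm x.
Proof. exact: sqrtr_ge0. Qed.

Lemma enorm_sqr m (x : 'rV[R]_m) : enorm x ^+ 2 = \sum_(i < m) x ord0 i ^+ 2.
Proof. by rewrite sqr_sqrtr// sumr_ge0// => i _; rewrite sqr_ge0. Qed.

Lemma coord_le_enorm m (x : 'rV[R]_m) i : `|x ord0 i| <= enorm x.
Proof.
rewrite -[leLHS]sqrtr_sqr ler_wsqrtr// (bigD1 i)//= lerDl sumr_ge0// => j _.
by rewrite sqr_ge0.
Qed.

(** The square is a polynomial, whereas the Euclidean norm is not smooth at the origin; for this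
    reason the spatial cut-off is a function of the squared norm. *)
Lemma smooth_enorm_sqr m k : Ck k (fun x : 'rV[R]_m => enorm x ^+ 2).
Proof.
under eq_fun do rewrite enorm_sqr.
apply: (@Ck_sum R 'rV[R]_m k m (fun i x => x ord0 i ^+ 2)) => i.
under eq_fun do rewrite expr2.
by apply: (@Ck_mul R 'rV[R]_m k (fun x => x ord0 i) (fun x => x ord0 i));
  exact: Ck_coord.
Qed.

Lemma continuous_enorm m : continuous (@enorm R m).
Proof.
move=> x; rewrite (_ : @enorm R m = Num.sqrt \o (fun x : 'rV[R]_m => enorm x ^+ 2)).
  apply: continuous_comp; last exact: sqrt_continuous.
  exact: (Ck_continuous (smooth_enorm_sqr m 0)).
by apply/funext => y /=; rewrite sqrtr_sqr ger0_norm ?enorm_ge0.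
Qed.

Lemma Ck_sub1 (c : R) k : Ck k (fun x : R => c - x).
Proof.
apply: Ck_add; first exact: Ck_cst.
have : Ck k (fun x : R => -1 * x) by apply: Ck_mul; [exact: Ck_cst|exact: Ck_id].
by under eq_fun do rewrite mulN1r.
Qed.

Lemma smooth_space_weight rho : smooth (space_weight rho).
Proof.
move=> k; apply: Ck_mul.
  by apply: Ck_comp1; [exact: Ck_expR|exact: Ck_coord].
apply: (@Ck_comp1 R _ k (@smooth_step R) (fun x : 'rV[R]_n.+1 => rho ^+ 2 + 1 - enorm x ^+ 2)).
  exact: Ck_smooth_step.
apply: (@Ck_comp1 R _ k (fun y => rho ^+ 2 + 1 - y) (fun x : 'rV[R]_n.+1 => enorm x ^+ 2)).
  exact: Ck_sub1.
exact: smooth_enorm_sqr.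
Qed.

Lemma space_weight_ge0 rho x : 0 <= space_weight rho x.
Proof. by rewrite mulr_ge0 ?expR_ge0 ?smooth_step_ge0. Qed.

Lemma space_weight_le rho x : space_weight rho x <= expR (x ord0 ord0).
Proof. by rewrite ler_piMr ?expR_ge0 ?smooth_step_le1. Qed.

Lemma space_weightE rho x : 0 <= rho -> enorm x <= rho ->
  space_weight rho x = expR (x ord0 ord0).
Proof.
move=> rho0 xr; rewrite /space_weight smooth_step_eq1 ?mulr1//.
have : enorm x ^+ 2 <= rho ^+ 2 by rewrite lerXn2r ?nnegrE ?enorm_ge0.
lra.
Qed.

Lemma space_weight_neq0 rho x : 0 <= rho -> space_weight rho x != 0 ->
  forall i, `[- (rho + 1), rho + 1]%classic (x ord0 i).
Proof.
move=> rho0 wx i /=; rewrite in_itv/= -ler_norml.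
apply: le_trans (coord_le_enorm x i) _; rewrite leNgt; apply: contraNN wx => big.
rewrite /space_weight smooth_step_eq0 ?mulr0//.
have : (rho + 1) ^+ 2 < enorm x ^+ 2.
  by rewrite ltrXn2r ?nnegrE ?enorm_ge0// addr_ge0.
have : (rho + 1) ^+ 2 = rho ^+ 2 + 1 + rho *+ 2 by rewrite !expr2 mulr2n; ring.
have : 0 <= rho *+ 2 by rewrite mulrn_wge0.
lra.
Qed.

Lemma test_fun_space_weight rho : 0 <= rho -> test_fun (space_weight rho).
Proof.
move=> rho0; split; first exact: smooth_space_weight.
apply: (proj2 (compact_csupport (compact_box (n := n.+1) (rho := rho + 1)) _)).
by move=> x /(space_weight_neq0 rho0).
Qed.

Lemma test_fun_derive (f : 'rV[R]_n.+1 -> R) (v : 'rV[R]_n.+1) :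
  test_fun f -> test_fun (fun x => 'D_v f x).
Proof.
move=> [sf cf]; split; first by move=> k; apply: (@Ck_D R _ k f v); exact: sf.
apply: (subclosed_compact _ cf); first exact: closed_closure.
exact: csupport_derive.
Qed.

Lemma is_derive_exp_coord (i : 'I_n.+1) (x : 'rV[R]_n.+1) :
  is_derive x (delta_mx ord0 i) (fun x : 'rV[R]_n.+1 => expR (x ord0 ord0))
    (expR (x ord0 ord0) * (i == ord0)%:R).
Proof.
apply: is_derive_comp1; apply/is_derive_lineP => /=.
under eq_fun do rewrite !mxE /= mulrC.
have := @is_deriveD R R R (fun t : R => (ord0 == i)%:R *: t) (cst (x ord0 ord0)) 0 1
  _ _ (is_deriveZ _ (is_derive_id _ _)) (is_derive_cst _ _ _).
by rewrite addr0 eq_sym /GRing.scale /= mulr1.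
Qed.

(** Near such an [x] the cut-off is constant and only the second derivative along the first
    coordinate survives. The strict inequality provides the neighbourhood that derivatives see; this
    is why [rho] is later taken strictly above [t1 + r]. *)
Lemma laplacian_space_weight rho x : 0 <= rho -> enorm x < rho ->
  \sum_(i < n.+1) 'D_(delta_mx ord0 i) (fun y => 'D_(delta_mx ord0 i) (space_weight rho) y) x
  = space_weight rho x.
Proof.
move=> rho0 xr.
have N1 (y : 'rV[R]_n.+1) : enorm y < rho ->
    \forall z \near y, expR ((z : 'rV[R]_n.+1) ord0 ord0) = space_weight rho z.
  move=> yr; near=> z; rewrite space_weightE// ltW//.
  by near: z; apply: (cvgr_lt (enorm y)) => //; exact: continuous_enorm.
have N2 (i : 'I_n.+1) : \forall y \near x,
    expR ((y : 'rV[R]_n.+1) ord0 ord0) * (i == ord0)%:R =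
    'D_(delta_mx ord0 i) (space_weight rho) y.
  near=> y; have yr : enorm y < rho.
    by near: y; apply: (cvgr_lt (enorm x)) => //; exact: continuous_enorm.
  rewrite -(near_eq_derive (delta_mx ord0 i) (N1 y yr)).
  by have [] := is_derive_exp_coord i y.
rewrite (bigD1 ord0)//= big1 ?addr0 => [|i i0].
  rewrite -(near_eq_derive _ (N2 ord0)) eqxx.
  under eq_fun do rewrite mulr1.
  have [_ ->] := is_derive_exp_coord ord0 x.
  by rewrite eqxx mulr1 space_weightE// ltW.
rewrite -(near_eq_derive _ (N2 i)) (negbTE i0).
under eq_fun do rewrite mulr0.
by have [] := is_derive_cst (0 : R) x (delta_mx ord0 i).
Unshelve. all: by end_near. Qed.

Section time.
Variables (t1 t2 : R).
Hypotheses (t10 : 0 <= t1) (t12 : t1 < t2).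

Lemma smooth_time_weight : smooth (time_weight t1 t2).
Proof.
move=> k; have neg : Ck k (fun x : R => - x).
  by have := Ck_sub1 0 k; under eq_fun do rewrite sub0r.
apply: Ck_mul; first by apply: (@Ck_comp1 R R^o k expR (fun x => - x)) => //; exact: Ck_expR.
apply: Ck_mul.
  apply: (@Ck_comp1 R R^o k (@smooth_step R) (fun t => 2 * (t2 - t) / (t2 - t1))).
    exact: Ck_smooth_step.
  apply: Ck_mul; last exact: Ck_cst.
  by apply: Ck_mul; [exact: Ck_cst|exact: Ck_sub1].
apply: (@Ck_comp1 R R^o k (@smooth_step R) (fun t => t + 2)); first exact: Ck_smooth_step.
by apply: Ck_add; [exact: Ck_id|exact: Ck_cst].
Qed.

(** The factor in [t + 2] only makes the support compact at negative times. The identity holds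
    beyond both ends of [0, t1], so that the derivative at the end points is also that of the
    exponential. *)
Lemma time_weightE t : - 1 <= t -> t <= (t1 + t2) / 2 -> time_weight t1 t2 t = expR (- t).
Proof.
move=> t0 tt; have t12' := t12; rewrite /time_weight !smooth_step_eq1 ?mulr1//; first lra.
rewrite ler_pdivlMr ?subr_gt0// mul1r; lra.
Qed.

Lemma derive_time_weight t : 0 <= t -> t <= t1 -> 'D_1 (time_weight t1 t2) t = - expR (- t).
Proof.
move=> t0 tt; have t12' := t12.
have E : \forall s \near t, expR (- s) = time_weight t1 t2 s.
  near=> s; rewrite time_weightE//.
    by apply: ltW; near: s; apply: (cvgr_gt t cvg_id); lra.
  by apply: ltW; near: s; apply: lt_nbhsl; lra.
rewrite -(near_eq_derive (1 : R) E).
have [_ ->] : is_derive t 1 (fun s => expR (- s)) (expR (- t) * - 1).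
  by apply: is_derive_comp1; exact: is_deriveNid.
by rewrite mulrN1.
Unshelve. all: by end_near. Qed.

Lemma time_weight_neq0 t : time_weight t1 t2 t != 0 -> `[- 2, t2]%classic t.
Proof.
have t12' := t12; move=> tw; rewrite /= in_itv/=; apply/andP; split; rewrite leNgt; apply: contraNN tw => h.
  by rewrite /time_weight (@smooth_step_eq0 _ (t + 2)) ?mulr0//; lra.
rewrite /time_weight (@smooth_step_eq0 _ (_ / _)) ?mul0r ?mulr0//.
by rewrite pmulr_lle0 ?invr_gt0 ?subr_gt0//; lra.
Qed.

Lemma spacetime_test_fun_weight rho (T : \bar R) : 0 <= rho -> (t2%:E < T)%E ->
  spacetime_test_fun T (fun z => time_weight t1 t2 z.1 * space_weight rho z.2).
Proof.
move=> rho0 t2T.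
have cK : compact (`[- 2, t2]%classic `*`
    [set x : 'rV[R]_n.+1 | forall i, `[- (rho + 1), rho + 1]%classic (x ord0 i)]).
  by apply: compact_setX; [exact: segment_compact|exact: compact_box].
have := @compact_csupport R (R * 'rV[R]_n.+1)%type
  (fun z => time_weight t1 t2 z.1 * space_weight rho z.2) _ cK.
case=> [z|sK cS].
  rewrite mulf_eq0 negb_or => /andP[/time_weight_neq0 ? /(space_weight_neq0 rho0)?].
  by split.
split=> //.
  by move=> k; apply: Ck_tensor; [exact: smooth_time_weight|exact: smooth_space_weight].
move=> z /sK[]/=; rewrite in_itv/= => /andP[_ zt2] _.
by apply: le_lt_trans t2T; rewrite lee_fin.
Qed.

End time.

End cutoffs.

(** * Pairings of L2 functions *)

Section L2_pairing.
Context d (T : measurableType d) (R : realType) (mu : {measure set T -> \bar R}).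
Local Notation L2 := (Lfun mu 2%:E).
Local Notation N2 f := (Lnorm mu 2%:E (EFin \o f%R)).
Implicit Types f g w : T -> R.

Lemma Lfun2_measurable f : f \in L2 -> measurable_fun setT f.
Proof. by rewrite inE => /andP[]; rewrite inE. Qed.

Lemma Lfun2_fin f : f \in L2 -> (N2 f < +oo)%E.
Proof. by rewrite inE => /andP[_]; rewrite inE. Qed.

Lemma Lfun2_fin_num f : f \in L2 -> N2 f \is a fin_num.
Proof. by move=> fL; rewrite ge0_fin_numE ?Lnorm_ge0//; exact: Lfun2_fin. Qed.

Lemma Lfun2_mul_integrable f w : f \in L2 -> w \in L2 ->
  mu.-integrable setT (EFin \o (fun x => f x * w x)).
Proof. by move=> fL wL; apply/Lfun1_integrable; exact: Lfun2_mul_Lfun1. Qed.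

Lemma Lfun2_sub f g : f \in L2 -> g \in L2 -> f \- g \in L2.
Proof.
move=> fL gL; have h : (1 <= 2%:E :> \bar R)%E by rewrite lee_fin ler1n.
have [_ lin] := @Lfun_submod_closed _ _ _ mu 2%:E h.
have -> : f \- g = -1 *: g + f by apply/funext => x /=; rewrite fctE scaleN1r addrC.
exact: lin.
Qed.

Lemma Lfun2_scale a f : f \in L2 -> a \*: f \in L2.
Proof.
move=> fL; have h : 1 <= (2 : R) by rewrite ler1n.
have -> : a \*: f = a \o* f by apply/funext => x /=; rewrite mulrC.
exact: Lfun_scale.
Qed.

Lemma Lfun2_pairing_le f w : f \in L2 -> w \in L2 ->
  (`|\int[mu]_x (f x * w x)|%:E <= N2 f * N2 w)%E.
Proof.
move=> fL wL; have fwL := Lfun2_mul_integrable fL wL.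
apply: le_trans (@hoelder _ _ _ mu f w 2 2 _ _ _ _ _) => //.
- rewrite Lnorm1 EFin_normr_Rintegral//; apply: le_abse_integral => //.
  by case/integrableP: fwL.
- exact: Lfun2_measurable.
- exact: Lfun2_measurable.
- lra.
Qed.

Lemma Lfun2_pairing_sub f g w : f \in L2 -> g \in L2 -> w \in L2 ->
  \int[mu]_x ((f \- g) x * w x) = \int[mu]_x (f x * w x) - \int[mu]_x (g x * w x).
Proof.
move=> fL gL wL; rewrite -RintegralB ?Lfun2_mul_integrable//.
by apply: eq_Rintegral => x _ /=; rewrite mulrBl.
Qed.

Lemma Lfun2_pairing_scale a f w : f \in L2 -> w \in L2 ->
  \int[mu]_x ((a \*: f) x * w x) = a * \int[mu]_x (f x * w x).
Proof.
move=> fL wL; rewrite -RintegralZl ?Lfun2_mul_integrable//.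
by apply: eq_Rintegral => x _ /=; rewrite mulrA.
Qed.

Lemma Lfun2_pairing_cvg (I : Type) (F : set_system I) (FF : Filter F)
    (f : I -> T -> R) g w :
  (\forall i \near F, f i \in L2) -> g \in L2 -> w \in L2 ->
  (fun i => N2 (f i \- g)) @ F --> 0%E ->
  (fun i => \int[mu]_x (f i x * w x)) @ F --> \int[mu]_x (g x * w x).
Proof.
move=> fL gL wL fg; apply/cvgrPdist_lt => e e0.
(* Adding 1 keeps the divisor positive when [w] vanishes almost everywhere. *)
have K0 : 0 < fine (N2 w) + 1.
  by apply: ltr_wpDl => //; apply: fine_ge0; exact: Lnorm_ge0.
have ed : (0 < (e / (fine (N2 w) + 1))%:E)%E by rewrite lte_fin divr_gt0.
have small := fg _ (open_ereal_lt' ed).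
near=> i; have fiL : f i \in L2 by near: i.
rewrite distrC -Lfun2_pairing_sub// -lte_fin.
apply: le_lt_trans (Lfun2_pairing_le (Lfun2_sub fiL gL) wL) _.
have wf := Lfun2_fin_num wL.
have nf := Lfun2_fin_num (Lfun2_sub fiL gL).
have : (N2 (f i \- g) < (e / (fine (N2 w) + 1))%:E)%E.
    by near: i; exact: small.
rewrite -(fineK nf) -(fineK wf) /= -EFinM !lte_fin.
rewrite ltr_pdivlMr// => h; apply: le_lt_trans h.
by apply: ler_wpM2l; [apply: fine_ge0; exact: Lnorm_ge0|rewrite lerDl].
Unshelve. all: by end_near. Qed.

(** On [E] one has |g| = |f i - g| almost everywhere, so the integral of |g|^2 over [E] is at most
    the squared norm of [f i - g], which is arbitrarily small. No almost everywhere convergent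
    subsequence has to be extracted. *)
Lemma Lfun2_cvg_ae0 (I : Type) (F : set_system I) (FF : ProperFilter F)
    (f : I -> T -> R) g (E : set T) : measurable E ->
  (\forall i \near F, f i \in L2) -> g \in L2 ->
  (fun i => N2 (f i \- g)) @ F --> 0%E ->
  (\forall i \near F, {ae mu, forall x, E x -> f i x = 0}) ->
  {ae mu, forall x, E x -> g x = 0}.
Proof.
move=> mE fL gL fg f0.
have mg := Lfun2_measurable gL.
have mg2 : measurable_fun E (fun x => (`|g x| `^ 2)%:E : \bar R).
  apply: measurable_funTS; apply/measurable_EFinP.
  by apply: (measurableT_comp (measurable_powR _)); exact: measurableT_comp.
suff : (\int[mu]_(x in E) `|(`|g x| `^ 2)%:E| = 0)%E.
  move/(ae_eq_integral_abs mu mE mg2); apply: filterS => x /= H Ex.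
  have /eqP := H Ex; rewrite eqe powR_eq0 => /andP[/eqP + _].
  exact: normr0_eq0.
apply/eqP; rewrite eq_le integral_ge0 ?andbT//.
apply/lee_addgt0Pr => e e0; rewrite add0e.
have ed : (0 < (e `^ 2^-1)%:E)%E by rewrite lte_fin powR_gt0.
have small := fg _ (open_ereal_lt' ed).
have near_i : \forall i \near F, [/\ f i \in L2,
    {ae mu, forall x, E x -> f i x = 0} & (N2 (f i \- g) < (e `^ 2^-1)%:E)%E].
  by near=> i; split; near: i; [exact: fL|exact: f0|exact: small].
have [i [fiL fi0 fie]] := filter_ex near_i.
have hL := Lfun2_sub fiL gL.
apply: (@le_trans _ _ (\int[mu]_x (`|(f i \- g) x| `^ 2)%:E)%E).
  have mh : measurable_fun setT (fun x => (`|(f i \- g) x| `^ 2)%:E : \bar R).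
    apply/measurable_EFinP; apply: (measurableT_comp (measurable_powR _)).
    by apply: measurableT_comp => //; exact: (Lfun2_measurable hL).
  apply: (@le_trans _ _ (\int[mu]_(x in E) (`|(f i \- g) x| `^ 2)%:E)%E).
    apply: ae_ge0_le_integral => //.
    - by apply: measurableT_comp.
    - exact: measurable_funTS.
    - apply: filterS fi0 => x fx Ex /=; rewrite fx// sub0r normrN.
      by rewrite lee_fin ger0_norm ?powR_ge0.
  by apply: ge0_subset_integral => // x _; rewrite lee_fin powR_ge0.
have := @powR_Lnorm _ _ _ mu (EFin \o (f i \- g)) 2 _.
have h2 : (2 : R) != 0 by [].
move=> /(_ h2) E2.
have -> : (\int[mu]_x (`|(f i \- g) x| `^ 2)%:E = N2 (f i \- g) `^ 2)%E.
  by rewrite E2; apply: eq_integral => x _ /=; rewrite -poweR_EFin.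
have nf := Lfun2_fin_num hL.
move: fie; rewrite -(fineK nf) poweR_EFin lte_fin lee_fin => fie.
have -> : e = (e `^ 2^-1) `^ 2 by rewrite -powRrM mulVf// powRr1// (ltW e0).
apply: ge0_ler_powR; rewrite ?nnegrE ?powR_ge0 ?(ltW fie)//.
by apply: fine_ge0; exact: Lnorm_ge0.
Unshelve. all: by end_near. Qed.

Lemma ae_eq_Rintegral (D : set T) f g : measurable D ->
  measurable_fun D f -> measurable_fun D g ->
  {ae mu, forall x, D x -> f x = g x} ->
  \int[mu]_(x in D) f x = \int[mu]_(x in D) g x.
Proof.
move=> mD mf mg fg; rewrite /Rintegral; congr fine; apply: ae_eq_integral => //.
- exact/measurable_EFinP.
- exact/measurable_EFinP.
- by apply: filterS fg => x fg Dx; rewrite fg.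
Qed.

End L2_pairing.

(** * Countable bases and supports up to null sets *)

Definition countable_base (X : topologicalType) (B : nat -> set X) :=
  (forall i, open (B i)) /\
  forall U x, open U -> U x -> exists i, B i x /\ B i `<=` U.

Lemma dense_countable_base (R : realType) (X : normedModType R) (C : countType)
    (q : C -> X) :
  (forall x (e : R), 0 < e -> exists c, ball x e (q c)) ->
  countable_base (fun i => if unpickle i is Some (c, k)
    then ball (q c) (k.+1%:R^-1 : R) else set0).
Proof.
move=> dens; split=> [i|U x oU Ux].
  case: unpickle => [[c k]|]; [exact: ball_open|exact: open0].
have [e /= e0 eU] : exists2 e : R, 0 < e & ball x e `<=` U.
  have /nbhs_ballP[e /= e0 H] : nbhs x U by apply: open_nbhs_nbhs.
  by exists e.
have [k ke] : exists k : nat, k.+1%:R^-1 < e / 2.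
  have e2 : 0 < e / 2 by rewrite divr_gt0.
  exists (Num.truncn (e / 2)^-1).
  rewrite -[ltRHS]invrK ltf_pV2 ?posrE ?invr_gt0//.
  exact: truncnS_gt.
have k0 : 0 < k.+1%:R^-1 :> R by rewrite invr_gt0.
have [c xc] := dens x _ k0.
exists (pickle (c, k)); rewrite pickleK; split; first exact: ball_sym.
move=> y cy; apply: eU; apply: (@ball_split _ _ (q c)).
  by apply: le_ball xc; exact: ltW.
by apply: le_ball cy; exact: ltW.
Qed.

Lemma rat_in_ball (R : realType) (x e : R) : 0 < e -> exists c : rat, ball x e (ratr c : R).
Proof.
move=> e0; have [c] := @rat_in_itvoo R (x - e) (x + e) (ltac:(lra)).
by rewrite in_itv/= => h; exists c; rewrite ball_itv /= in_itv.
Qed.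

Lemma rat_in_ball_rV (R : realType) n (x : 'rV[R]_n) (e : R) : 0 < e ->
  exists c : 'rV[rat]_n, ball x e (map_mx ratr c).
Proof.
move=> e0; have /choice[c hc] : forall i, exists c : rat, ball (x ord0 i) e (ratr c : R).
  by move=> i; exact: rat_in_ball.
by exists (\row_i c i); split=> // i j; rewrite !mxE ord1.
Qed.

Definition rV_base (R : realType) n (i : nat) : set 'rV[R]_n :=
  if unpickle i is Some (c, k)
  then ball (map_mx ratr (c : 'rV[rat]_n) : 'rV[R]_n) (k.+1%:R^-1 : R) else set0.

Lemma rV_countable_base (R : realType) n : countable_base (@rV_base R n).
Proof.
by apply: (@dense_countable_base R 'rV[R]_n) => x e e0; exact: rat_in_ball_rV.
Qed.

Definition spacetime_base (R : realType) n (i : nat) : set (R * 'rV[R]_n) :=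
  if unpickle i is Some (c, k)
  then ball ((ratr c.1 : R, map_mx ratr (c.2 : 'rV[rat]_n)) : R * 'rV[R]_n)
    (k.+1%:R^-1 : R) else set0.

Lemma spacetime_countable_base (R : realType) n : countable_base (@spacetime_base R n).
Proof.
apply: (@dense_countable_base R (R * 'rV[R]_n)%type (rat * 'rV[rat]_n)%type
  (fun c => (ratr c.1, map_mx ratr c.2))) => x e e0.
have [c1 h1] := rat_in_ball x.1 e0; have [c2 h2] := rat_in_ball_rV x.2 e0.
by exists (c1, c2); split.
Qed.

Lemma measurable_rV_base (R : realType) n i : measurable (@rV_base R n i).
Proof.
rewrite /rV_base; case: unpickle => [[c k]|]; last exact: measurable0.
rewrite (_ : ball _ _ = [set x : 'rV[R]_n | forall j,
    ball (map_mx ratr c ord0 j : R) (k.+1%:R^-1 : R) (x ord0 j)]).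
  apply: (@measurable_rV_box R n (fun j => ball (map_mx ratr c ord0 j : R) _)) => j.
  exact: measurable_ball.
apply/seteqP; split => x /=; first by move=> [_ h] j; exact: h.
by move=> h; split; [rewrite invr_gt0|move=> i' j; rewrite ord1; exact: h].
Qed.

(** The sigma-algebra is generated by the coordinates; balls of the sup norm are boxes, hence
    measurable, and countably many rational ones exhaust any open set. *)
Lemma measurable_rV_open (R : realType) n (U : set 'rV[R]_n) : open U -> measurable U.
Proof.
move=> oU; have [_ base] := rV_countable_base R n.
rewrite (_ : U = \bigcup_(i in [set i | rV_base i `<=` U]) rV_base i).
  by apply: bigcup_measurable => i _; exact: measurable_rV_base.
apply/seteqP; split => x; last by move=> [i /= iU ix]; exact: iU.
by move=> Ux; have [i [ix iU]] := base U x oU Ux; exists i.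
Qed.

Lemma continuous_measurable_rV (R : realType) n (f : 'rV[R]_n -> R) :
  continuous f -> measurable_fun setT f.
Proof.
move=> cf; apply: (measurability _ (RGenOpens.measurableE R)).
move=> _ [_ [a [b ->]] <-]; rewrite setTI; apply: measurable_rV_open.
by apply: open_comp; [move=> x _; exact: cf|exact: interval_open].
Qed.

(** The complement of the support is a union of possibly uncountably many open sets on which [f] is
    null; a countable base replaces them by countably many. Keeping [ae] abstract lets the same
    argument serve space and space-time. *)
Lemma ess_support_ae0 (R : realType) (X : topologicalType) (ae : set_system X) (D : set X)
    (f : X -> R) (B : nat -> set X) :
  countable_base B ->
  (forall F : nat -> set X, (forall i, ae (F i)) -> ae (\bigcap_i F i)) ->
  (forall P Q : set X, P `<=` Q -> ae P -> ae Q) -> ae setT ->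
  ae [set y | D y -> ~ ess_support ae D f y -> f y = 0].
Proof.
move=> [_ base] aeI aeS aeT.
pose G i := [set y | D y -> B i y -> f y = 0].
(* Base sets on which [f] is not null almost everywhere impose no condition. *)
pose F i := if `[< ae (G i) >] then G i else setT.
apply: (aeS (\bigcap_i F i)) => [y Fy Dy /= nsy|]; last first.
  by apply: aeI => i; rewrite /F; case: asboolP.
have [U [oU Uy aeU]] : exists U, [/\ open U, U y & ae [set y | D y -> U y -> f y = 0]].
  apply: contrapT => noU; apply: nsy; split=> // U oU Uy aeU.
  by apply: noU; exists U.
have [i [iy iU]] := base U y oU Uy.
have aeGi : ae (G i) by apply: (aeS _ _ _ aeU) => z /= h Dz Bz; apply: h => //; exact: iU.
by have := Fy i I; rewrite /F asboolT//; exact.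
Qed.

(** * Mass of the plane wave on the cone *)

Lemma ge0_integral_rV_lebesgueS (R : realType) n (f : 'rV[R]_n.+1 -> \bar R) :
  measurable_fun setT f -> (forall x, 0 <= f x)%E ->
  (\int[rV_lebesgue]_x f x =
   \int[lebesgue_measure]_a \int[rV_lebesgue]_y f (rV_cons (a, y)))%E.
Proof.
move=> mf f0.
have -> : (\int[rV_lebesgue]_x f x =
    \int[(lebesgue_measure \x @rV_lebesgue R n)]_z f (rV_cons z))%E.
  have := @ge0_integral_pushforward _ _ _ _ R _ (@measurable_rV_cons R n)
    (lebesgue_measure \x @rV_lebesgue R n)%E setT f measurableT mf (fun x _ => f0 x).
  rewrite preimage_setT => <-. apply: eq_measure_integral => //.
  exact: measurable_rV_cons.
rewrite (fubini_tonelli1 (fun z => f (rV_cons z)))//.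
exact: measurableT_comp (@measurable_rV_cons R n).
Qed.

Lemma rV_consE (R : realType) n (a : R) (y : 'rV[R]_n) :
  (rV_cons (a, y) ord0 ord0 = a) * (forall i, rV_cons (a, y) ord0 (lift ord0 i) = y ord0 i).
Proof.
split=> [|i].
  by have /(congr1 fst) := rV_consK ((a : measurableTypeR R), y).
rewrite (_ : lift ord0 i = @rshift 1 n i); first exact: row_mxEr.
exact/val_inj.
Qed.

Lemma enorm_rV_cons (R : realType) n (a : R) (y : 'rV[R]_n) :
  enorm (rV_cons (a, y)) ^+ 2 = a ^+ 2 + enorm y ^+ 2.
Proof.
rewrite !enorm_sqr big_ord_recl (rV_consE a y).1; congr (_ + _).
by apply: eq_bigr => i _; rewrite (rV_consE a y).2.
Qed.

Lemma measurable_enorm (R : realType) n : measurable_fun setT (@enorm R n).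
Proof. by apply: continuous_measurable_rV; exact: continuous_enorm. Qed.

Lemma measurable_enorm_le (R : realType) n (rho : R) :
  measurable [set x : 'rV[R]_n | enorm x <= rho].
Proof.
rewrite (_ : [set _ | _] = @enorm R n @^-1` `]-oo, rho]%classic).
  by rewrite -[X in measurable X]setTI; exact: measurable_enorm.
by apply/seteqP; split => x /=; rewrite in_itv.
Qed.

(** The slice lies in a cube of side 2 s with s^2 = rho^2 - a^2, and (2 s)^2 <= 8 rho (rho - a). The
    factor (rho - a)^(n / 2) is absorbed by exp ((rho - a) / 2), half of the available decay: what
    is left is e^(rho / 2) e^(a / 2), whose integral is still of order e^rho. *)
Lemma section_le (R : realType) n (rho a : R) : 0 < rho ->
  (\int[@rV_lebesgue R n]_y
     ((expR a * \1_[set x : 'rV[R]_n.+1 | enorm x <= rho] (rV_cons (a, y)))%:E)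
   <= (Num.sqrt (8 * n.+1%:R * rho) ^+ n * expR (rho / 2) *
       (expR (a / 2) * \1_(`[- rho, rho]%classic) a))%:E)%E.
Proof.
move=> rho0; set E := [set x : 'rV[R]_n.+1 | enorm x <= rho].
have sq y : enorm (rV_cons (a, y)) <= rho -> a ^+ 2 + enorm (y : 'rV[R]_n) ^+ 2 <= rho ^+ 2.
  by rewrite -enorm_rV_cons => h; rewrite lerXn2r ?nnegrE ?enorm_ge0 ?(ltW rho0).
have [aI|aI] := boolP (a \in `[- rho, rho]); last first.
  rewrite (eq_integral (cst 0%E)); last first.
    move=> y _ /=; rewrite indicE memNset ?mulr0//= => /sq h.
    move: aI; rewrite in_itv/= -ler_norml => /negP; apply.
    rewrite -(ler_pXn2r (n := 2))// ?nnegrE ?(ltW rho0)// real_normK ?num_real//.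
    by apply: le_trans h; rewrite lerDl sqr_ge0.
  by rewrite integral0 lee_fin !mulr_ge0 ?exprn_ge0 ?sqrtr_ge0 ?expR_ge0.
rewrite [X in expR (a / 2) * X]indicE mem_set//= mulr1.
move: aI; rewrite in_itv/= => /andP[a1 a2].
pose s := Num.sqrt (rho ^+ 2 - a ^+ 2).
have a22 : a ^+ 2 <= rho ^+ 2.
  rewrite -[a ^+ 2]real_normK ?num_real//.
  by rewrite lerXn2r ?nnegrE ?(ltW rho0)// ler_norml a1.
pose box := [set y : 'rV[R]_n | forall i, `[- s, s]%classic (y ord0 i)].
have mbox : measurable box by exact: (@measurable_rV_box R n (fun=> `[- s, s]%classic)).
have box_vol : (rV_lebesgue box = ((2 * s) ^+ n)%:E)%E.
  rewrite (@rV_lebesgue_box R n (fun=> `[- s, s]%classic))//.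
  rewrite (eq_bigr (fun=> (2 * s)%:E)) => [|i _]; last first.
    rewrite lebesgue_measure_itv /= lte_fin.
    have : 0 <= s by exact: sqrtr_ge0.
    rewrite le_eqVlt => /predU1P[<-|s0].
      by rewrite oppr0 ltxx mulr0.
    rewrite ifT; last by lra.
    by rewrite -EFinD opprK; congr EFin; lra.
  by rewrite prodEFin prodr_const card_ord.
have mE : measurable_fun setT (fun y : 'rV[R]_n => \1_E (rV_cons (a, y)) : R).
  have mc : measurable_fun setT (fun y : 'rV[R]_n => rV_cons ((a : measurableTypeR R), y)).
    apply: measurableT_comp (@measurable_rV_cons R n) _.
    by apply: measurable_fun_pair; [exact: measurable_cst|exact: measurable_id].
  by apply: measurableT_comp mc; apply: measurable_indic; exact: measurable_enorm_le.
apply: (@le_trans _ _ (\int[@rV_lebesgue R n]_y ((expR a)%:E * (\1_box y)%:E))%E).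
  apply: ge0_le_integral => //.
  - by apply/measurable_EFinP; exact: measurable_funM.
  - by apply: emeasurable_funM => //; apply/measurable_EFinP; exact: measurable_indic.
  - move=> y _; rewrite -EFinM lee_fin ler_wpM2l ?expR_ge0// !indicE.
    have [yE|//] := boolP (rV_cons (a, y) \in E).
    rewrite mem_set//= => i; rewrite /= in_itv/= -ler_norml.
    apply: le_trans (coord_le_enorm y i) _.
    rewrite -[leLHS]ger0_norm ?enorm_ge0// -sqrtr_sqr ler_wsqrtr//.
    by move: yE; rewrite inE => /sq; lra.
rewrite ge0_integralZl//; last first.
  by apply/measurable_EFinP; exact: measurable_indic.
rewrite integral_indic// setIT.
rewrite [X in (_ * X)%E](_ : _ = ((2 * s) ^+ n)%:E)%E; last exact: box_vol.
rewrite -EFinM lee_fin.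
have s2 : (2 * s) ^+ n <= Num.sqrt (8 * rho * (rho - a)) ^+ n.
  rewrite lerXn2r ?nnegrE ?sqrtr_ge0 ?mulr_ge0 ?sqrtr_ge0//.
  have -> : 2 * s = Num.sqrt (4 * (rho ^+ 2 - a ^+ 2)).
    rewrite sqrtrM// (_ : 4 = 2 ^+ 2 :> R) ?sqrtr_sqr ?ger0_norm//.
    by rewrite expr2; ring.
  rewrite ler_wsqrtr// !expr2; nra.
apply: (le_trans (ler_wpM2l (expR_ge0 a) s2)).
(* Any N >= n would do in y <= N exp (y / N), whose power n / 2 is then bounded through exp (y / 2);
   the successor is positive even for n = 0. *)
pose N : R := n.+1%:R.
have N0 : 0 < N by rewrite ltr0n.
have y_le : rho - a <= N * expR ((rho - a) / N).
  rewrite mulrC -ler_pdivrMr//; by apply: le_trans (expR_ge1Dx _); rewrite lerDr.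
have s3 : Num.sqrt (8 * rho * (rho - a)) ^+ n <=
    Num.sqrt (8 * N * rho) ^+ n * expR ((rho - a) / 2).
  apply: (@le_trans _ _ (Num.sqrt (8 * N * rho * expR ((rho - a) / N)) ^+ n)).
    rewrite lerXn2r ?nnegrE ?sqrtr_ge0// ler_wsqrtr//.
    have -> : 8 * N * rho * expR ((rho - a) / N) = 8 * rho * (N * expR ((rho - a) / N)).
      by ring.
    by rewrite ler_wpM2l// mulr_ge0// ltW.
  rewrite sqrtrM ?mulr_ge0 ?(ltW rho0) ?(ltW N0)// exprMn ler_wpM2l ?exprn_ge0 ?sqrtr_ge0//.
  have -> : Num.sqrt (expR ((rho - a) / N)) = expR ((rho - a) / N / 2).
    rewrite -[RHS]ger0_norm ?expR_ge0// -sqrtr_sqr expr2 -expRD; congr (Num.sqrt (expR _)).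
    by field; rewrite gt_eqF.
  rewrite -expRM_natl ler_expR.
  have -> : n%:R * ((rho - a) / N / 2) = (rho - a) / 2 * (n%:R / N).
    by field; rewrite gt_eqF.
  by rewrite ler_piMr ?divr_ge0 ?subr_ge0// ler_pdivrMr// mul1r ler_nat.
apply: (le_trans (ler_wpM2l (expR_ge0 a) s3)).
rewrite mulrCA -!mulrA ler_wpM2l ?exprn_ge0 ?sqrtr_ge0//.
by rewrite -!expRD ler_expR; lra.
Qed.

Lemma integral_exp_half (R : realType) (rho : R) : 0 < rho ->
  (\int[lebesgue_measure]_(a in `[(- rho)%R, rho]) (expR (a / 2))%:E <= (2 * expR (rho / 2))%:E)%E.
Proof.
move=> rho0.
have dF x : is_derive x (1 : R) (fun a : R => 2 * expR (a / 2)) (expR (x / 2)).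
  have d1 : is_derive x (1 : R) (fun a : R => a / 2) 2^-1.
    have := is_deriveZ (2^-1 : R) (is_derive_id x (1 : R)).
    rewrite [_ *: 1]mulr1; congr (is_derive _ _ _ _).
    by apply/funext => y; rewrite mulrC.
  have d2 : is_derive x (1 : R) (fun a : R => expR (a / 2)) (expR (x / 2) * 2^-1).
    exact: is_derive_comp1.
  have := is_deriveZ (2 : R) d2; rewrite /GRing.scale /= mulrC divfK//.
have cF : continuous (fun a : R => expR (a / 2)).
  move=> x; apply: continuous_comp; last exact: continuous_expR.
  by apply: cvgM; [exact: cvg_id|exact: cvg_cst].
rewrite (@continuous_FTC2 _ _ (fun a => 2 * expR (a / 2))).
- by rewrite -EFinB lee_fin lerBlDr lerDl mulr_ge0 ?expR_ge0.
- lra.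
- exact: continuous_subspaceT.
- have cF2 : continuous (fun a : R => 2 * expR (a / 2)).
    by move=> x; apply: cvgM; [exact: cvg_cst|exact: cF].
  split.
  + by move=> x _; have [] := dF x.
  + exact/cvg_at_right_filter/cF2.
  + exact/cvg_at_left_filter/cF2.
- by move=> x _; rewrite derive1E; have [] := dF x.
Qed.

(* The slice [x_0 = a] of the ball of radius [rho] has measure
   O((rho (rho - a))^(n/2)), and [e^a] integrates this to O(e^rho rho^(n/2)). *)
Lemma plane_wave_mass (R : realType) n (r : R) : 0 < r ->
  exists2 C : R, 0 < C & forall t, 0 <= t ->
    (\int[rV_lebesgue]_(x in [set x : 'rV[R]_n.+1 | (enorm x <= t + r)%R])
       (expR (x ord0 ord0))%:E <= (C * expR t * (1 + t) `^ (n%:R / 2))%:E)%E.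
Proof.
(* The 1 + r in [D] comes from t + r <= (1 + r) (1 + t). *)
move=> r0; pose D := Num.sqrt (8 * n.+1%:R * (1 + r)) ^+ n.
have D0 : 0 < D by rewrite exprn_gt0// sqrtr_gt0 !mulr_gt0//; lra.
exists (2 * D * expR r); first by rewrite !mulr_gt0 ?expR_gt0.
move=> t t0; set rho := t + r; have rho0 : 0 < rho by rewrite /rho; lra.
set E := [set x : 'rV[R]_n.+1 | enorm x <= rho].
have mE : measurable E by exact: measurable_enorm_le.
have mexp : measurable_fun setT (fun x : 'rV[R]_n.+1 => expR (x ord0 ord0)).
  by apply: measurableT_comp; [exact: measurable_expR|exact: measurable_rV_coord].
have -> : (\int[rV_lebesgue]_(x in E) (expR (x ord0 ord0))%:E =
    \int[rV_lebesgue]_x (expR (x ord0 ord0) * \1_E x)%:E)%E.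
  rewrite integral_mkcond; apply: eq_integral => x _; rewrite patchE indicE.
  by case: ifP; rewrite ?mulr1 ?mulr0.
rewrite ge0_integral_rV_lebesgueS; last first.
- by move=> x; rewrite lee_fin mulr_ge0 ?expR_ge0.
- apply/measurable_EFinP; apply: measurable_funM; first exact: mexp.
  exact: measurable_indic.
under eq_integral do (under eq_integral do rewrite (rV_consE _ _).1).
set K := Num.sqrt (8 * n.+1%:R * rho) ^+ n * expR (rho / 2).
have K0 : 0 <= K by rewrite mulr_ge0 ?exprn_ge0 ?sqrtr_ge0 ?expR_ge0.
have mh : measurable_fun setT (fun a : R => expR (a / 2) * \1_(`[- rho, rho]%classic) a : R).
  apply: measurable_funM; last exact: measurable_indic.
  by apply: measurableT_comp; [exact: measurable_expR|exact: measurable_funM].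
apply: (@le_trans _ _ (\int[lebesgue_measure]_a
    (K%:E * (expR (a / 2) * \1_(`[- rho, rho]%classic) a)%:E))%E).
  apply: ge0_le_integral => //.
  - by move=> a _; apply: integral_ge0 => y _; rewrite lee_fin mulr_ge0 ?expR_ge0.
  - pose g (z : measurableTypeR R * 'rV[R]_n) : \bar R := (expR z.1 * \1_E (rV_cons z))%:E.
    have mg : measurable_fun setT g.
      apply/measurable_EFinP; apply: measurable_funM.
        by apply: measurableT_comp; [exact: measurable_expR|exact: measurable_fst].
      apply: measurableT_comp; last exact: measurable_rV_cons.
      exact: measurable_indic.
    have g0 z : (0 <= g z)%E by rewrite lee_fin mulr_ge0 ?expR_ge0.
    exact: (@measurable_fun_fubini_tonelli_F _ _ _ _ R (@rV_lebesgue R n) g mg g0).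
  - by apply: emeasurable_funM => //; exact/measurable_EFinP.
  - by move=> a _; rewrite -EFinM; exact: section_le.
rewrite ge0_integralZl//; last first.
  exact/measurable_EFinP.
have -> : (\int[lebesgue_measure]_a (expR (a / 2) * \1_(`[- rho, rho]%classic) a)%:E =
    \int[lebesgue_measure]_(a in `[(- rho)%R, rho]) (expR (a / 2))%:E)%E.
  rewrite [RHS]integral_mkcond; apply: eq_integral => x _; rewrite patchE indicE.
  by case: ifP; rewrite ?mulr1 ?mulr0.
apply: le_trans (lee_wpmul2l _ (integral_exp_half rho0)) _; first by rewrite lee_fin.
rewrite -EFinM lee_fin /K.
have -> : (1 + t) `^ (n%:R / 2) = Num.sqrt (1 + t) ^+ n.
  rewrite mulrC powRrM powR12_sqrt; last lra.
  by rewrite powR_mulrn// sqrtr_ge0.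
have s1 : Num.sqrt (8 * n.+1%:R * rho) ^+ n <= D * Num.sqrt (1 + t) ^+ n.
  rewrite /D -exprMn -sqrtrM; last by rewrite !mulr_ge0//; lra.
  rewrite lerXn2r ?nnegrE ?sqrtr_ge0// ler_wsqrtr//.
  by rewrite -[leRHS]mulrA; apply: ler_wpM2l; [rewrite mulr_ge0|rewrite /rho; nra].
have -> : Num.sqrt (8 * n.+1%:R * rho) ^+ n * expR (rho / 2) * (2 * expR (rho / 2)) =
    2 * expR rho * Num.sqrt (8 * n.+1%:R * rho) ^+ n.
  have -> : expR rho = expR (rho / 2) * expR (rho / 2) by rewrite -expRD -splitr.
  by ring.
have -> : 2 * D * expR r * expR t * Num.sqrt (1 + t) ^+ n =
    2 * expR rho * (D * Num.sqrt (1 + t) ^+ n) by rewrite /rho expRD; ring.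
by rewrite ler_wpM2l// mulr_ge0 ?expR_ge0.
Qed.

(** * Space-time supports and time slices *)

Section support.
Context (R : realType) (n : nat).
Local Notation leb := (@lebesgue_measure R).
Local Notation lebn := (@rV_lebesgue R n).

Lemma spacetime_ae_section (P : R -> 'rV[R]_n -> Prop) :
  {ae @spacetime_lebesgue R n, forall z, P z.1 z.2} ->
  {ae leb, forall s, {ae lebn, forall x, P s x}}.
Proof.
move=> [N [mN N0 PN]].
have mF : measurable_fun setT (fun s => lebn (xsection N s)).
  exact: (measurable_fun_xsection lebn mN).
have : (\int[leb]_s `|lebn (xsection N s)| = 0)%E.
  rewrite -[RHS]N0; apply: eq_integral => s _.
  by rewrite gee0_abs// measure_ge0.
move/(ae_eq_integral_abs leb measurableT mF); apply: filterS => s /= Ns.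
exists (xsection N s); split; [exact: measurable_xsection|exact: Ns|].
by move=> x /= nP; rewrite /xsection/= inE; apply: PN.
Qed.

Lemma spacetime_support_ae (T : \bar R) (u : R -> 'rV[R]_n -> R) (r : R) :
  supp_spacetime T u `<=` [set z | enorm z.2 <= z.1 + r] ->
  {ae leb, forall s, time_ivl T s ->
     {ae lebn, forall x, s + r < enorm x -> u s x = 0}}.
Proof.
move=> su.
have H : {ae @spacetime_lebesgue R n, forall z,
    spacetime T z -> ~ supp_spacetime T u z -> u z.1 z.2 = 0}.
  apply: (@ess_support_ae0 R (R * 'rV[R]_n)%type (almost_everywhere (@spacetime_lebesgue R n))
    (spacetime T) (fun z => u z.1 z.2) (@spacetime_base R n)).
  - exact: spacetime_countable_base.
  - by move=> F aeF; apply: filterS (ae_foralln aeF) => z Fz i _; exact: Fz.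
  - by move=> P Q PQ; apply: negligibleS; exact: subsetC.
  - by rewrite /almost_everywhere setCT; exact: negligible_set0.
have : {ae leb, forall s, {ae lebn, forall x, time_ivl T s -> s + r < enorm x -> u s x = 0}}.
  apply: (@spacetime_ae_section (fun s x => time_ivl T s -> s + r < enorm x -> u s x = 0)).
  apply: negligibleS H; apply: subsetC => -[s x] /= h Ts sx.
  by apply: h => // /su /=; rewrite leNgt sx.
apply: negligibleS; apply: subsetC => s hs Ts.
by apply: filterS hs => x h; exact: h.
Qed.

Lemma ae_dense (P : R -> Prop) (a b : R) : a < b -> {ae leb, forall s, P s} ->
  exists2 s, a < s < b & P s.
Proof.
move=> ab [N [mN N0 PN]]; apply: contrapT => none.
have sub : `]a, b[%classic `<=` N.
  move=> s /=; rewrite in_itv/= => sab; apply: PN => /= Ps.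
  by apply: none; exists s.
have : (leb `]a, b[%classic <= leb N)%E.
  by apply: le_measure => //; rewrite inE.
rewrite N0 lebesgue_measure_itv/= lte_fin ab -EFinB lee_fin; lra.
Qed.

End support.

Section support_slices.
Context (R : realType) (n : nat).
Local Notation lebn := (@rV_lebesgue R n).
Variables (T : \bar R) (u ut : R -> 'rV[R]_n -> R) (r : R).
Hypotheses (cu : C0_L2 (time_ivl T) u) (cut : C1_L2 (time_ivl T) u ut)
  (su : supp_spacetime T u `<=` [set z | enorm z.2 <= z.1 + r]).

Lemma time_ivl_right s : time_ivl T s -> exists2 h : R, 0 < h &
  forall x, s <= x -> x < s + h -> time_ivl T x.
Proof.
move=> [s0 sT].
have [b sb bT] : exists2 b : R, s < b & forall x, x < b -> (x%:E < T)%E.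
  case: T sT => [t| |//].
    by rewrite lte_fin => st; exists t => // x; rewrite lte_fin.
  by move=> _; exists (s + 1) => [|x _]; [rewrite ltrDl|rewrite ltry].
exists (b - s); first by rewrite subr_gt0.
move=> x sx xb; split; first exact: le_trans sx.
by apply: bT; move: xb; rewrite addrC subrK.
Qed.

Lemma measurable_enorm_gt (c : R) : measurable [set x : 'rV[R]_n | c < enorm x].
Proof.
rewrite (_ : [set _ | _] = ~` [set x | enorm x <= c]).
  by apply: measurableC; exact: measurable_enorm_le.
by apply/seteqP; split => x /=; rewrite ltNge => /negP.
Qed.

Lemma ae_enorm_gt (f : 'rV[R]_n -> R) (c : R) :
  (forall d, 0 < d -> {ae lebn, forall x, c + d < enorm x -> f x = 0}) ->
  {ae lebn, forall x, c < enorm x -> f x = 0}.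
Proof.
move=> H; have k0 (k : nat) : 0 < k.+1%:R^-1 :> R by rewrite invr_gt0.
have := ae_foralln (fun k : nat => H k.+1%:R^-1 (k0 k)).
apply: filterS => x hx cx.
have [k kd] : exists k : nat, k.+1%:R^-1 < enorm x - c.
  have e2 : 0 < enorm x - c by rewrite subr_gt0.
  exists (Num.truncn (enorm x - c)^-1).
  rewrite -[ltRHS]invrK ltf_pV2 ?posrE ?invr_gt0//.
  exact: truncnS_gt.
by apply: (hx k); rewrite -ltrBrDl.
Qed.

Let harm (h : R) (s : R) : (fun k : nat => s + h / k.+1%:R) @ \oo --> s.
Proof.
rewrite -[X in _ --> X]addr0; apply: cvgD; first exact: cvg_cst.
rewrite -[X in _ --> X](mulr0 h); apply: cvgM; first exact: cvg_cst.
exact: cvg_harmonic.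
Qed.

(** Fubini gives the support property at almost every time only. Good times approach [s] from the
    right, which is possible even at s = 0, and L2 continuity carries the property to the limit. The
    radius grows by an arbitrary [d] on the way, which [ae_enorm_gt] removes. *)
Lemma support_slice s : time_ivl T s ->
  {ae lebn, forall x, s + r < enorm x -> u s x = 0}.
Proof.
move=> Ts; have [h h0 sh] := time_ivl_right Ts.
have [L2u contu] := cu.
have good (k : nat) : exists s', s < s' < s + h / k.+1%:R /\
    (time_ivl T s' -> {ae lebn, forall x, s' + r < enorm x -> u s' x = 0}).
  have [|s' s's us'] := @ae_dense R _ s (s + h / k.+1%:R) _ (spacetime_support_ae su).
    by rewrite ltrDl divr_gt0.
  by exists s'.
have {good}[g hg] := choice good.
have gT k : time_ivl T (g k).
  have [/andP[g1 g2] _] := hg k; apply: sh; first exact: ltW.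
  apply: lt_le_trans g2 _; rewrite lerD2l ler_pdivrMr// ler_pMr//.
  by rewrite ler1n.
have gs : g @ \oo --> s.
  apply: (@squeeze_cvgr _ _ _ _ (fun=> s) (fun k : nat => s + h / k.+1%:R)).
  - by near=> k; have [/andP[g1 g2] _] := hg k; rewrite !ltW.
  - exact: cvg_cst.
  - exact: harm.
have gw : g @ \oo --> within (time_ivl T) (nbhs s).
  move=> A HA; have H : \forall k \near \oo, time_ivl T (g k) -> A (g k) := gs _ HA.
  suff : \forall k \near \oo, A (g k) by [].
  by apply: filterS H => k; apply.
apply: ae_enorm_gt => d d0.
apply: (@Lfun2_cvg_ae0 _ _ R lebn nat \oo _ (fun k => u (g k)) (u s)).
- exact: measurable_enorm_gt.
- by near=> k; exact: L2u.
- exact: L2u.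
- exact: (cvg_comp g _ gw (contu s Ts)).
- near=> k; have [_ /(_ (gT k))] := hg k.
  apply: filterS => x h1 h2; apply: h1.
  have : g k < s + d by near: k; apply: (cvgr_lt _ gs); rewrite ltrDl.
  lra.
Unshelve. all: by end_near. Qed.

(** The difference quotients of [u] vanish outside a slightly larger ball and converge to [ut s] in
    L2. *)
Lemma support_slice_derive s : time_ivl T s ->
  {ae lebn, forall x, s + r < enorm x -> ut s x = 0}.
Proof.
move=> Ts; have [h h0 sh] := time_ivl_right Ts.
have [L2u _] := cu; have [_ [L2ut _] dut] := cut.
pose g k : R := s + h / 2 / k.+1%:R.
have hk (k : nat) : 0 < h / 2 / k.+1%:R <= h / 2.
  rewrite !divr_gt0//= ler_pdivrMr// ler_pMr ?divr_gt0//.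
  by rewrite ler1n.
have gT k : time_ivl T (g k).
  by apply: sh; rewrite /g; have /andP[] := hk k; set y := h / 2 / _ => h1 h2; lra.
have gs : g @ \oo --> s by exact: harm.
have gw : g @ \oo --> within (time_ivl T) s^'.
  move=> A HA; have gne k : g k != s.
    by rewrite /g; have /andP[h1 _] := hk k; rewrite gt_eqF// ltrDl.
  have sA : \forall x \near s, x != s -> time_ivl T x -> A x := HA.
  have H : \forall k \near \oo, g k != s -> time_ivl T (g k) -> A (g k) := gs _ sA.
  suff : \forall k \near \oo, A (g k) by [].
  by apply: filterS H => k; apply.
apply: ae_enorm_gt => d d0.
apply: (@Lfun2_cvg_ae0 _ _ R lebn nat \oo _
  (fun k => (g k - s)^-1 \*: (u (g k) \- u s)) (ut s)).
- exact: measurable_enorm_gt.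
- by near=> k; apply: Lfun2_scale; apply: Lfun2_sub; exact: L2u.
- exact: L2ut.
- exact: (cvg_comp g _ gw (dut s Ts)).
- near=> k; have := support_slice (gT k); apply: filterS2 (support_slice Ts) => x h1 h2 h3.
  have gd : g k < s + d by near: k; apply: (cvgr_lt _ gs); rewrite ltrDl.
  by rewrite /= h1 ?h2 ?subr0 ?scaler0//; lra.
Unshelve. all: by end_near. Qed.

End support_slices.

Lemma L2_bounded_box (R : realType) n (f : 'rV[R]_n -> R) (C M : R) :
  measurable_fun setT f -> (forall x, `|f x| <= C) ->
  (forall x, f x != 0 -> forall i, `[- M, M]%classic (x ord0 i)) -> L2 f.
Proof.
move=> mf fC fM; rewrite /L2 /= inE; apply/andP; split; rewrite inE//=.
pose box := [set x : 'rV[R]_n | forall i, `[- M, M]%classic (x ord0 i)].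
have mbox : measurable box by exact: (@measurable_rV_box R n (fun=> `[- M, M]%classic)).
have box_fin : (@rV_lebesgue R n box < +oo)%E.
  rewrite (@rV_lebesgue_box R n (fun=> `[- M, M]%classic))//.
  have -> : lebesgue_measure `[- M, M]%classic = (fine (lebesgue_measure `[- M, M]%classic))%:E.
    by rewrite fineK// lebesgue_measure_itv/=; case: ifP.
  by rewrite prodEFin ltry.
rewrite /finite_norm unlock poweR_lty//.
apply: (@le_lt_trans _ _ (\int[rV_lebesgue]_x ((C `^ 2)%:E * (\1_box x)%:E))%E).
  apply: ge0_le_integral => //.
  - by move=> x _; rewrite poweR_EFin lee_fin powR_ge0.
  - apply: (_ : measurable_fun setT (EFin \o (fun x => `|f x| `^ 2))).
    apply/measurable_EFinP; apply: (measurableT_comp (measurable_powR _)).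
    exact: measurableT_comp.
  - by apply: emeasurable_funM => //; apply/measurable_EFinP; exact: measurable_indic.
  - move=> x _; rewrite /= lee_fin indicE.
    have [->|fx] := eqVneq (f x) 0.
      by rewrite normr0 powR0 ?mulr_ge0 ?powR_ge0.
    rewrite mem_set//=; last exact: fM.
    by rewrite mulr1 powR_le.
rewrite ge0_integralZl//; last 2 first.
- by apply/measurable_EFinP; exact: measurable_indic.
- by rewrite lee_fin powR_ge0.
by rewrite integral_indic// setIT lte_mul_pinfty// lee_fin powR_ge0.
Qed.

Lemma compact_rV_box (R : realType) n (K : set 'rV[R]_n) : compact K ->
  exists M : R, forall x, K x -> forall i, `[- M, M]%classic (x ord0 i).
Proof.
move=> /compact_bounded[M [Mr HM]]; exists (M + 1) => x Kx i.
rewrite /= in_itv/= -ler_norml.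
have : `|x| <= M + 1 by apply: (HM (M + 1)) => //; rewrite ltrDl.
apply: le_trans; rewrite [leRHS](mx_normrE x).
exact: (le_bigmax _ (fun ij => `|x ij.1 ij.2|) (ord0, i)).
Qed.

Lemma test_fun_L2 (R : realType) n (f : 'rV[R]_n -> R) : test_fun f -> L2 f.
Proof.
move=> [sf cf]; have cont : continuous f by exact: Ck_continuous (sf 0%N).
have sub x : f x != 0 -> csupport f x by move=> fx; exact: subset_closure.
have [M hM] := compact_rV_box cf.
have [C hC] : exists C : R, forall x, `|f x| <= C.
  have /compact_bounded[C [Cr HC]] : compact (f @` csupport f).
    by apply: continuous_compact cf; exact: continuous_subspaceT.
  exists (Num.max 0 (C + 1)) => x.
  have [->|fx] := eqVneq (f x) 0; first by rewrite normr0 le_max lexx.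
  rewrite le_max; apply/orP; right; apply: (HC (C + 1)); first by rewrite ltrDl.
  by exists x => //; exact: sub.
apply: (@L2_bounded_box _ _ f C M) => //.
  exact: continuous_measurable_rV.
by move=> x /sub; exact: hM.
Qed.

(** * The weighted mean of the solution *)

Lemma Rintegral_sum d (X : measurableType d) (R : realType)
    (mu : {measure set X -> \bar R}) m (f : 'I_m -> X -> R) :
  (forall i, mu.-integrable setT (EFin \o f i)) ->
  mu.-integrable setT (EFin \o (fun x => \sum_(i < m) f i x)) /\
  \int[mu]_x (\sum_(i < m) f i x) = \sum_(i < m) \int[mu]_x f i x.
Proof.
elim: m f => [|m IH] f intf.
  split.
    rewrite (_ : _ \o _ = cst 0%E); first exact: integrable0.
    by apply/funext => x /=; rewrite big_ord0.
  rewrite big_ord0 (@eq_Rintegral _ _ _ mu setT (cst 0)) ?Rintegral_cst ?mul0r//.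
  by move=> x _; rewrite big_ord0.
have [int_tl eq_tl] := IH (fun i => f (lift ord0 i)) (fun i => intf _).
split.
  rewrite (_ : _ \o _ = (EFin \o f ord0) \+ (EFin \o (fun x => \sum_(i < m) f (lift ord0 i) x)%R))%E.
    exact: integrableD.
  by apply/funext => x /=; rewrite big_ord_recl EFinD.
rewrite big_ord_recl -eq_tl -RintegralD//.
by apply: eq_Rintegral => x _; rewrite big_ord_recl.
Qed.

Lemma segment_integrable (R : realType) (f : R -> R) (t t1 : R) : 0 <= t -> t <= t1 ->
  {within `[0, t1], continuous f} ->
  (@lebesgue_measure R).-integrable `[0, t] (EFin \o f).
Proof.
move=> t0 tt1 cf; apply: continuous_compact_integrable; first exact: segment_compact.
by apply: continuous_subspaceW cf; apply: subset_itvl; rewrite bnd_simp.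
Qed.

Section wave_functional.
Context (R : realType) (n : nat).
Local Notation leb := (@lebesgue_measure R).
Local Notation lebn := (@rV_lebesgue R n.+1).
Variables (T : \bar R) (u ut : R -> 'rV[R]_n.+1 -> R) (r rho t1 : R).
Hypotheses (hr : 0 < r) (t1_ge0 : 0 <= t1) (t1T : (t1%:E < T)%E)
  (t1rho : t1 + r < rho).
Hypotheses (cu : C0_H1 (time_ivl T) u) (cut : C1_L2 (time_ivl T) u ut)
  (su : supp_spacetime T u `<=` [set z | enorm z.2 <= z.1 + r]).

Let rho_ge0 : 0 <= rho.
Proof. by have := hr; have := t1_ge0; have := t1rho; lra. Qed.

Local Notation W := (@space_weight R n rho).

Let WL : L2 W.
Proof. by apply: test_fun_L2; exact: test_fun_space_weight. Qed.

(* [exp (- t) W] is the plane wave at time [t], up to the spatial cut-off. *)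
Definition wave_functional (f : R -> 'rV[R]_n.+1 -> R) (t : R) : R :=
  expR (- t) * \int[lebn]_x (f t x * W x).

Let ivl t : 0 <= t <= t1 -> time_ivl T t.
Proof. by move=> /andP[t0 tt]; split=> //; apply: le_lt_trans t1T; rewrite lee_fin. Qed.

Let L2u t : time_ivl T t -> L2 (u t).
Proof. by have [[h _] _ _] := cut; exact: h. Qed.

Let L2ut t : time_ivl T t -> L2 (ut t).
Proof. by have [_ [h _] _] := cut; exact: h. Qed.

Let pairing_continuous (f : R -> 'rV[R]_n.+1 -> R) : C0_L2 (time_ivl T) f ->
  {within `[0, t1], continuous (wave_functional f)}.
Proof.
move=> [Lf cf].
have c2 : {within `[0, t1], continuous (fun t => \int[lebn]_x (f t x * W x))}.
  apply/subspace_continuousP => t /= tI.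
  rewrite in_itv/= in tI; have Tt := ivl tI.
  apply: Lfun2_pairing_cvg => //; last 2 first.
  - exact: Lf.
  - apply: cvg_trans (cf t Tt); apply: cvg_app.
    by apply: within_subset => s /=; rewrite in_itv/= => /ivl.
  - near=> s; apply: Lf; apply: ivl.
    have : `[0, t1]%classic s by near: s; exact: withinT.
    by rewrite /= in_itv.
have cE : {within `[0, t1], continuous (fun s : R => expR (- s))}.
  apply: continuous_subspaceT => s.
  by apply: continuous_comp; [exact: continuousN|exact: continuous_expR].
by move=> t; apply: cvgM; [exact: cE|exact: c2].
Unshelve. all: by end_near. Qed.

Lemma continuous_functional : {within `[0, t1], continuous (wave_functional u)}.
Proof. by have [C0u _ _] := cut; exact: pairing_continuous. Qed.

Lemma continuous_functional_derive : {within `[0, t1], continuous (wave_functional ut)}.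
Proof. by have [_ C0ut _] := cut; exact: pairing_continuous. Qed.

Lemma is_derive_functional t : 0 < t < t1 ->
  is_derive t 1 (wave_functional u) (wave_functional ut t - wave_functional u t).
Proof.
move=> tI; have tI' : 0 <= t <= t1 by move: tI => /andP[a b]; rewrite !ltW.
have Tt := ivl tI'; have [_ _ /(_ t Tt) dut] := cut.
have near_ivl : \forall s \near t, time_ivl T s.
  near=> s; apply: ivl; apply/andP; split; apply/ltW.
    by near: s; apply: (cvgr_gt t cvg_id); case/andP: tI.
  by near: s; apply: lt_nbhsl; case/andP: tI.
have dp : is_derive t 1 (fun s => \int[lebn]_x (u s x * W x)) (\int[lebn]_x (ut t x * W x)).
  have cv : (fun h => h^-1 *: (((fun s => \int[lebn]_x (u s x * W x)) \o shift t) (h *: 1)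
      - \int[lebn]_x (u t x * W x))) @ 0^' --> (\int[lebn]_x (ut t x * W x) : R).
    have c0 : (fun h : R => h + t) @ (0 : R) --> t.
      by rewrite -[X in _ --> X]add0r; apply: cvgD; [exact: cvg_id|exact: cvg_cst].
    have sh : (fun h : R => h + t) @ 0^' --> within (time_ivl T) t^'.
      move=> A HA; have sA : \forall x \near t, x != t -> time_ivl T x -> A x := HA.
      suff : \forall h \near 0^', A (h + t) by [].
      have N1 : \forall h \near (0 : R), h + t != t -> time_ivl T (h + t) -> A (h + t) := c0 _ sA.
      have N2 : \forall h \near (0 : R), time_ivl T (h + t) := c0 _ near_ivl.
      near=> h; have hA : h + t != t -> time_ivl T (h + t) -> A (h + t).
        by near: h; exact: nbhs_dnbhs.
      apply: hA; last by near: h; exact: nbhs_dnbhs.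
      rewrite -subr_eq0 addrK; near: h; exact: nbhs_dnbhs_neq.
    have L2near : \forall s \near within (time_ivl T) t^', L2 ((s - t)^-1 \*: (u s \- u t)).
      near=> s; apply: Lfun2_scale; apply: Lfun2_sub; last exact: L2u.
      by apply: L2u; near: s; exact: withinT.
    have FF : Filter (within (time_ivl T) t^') by exact: within_filter.
    have pc := Lfun2_pairing_cvg FF L2near (L2ut Tt) WL dut.
    have := cvg_comp (fun h : R => h + t)
      (fun s => \int[lebn]_x (((s - t)^-1 \*: (u s \- u t)) x * W x)) sh pc => comp_cvg.
    apply: (cvg_trans _ comp_cvg); apply: near_eq_cvg; near=> h.
    have Th : time_ivl T (h + t).
      by near: h; apply: nbhs_dnbhs; exact: (c0 _ near_ivl).
    rewrite /= addrK [h%:A]mulr1 (Lfun2_pairing_scale _ (Lfun2_sub (L2u Th) (L2u Tt)) WL).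
    by rewrite (Lfun2_pairing_sub (L2u Th) (L2u Tt) WL).
  apply: DeriveDef; first by apply/cvg_ex; eexists; exact: cv.
  exact/cvg_lim.
have dE : is_derive t 1 (fun s : R => expR (- s)) (- expR (- t)).
  rewrite -mulrN1; apply: is_derive_comp1; exact: is_deriveNid.
have H := is_deriveM dE dp.
apply: (is_derive_eq H); rewrite /wave_functional /GRing.scale /=; ring.
Unshelve. all: by end_near. Qed.

(** The weak gradient is moved onto [W] by taking the derivatives of [W], again test functions, in
    [weak_partial]. The resulting Laplacian of [W] equals [W] wherever [u s] does not vanish, since
    that set lies in the ball of radius [s + r < rho]. *)
Let laplacian_term s : 0 <= s <= t1 ->
  \int[lebn]_x (\sum_(i < n.+1) wderiv i (u s) x *
      (expR (- s) * 'D_(delta_mx ord0 i) W x)) = - wave_functional u s.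
Proof.
move=> sI; have Ts := ivl sI; have [H1u _] := cu; have [_ wd] := H1u s Ts.
(* Membership in [H1] guarantees that [wderiv] is not its default value. *)
have wdP (i : 'I_n.+1) : L2 (wderiv i (u s)) /\ weak_partial i (u s) (wderiv i (u s)).
  have [g g1 g2] := wd i.
  by apply: (@xgetPex _ (cst 0) [set g | L2 g /\ weak_partial i (u s) g]); exists g.
have tW : test_fun W by exact: test_fun_space_weight.
have tDW (i : 'I_n.+1) : test_fun (fun x => 'D_(delta_mx ord0 i) W x).
  exact: test_fun_derive.
have tDDW (i : 'I_n.+1) : test_fun (fun x => 'D_(delta_mx ord0 i)
    (fun y => 'D_(delta_mx ord0 i) W y) x).
  exact: test_fun_derive.
transitivity (\sum_(i < n.+1) \int[lebn]_x (wderiv i (u s) x *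
    (expR (- s) * 'D_(delta_mx ord0 i) W x))).
  apply: (proj2 (Rintegral_sum _)) => i.
  apply: (Lfun2_mul_integrable (proj1 (wdP i))).
  exact: (Lfun2_scale _ (test_fun_L2 (tDW i))).
transitivity (- expR (- s) * \sum_(i < n.+1) \int[lebn]_x (u s x *
    'D_(delta_mx ord0 i) (fun y => 'D_(delta_mx ord0 i) W y) x)).
  rewrite mulr_sumr; apply: eq_bigr => i _.
  have [L2w wP] := wdP i.
  rewrite (wP _ (tDW i)) mulrNN -RintegralZl//; last first.
    by apply: Lfun2_mul_integrable => //; exact: test_fun_L2.
  by apply: eq_Rintegral => x _; rewrite mulrCA.
rewrite mulNr; congr (- (_ * _)).
have [intS <-] := @Rintegral_sum _ _ R lebn _ (fun (i : 'I_n.+1) x => u s x *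
    'D_(delta_mx ord0 i) (fun y => 'D_(delta_mx ord0 i) W y) x)
    (fun i => Lfun2_mul_integrable (L2u Ts) (test_fun_L2 (tDDW i))).
apply: ae_eq_Rintegral => //.
- by case/integrableP : intS => /measurable_EFinP.
- by case/integrableP : (Lfun2_mul_integrable (L2u Ts) WL) => /measurable_EFinP.
- have [C0u _ _] := cut.
  apply: filterS (support_slice C0u su Ts) => x ux _.
  have [xs|xs] := ltP (s + r) (enorm x).
    by rewrite ux// mul0r big1// => i _; rewrite mul0r.
  rewrite -mulr_sumr laplacian_space_weight//.
  by move: sI => /andP[_ st]; have := t1rho; lra.
Qed.

Variables (b : R -> R) (F : R -> 'rV[R]_n.+1 -> R) (w1 : 'rV[R]_n.+1 -> R).
Hypothesis weak : weak_wave_eq T b F w1 u ut.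

Definition source_functional (s : R) : R :=
  \int[lebn]_x (F s x * (expR (- s) * W x)).

(** This is the weak equation tested with the truncated wave. The time derivative of the wave is
    minus the wave, so that term returns the mean of [ut], and the gradient term becomes minus the
    mean of [u]. *)
Lemma wave_functional_identity t : 0 <= t <= t1 ->
  \int[leb]_(s in `[0, t]) source_functional s =
  wave_functional ut t - \int[lebn]_x (w1 x * W x)
  + \int[leb]_(s in `[0, t]) wave_functional ut s
  - \int[leb]_(s in `[0, t]) wave_functional u s
  + \int[leb]_(s in `[0, t]) (b s * wave_functional ut s).
Proof.
move=> tI; have Tt := ivl tI; have /andP[t0 tt1] := tI.
(* The time cut-off needs room between [t1] and the end of existence to switch off. *)
have [t2 t12 t2T] : exists2 t2 : R, t1 < t2 & (t2%:E < T)%E.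
  have [h h0 hT] := @time_ivl_right _ T t1 (ivl (introT andP (conj t1_ge0 (lexx _)))).
  exists (t1 + h / 2); first by rewrite ltrDl divr_gt0.
  by have [] : time_ivl T (t1 + h / 2) by apply: hT; lra.
have := weak (spacetime_test_fun_weight n t12 rho_ge0 t2T) Tt.
have thE s : 0 <= s <= t1 -> time_weight t1 t2 s = expR (- s).
  by move=> /andP[s0 st]; apply: time_weightE => //; have := t12; lra.
have dth s : derivable (time_weight t1 t2) s 1.
  have [_ /(_ 1)[d _]] := smooth_time_weight t1 t2 1%N; exact: d.
have dW x i : derivable W x (delta_mx ord0 i).
  have [_ /(_ (delta_mx ord0 i))[d _]] := @smooth_space_weight R n rho 1%N; exact: d.
have sub s : s \in `[0, t]%classic -> 0 <= s <= t1.
  by rewrite inE/= in_itv/= => /andP[-> st]; exact: le_trans tt1.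
have E0 : (0 : R) <= 0 <= t1 by rewrite lexx t1_ge0.
have -> : \int[leb]_(s in `[0, t]) \int[lebn]_x (F s x * (time_weight t1 t2 s * W x))
    = \int[leb]_(s in `[0, t]) source_functional s.
  by apply: eq_Rintegral => s /sub /thE ->.
have int_ut := segment_integrable t0 tt1 (continuous_functional_derive).
have int_u := segment_integrable t0 tt1 (continuous_functional).
move=> ->; congr (_ - _ + _ + _ + _).
- rewrite /= thE// /wave_functional.
  rewrite -RintegralZl//; last exact: (Lfun2_mul_integrable (L2ut Tt) WL).
  by apply: eq_Rintegral => x _; rewrite mulrCA.
- by apply: eq_Rintegral => x _; rewrite /= thE// oppr0 expR0 mul1r.
- transitivity (- \int[leb]_(s in `[0, t]) (-1 * wave_functional ut s)); last first.
    by rewrite RintegralZl ?mulN1r ?opprK//; exact: int_ut.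
  congr (- _); apply: eq_Rintegral => s /sub sI.
  transitivity (\int[lebn]_x (- expR (- s) * (ut s x * W x))).
    apply: eq_Rintegral => x _.
    rewrite dtime_tensor// derive_time_weight//; first ring.
    + by case/andP: sI.
    + by case/andP: sI.
  rewrite RintegralZl//; last exact: (Lfun2_mul_integrable (L2ut (ivl sI)) WL).
  by rewrite mulN1r mulNr.
- transitivity (\int[leb]_(s in `[0, t]) (-1 * wave_functional u s)); last first.
    by rewrite RintegralZl ?mulN1r//; exact: int_u.
  apply: eq_Rintegral => s /sub sI; rewrite mulN1r -laplacian_term//.
  apply: eq_Rintegral => x _; apply: eq_bigr => i _.
  by rewrite dspace_tensor// thE.
- apply: eq_Rintegral => s /sub sI; have Ts := ivl sI.
  rewrite /= thE// /wave_functional mulrA -RintegralZl//; last first.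
    exact: (Lfun2_mul_integrable (L2ut Ts) WL).
  by apply: eq_Rintegral => x _; ring.
Qed.

End wave_functional.

Lemma within_itv_continuous_at (R : realType) (f : R -> R) (a b t : R) :
  {within `[a, b], continuous f} -> a < t < b -> {for t, continuous f}.
Proof.
move=> /subspace_continuousP cf /andP[a_t tb].
have tI : `[a, b]%classic t by rewrite /= in_itv/= !ltW.
have := cf t tI; rewrite within_interior//.
have : nbhs t `]a, b[%classic by apply: near_in_itvoo; rewrite in_itv/= a_t.
by apply: filterS => s /=; rewrite !in_itv/= => /andP[sa sb]; rewrite !ltW.
Qed.

Lemma is_derive_integral (R : realType) (f : R -> R) (t1 t : R) :
  {within `[0, t1], continuous f} -> 0 < t < t1 ->
  is_derive t 1 (fun y => \int[@lebesgue_measure R]_(s in `[0, y]) f s) (f t).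
Proof.
move=> cf tI; have /andP[t0 tt1] := tI.
have intf := segment_integrable (ltW (lt_trans t0 tt1)) (lexx t1) cf.
have [d dE] := continuous_FTC1_closed tt1 intf t0 (within_itv_continuous_at cf tI).
by rewrite derive1E in dE; exact: DeriveDef d dE.
Qed.

Lemma integral_continuous (R : realType) (f : R -> R) (t1 : R) : 0 <= t1 ->
  (@lebesgue_measure R).-integrable `[0, t1] (EFin \o f) ->
  {within `[0, t1], continuous (fun y => \int[@lebesgue_measure R]_(s in `[0, y]) f s)}.
Proof. by move=> t10 intf; exact: (parameterized_integral_continuous t10 intf). Qed.

(** * Lower bound for the mean of the time derivative *)

Section wave_lower_bound.
Context (R : realType) (n : nat).
Local Notation leb := (@lebesgue_measure R).
Local Notation lebn := (@rV_lebesgue R n.+1).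
Variables (T : \bar R) (u ut : R -> 'rV[R]_n.+1 -> R) (r rho t1 : R).
Hypotheses (hr : 0 < r) (t1_ge0 : 0 <= t1) (t1T : (t1%:E < T)%E)
  (t1rho : t1 + r < rho).
Hypotheses (cu : C0_H1 (time_ivl T) u) (cut : C1_L2 (time_ivl T) u ut)
  (su : supp_spacetime T u `<=` [set z | enorm z.2 <= z.1 + r]).
Variables (b : R -> R) (F : R -> 'rV[R]_n.+1 -> R) (w1 : 'rV[R]_n.+1 -> R).
Hypotheses (hb : damping b) (weak : weak_wave_eq T b F w1 u ut).
Hypotheses (F_ge0 : forall s x, 0 <= F s x)
  (int_source : leb.-integrable `[0, t1] (EFin \o source_functional rho F)).
Local Notation W := (@space_weight R n rho).
Hypotheses (u0_ge0 : 0 <= wave_functional rho u 0) (w1_gt0 : 0 < \int[lebn]_x (w1 x * W x)).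

Let P t := \int[leb]_(s in `[0, t]) source_functional rho F s.

Lemma source_functional_ge0 s : 0 <= source_functional rho F s.
Proof.
apply: Rintegral_ge0 => x _; apply: mulr_ge0; first exact: F_ge0.
by apply: mulr_ge0; [exact: expR_ge0|exact: space_weight_ge0].
Qed.

Lemma Rintegral_itv_add (f : R -> R) s t : 0 <= s -> s <= t ->
  leb.-integrable `[0, t] (EFin \o f) ->
  \int[leb]_(x in `[0, t]) f x =
  \int[leb]_(x in `[0, s]) f x + \int[leb]_(x in `]s, t]) f x.
Proof.
move=> s0 st intf; apply/eqP; rewrite addrC -subr_eq; apply/eqP.
by apply: Rintegral_itvB => //; rewrite bnd_simp.
Qed.

(** The identity exhibits B - P as a primitive of the continuous function A - B - b B, although the
    source may be discontinuous. So [damped_ode_lb] applies with M = exp (int_0^t b), which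
    summability of [b] bounds uniformly in time. *)
Lemma wave_lower_bound t : 0 <= t <= t1 ->
  \int[lebn]_x (w1 x * W x) + P t <=
  2 * expR (\int[leb]_(s in `[0, +oo[) b s) * wave_functional rho ut t.
Proof.
set I := \int[lebn]_x _.
have [cb b_ge0 intb] := hb.
have cb1 : {within `[0, t1], continuous b}.
  by apply: continuous_subspaceW cb; apply: subset_itvl; rewrite bnd_simp.
pose A := wave_functional rho u; pose B := wave_functional rho ut.
have cA : {within `[0, t1], continuous A}.
  exact: (continuous_functional hr t1_ge0 t1T t1rho cut).
have cB : {within `[0, t1], continuous B}.
  exact: (continuous_functional_derive hr t1_ge0 t1T t1rho cut).
have cbB : {within `[0, t1], continuous (fun s => b s * B s)}.
  by move=> s; apply: cvgM; [exact: cb1|exact: cB].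
have ident := wave_functional_identity hr t1_ge0 t1T t1rho cu cut su weak.
have P0 : P 0 = 0 by rewrite /P set_itv1 Rintegral_set1.
(* The initial velocity enters only through the weak equation, here evaluated at time 0. *)
have B0 : B 0 = I.
  have := ident 0; rewrite lexx t1_ge0 => /(_ isT).
  by rewrite set_itv1 !Rintegral_set1 subr0 !addr0 => /esym/subr0_eq.
pose g s := A s - B s - b s * B s.
have cAB : {within `[0, t1], continuous (fun s => A s - B s)}.
  by move=> s; apply: cvgB; [exact: cA|exact: cB].
have cg : {within `[0, t1], continuous g}.
  by move=> s; apply: cvgB; [exact: cAB|exact: cbB].
have BP s : 0 <= s <= t1 -> (B \- P) s = I + \int[leb]_(x in `[0, s]) g x.
  move=> sI; have /andP[s0 st] := sI; have := ident s sI.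
  rewrite /= -/(P s) -/(B s) -/I => ->.
  rewrite [\int[leb]_(x in `[0, s]) g x](_ : _ = \int[leb]_(x in `[0, s]) A x -
    \int[leb]_(x in `[0, s]) B x - \int[leb]_(x in `[0, s]) (b x * B x)).
    by rewrite /A /B; ring.
  have iA := segment_integrable s0 st cA; have iB := segment_integrable s0 st cB.
  rewrite -RintegralB// -RintegralB//.
  - exact: segment_integrable st cAB.
  - exact: segment_integrable st cbB.
pose M y := expR (\int[leb]_(s in `[0, y]) b s).
have intb1 s : 0 <= s -> s <= t1 -> leb.-integrable `[0, s] (EFin \o b).
  by move=> s0 st; exact: segment_integrable st cb1.
have Mge1 s : 0 <= s <= t1 -> 1 <= M s.
  move=> _; rewrite -expR0 ler_expR; apply: Rintegral_ge0 => x /=.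
  by rewrite in_itv/= => /andP[x0 _]; exact: b_ge0.
have -> : wave_functional rho ut t = B t by [].
rewrite -B0 => tI.
apply: (@damped_ode_lb R t1 (expR (\int[leb]_(s in `[0, +oo[) b s)) A B P M b).
- exact: t1_ge0.
- exact: cA.
- exact: cB.
- exact: integral_continuous.
- have ci := integral_continuous t1_ge0 (intb1 t1 t1_ge0 (lexx _)).
  by move=> s; apply: continuous_comp; [exact: ci|exact: continuous_expR].
- by move=> s sI; exact: (is_derive_functional hr t1_ge0 t1T t1rho cut).
- move=> s sI; have dG := is_derive_integral cg sI.
  have dI := is_deriveD (is_derive_cst I s (1 : R)) dG.
  have near_s : \forall x \near s, I + \int[leb]_(y in `[0, x]) g y = (B \- P) x.
    have : nbhs s `]0, t1[%classic by apply: near_in_itvoo; rewrite in_itv.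
    apply: filterS => x /=; rewrite in_itv/= => /andP[x0 xt].
    have xI : 0 <= x <= t1 by rewrite !ltW.
    by rewrite -(BP x xI).
  have := near_eq_is_derive near_s dI.
  by rewrite add0r /g; congr (is_derive _ _ _ _); ring.
- move=> s sI; rewrite mulrC.
  by apply: is_derive_comp1; exact: (is_derive_integral cb1 sI).
- by move=> s /andP[s0 _]; apply: b_ge0; exact: ltW.
- exact: Mge1.
- move=> s /andP[s0 st]; rewrite ler_expR /Rintegral; apply: fine_le.
  + exact: (integrable_fin_num _ (intb1 s s0 st)).
  + exact: integrable_fin_num.
  + apply: ge0_subset_integral => //.
    * by case/integrableP : intb.
    * by move=> x /=; rewrite in_itv/= andbT => x0; rewrite lee_fin b_ge0.
    * by apply: subset_itvl; rewrite bnd_simp.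
- by rewrite /M set_itv1 Rintegral_set1 expR0.
- exact: P0.
- move=> x y x0 xy yt; rewrite /P (Rintegral_itv_add x0 xy).
    by rewrite lerDl Rintegral_ge0// => s _; exact: source_functional_ge0.
  by apply: integrableS int_source => //; apply: subset_itvl; rewrite bnd_simp.
- exact: u0_ge0.
- by rewrite B0.
- exact: tI.
Qed.

End wave_lower_bound.

(** * The nonlinear term *)

Section source.
Context (R : realType) (n : nat).
Local Notation leb := (@lebesgue_measure R).
Local Notation lebn := (@rV_lebesgue R n.+1).
Variables (T : \bar R) (ut : R -> 'rV[R]_n.+1 -> R) (p rho t1 : R).
Hypotheses (hp : 1 < p) (rho_ge0 : 0 <= rho) (t1T : (t1%:E < T)%E)
  (Lut : Lloc p (spacetime T) (fun z => ut z.1 z.2)).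
Local Notation W := (@space_weight R n rho).
Local Notation F := (fun s x => `|ut s x| `^ p).

Let h (z : measurableTypeR R * 'rV[R]_n.+1) : R :=
  `|ut z.1 z.2| `^ p * (expR (- z.1) * W z.2).
Let D : set (measurableTypeR R * 'rV[R]_n.+1) := [set z | 0 <= z.1 <= t1].

Let mD : measurable D.
Proof.
rewrite (_ : D = fst @^-1` `[0, t1]%classic).
  by rewrite -[X in measurable X]setTI; apply: measurable_fst.
by apply/seteqP; split => z; rewrite /D /= in_itv.
Qed.

Let mut : measurable_fun D (fun z => ut z.1 z.2).
Proof.
have [mu _] := Lut.
have sub : D `<=` spacetime T.
  move=> z /andP[z0 zt]; split=> //.
  by apply: le_lt_trans t1T; rewrite lee_fin.
apply: measurable_funS sub mu.
rewrite (_ : spacetime T = fst @^-1` (`[0, +oo[%classic `&` [set t : R | (t%:E < T)%E])).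
  rewrite -[X in measurable X]setTI; apply: measurable_fst => //.
  by apply: measurableI => //; apply: open_measurable; exact: open_ereal_lt.
by apply/seteqP; split => z; rewrite /spacetime /time_ivl /= in_itv/= andbT.
Qed.

Let mutp : measurable_fun D (fun z => `|ut z.1 z.2| `^ p).
Proof.
apply: (measurableT_comp (measurable_powR _)).
exact: measurableT_comp mut.
Qed.

Let mh : measurable_fun D h.
Proof.
apply: measurable_funM => //; apply: measurable_funTS; apply: measurable_funM.
  apply: measurableT_comp; first exact: measurable_expR.
  by apply: measurableT_comp => //; exact: measurable_fst.
apply: measurableT_comp; last exact: measurable_snd.
apply: continuous_measurable_rV.
exact: (Ck_continuous (@smooth_space_weight R n rho 0%N)).
Qed.

Let G : measurableTypeR R * 'rV[R]_n.+1 -> \bar R := (EFin \o h) \_ D.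

Let mG : measurable_fun setT G.
Proof.
apply/(measurable_restrictT _ _).1 => //; exact/measurable_EFinP.
Qed.

(** Local integrability is available on compact sets only. The spatial cut-off confines the
    integrand to a box, on which the weight is at most [C]. *)
Let G_integrable : (leb \x lebn)%E.-integrable setT G.
Proof.
have [_ Lint] := Lut.
pose K : set (measurableTypeR R * 'rV[R]_n.+1) := `[0, t1]%classic `*`
  [set x : 'rV[R]_n.+1 | forall i, `[- (rho + 1), rho + 1]%classic (x ord0 i)].
have mK : measurable K.
  apply: measurableX => //.
  exact: (@measurable_rV_box R n.+1 (fun=> `[- (rho + 1), rho + 1]%classic)).
have KD : K `<=` D by move=> z [/= + _]; rewrite in_itv.
have KT : K `<=` spacetime T.
  move=> z /KD /andP[z0 zt]; split=> //.
  by apply: le_lt_trans t1T; rewrite lee_fin.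
have cK : compact (K : set (R * 'rV[R]_n.+1)).
  by apply: compact_setX; [exact: segment_compact|exact: compact_box].
pose C := expR (rho + 1).
have := Lint K cK KT.
set I := (\int[_]_(z in K) _)%E => Ioo.
apply/integrableP; split => //.
apply: (@le_lt_trans _ _ (\int[(leb \x lebn)%E]_(z in K)
    (C%:E * (`|ut z.1 z.2| `^ p)%:E))%E); last first.
  rewrite ge0_integralZl ?lte_mul_pinfty// ?lee_fin ?expR_ge0//.
  by apply/measurable_EFinP; exact: measurable_funS KD mutp.
rewrite [leRHS]integral_mkcond; apply: ge0_le_integral => //.
- exact: measurableT_comp mG.
- apply/(measurable_restrictT _ _).1 => //.
  apply: emeasurable_funM => //.
  by apply/measurable_EFinP; exact: measurable_funS KD mutp.
- move=> z _; rewrite /G !patchE.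
  case: ifPn => [|_]; last first.
    rewrite abse0; case: ifPn => // _.
    by rewrite mule_ge0 ?lee_fin ?expR_ge0 ?powR_ge0.
  rewrite inE => zD; rewrite /= /h.
  have [->|Wz] := eqVneq (W z.2) 0.
    rewrite !mulr0 normr0; case: ifPn => // _.
    by rewrite mule_ge0 ?lee_fin ?expR_ge0 ?powR_ge0.
  have zK : K z.
    split; first by rewrite /= in_itv.
    exact: space_weight_neq0 Wz.
  rewrite mem_set// -EFinM lee_fin ger0_norm; last first.
    apply: mulr_ge0; first exact: powR_ge0.
    by apply: mulr_ge0; [exact: expR_ge0|exact: space_weight_ge0].
  rewrite mulrC ler_wpM2r ?powR_ge0//.
  rewrite -[leRHS]mul1r ler_pM ?expR_ge0//; first exact: space_weight_ge0.
    by rewrite -expR0 ler_expR; case/andP: zD; lra.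
  apply: le_trans (space_weight_le _ _) _; rewrite ler_expR.
  by have [_ /(_ ord0)] := zK; rewrite /= in_itv/= => /andP[].
Qed.

Let GE s : 0 <= s <= t1 -> (fun x => G (s, x)) =
  EFin \o (fun x => `|ut s x| `^ p * (expR (- s) * W x)).
Proof. by move=> sI; apply/funext => x; rewrite /G patchE mem_set. Qed.

Lemma source_integrable : leb.-integrable `[0, t1] (EFin \o source_functional rho F).
Proof.
have intF := integrable_fubini_F G_integrable.
have intF1 : leb.-integrable `[0, t1] (fubini_F lebn G).
  exact: integrableS intF.
have /integrableP[mF _] := intF1.
(* The inner integral may be infinite at a null set of times, where [fine] replaces it by 0; this
   does not increase its absolute value. *)
suff : leb.-integrable `[0, t1] (EFin \o (fine \o fubini_F lebn G)).
  apply: eq_integrable => // s; rewrite inE/= in_itv/= => sI.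
  by rewrite /source_functional /Rintegral /fubini_F (GE sI).
apply: (le_integrable _ _ _ intF1) => //.
- by apply/measurable_EFinP; exact: measurableT_comp mF.
- by move=> s _ /=; case: (fubini_F lebn G s) => //=; rewrite normr0 leey.
Qed.

Lemma source_slice_integrable : {ae leb, forall s, 0 <= s <= t1 ->
  lebn.-integrable setT (EFin \o (fun x => `|ut s x| `^ p * (expR (- s) * W x)))}.
Proof.
have := ae_integrable1 G_integrable; apply: filterS => s intG sI.
by move: intG; rewrite (GE sI).
Qed.

End source.

(** * Weighted Jensen inequality *)

Section jensen.
Context (R : realType).

(** The tangent of y^p at [l] lies below the curve: this is Young's inequality for [y] and l^(p -
    1). *)
Lemma powR_tangent (p l y : R) : 1 < p -> 0 < l -> 0 <= y ->
  p * l `^ (p - 1) * y - (p - 1) * l `^ p <= y `^ p.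
Proof.
move=> p1 l0 y0.
have q0 : 0 < p / (p - 1) by rewrite divr_gt0; lra.
have pp : p - 1 != 0 by rewrite gt_eqF; lra.
have p0 : p != 0 by rewrite gt_eqF; lra.
have p0' : 0 < p by lra.
have pq : p^-1 + (p / (p - 1))^-1 = 1 by field; rewrite pp p0.
have := conjugate_powR y0 (powR_ge0 l (p - 1)) p0' q0 pq.
rewrite -powRrM [(p - 1) * _]mulrC divfK// => H.
have : y * l `^ (p - 1) * p <= (y `^ p / p + l `^ p / (p / (p - 1))) * p.
  by rewrite ler_pM2r.
have -> : (y `^ p / p + l `^ p / (p / (p - 1))) * p = y `^ p + (p - 1) * l `^ p.
  by field; rewrite pp p0.
lra.
Qed.

Lemma integrable_mull d (X : measurableType d) (mu : {measure set X -> \bar R})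
    (a : R) (f : X -> R) : mu.-integrable setT (EFin \o f) ->
  mu.-integrable setT (EFin \o (fun x => a * f x)).
Proof.
move=> intf; have := integrableZl measurableT a intf.
by apply: eq_integrable => // x _ /=; rewrite EFinM.
Qed.

(** The tangent inequality at [l] is integrated against [w] on [E]. The mass of [w] appears there
    with a negative coefficient, so the upper bound [m] can replace it. Restricting to [E] is
    necessary because only there is [w] known to be integrable. *)
Lemma weighted_jensen d (X : measurableType d) (mu : {measure set X -> \bar R})
    (p m : R) (g w : X -> R) (E : set X) :
  1 < p -> 0 < m -> measurable E -> (forall x, 0 <= w x) ->
  mu.-integrable setT (EFin \o (fun x => `|g x| `^ p * w x)) ->
  mu.-integrable setT (EFin \o (fun x => g x * w x)) ->
  measurable_fun setT w ->
  (\int[mu]_(x in E) (w x)%:E <= m%:E)%E ->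
  {ae mu, forall x, ~ E x -> g x = 0} ->
  0 < \int[mu]_x (g x * w x) ->
  (\int[mu]_x (g x * w x)) `^ p * m `^ (1 - p) <= \int[mu]_x (`|g x| `^ p * w x).
Proof.
move=> p1 m0 mE w0 intp intg mw wm gE B0; set B := \int[mu]_x (g x * w x) in B0 *.
(* The weighted mean is the optimal point of tangency: p l^(p - 1) B - (p - 1) l^p m then equals l^p
   m = B^p m^(1 - p). *)
pose l := B / m; have l0 : 0 < l by rewrite divr_gt0.
have intw : mu.-integrable setT (EFin \o (fun x => w x * \1_E x)).
  apply/integrableP; split.
    by apply/measurable_EFinP; apply: measurable_funM => //; exact: measurable_indic.
  apply: (@le_lt_trans _ _ m%:E); last by rewrite ltry.
  apply: le_trans wm; rewrite [leRHS]integral_mkcond le_eqVlt; apply/orP; left; apply/eqP.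
  apply: eq_integral => x _; rewrite /= patchE indicE.
  by case: ifP => _; rewrite ?mulr1 ?mulr0 ?normr0// ger0_norm.
have wint : \int[mu]_x (w x * \1_E x) <= m.
  rewrite -lee_fin /Rintegral fineK; last exact: integrable_fin_num.
  apply: le_trans wm; rewrite [leRHS]integral_mkcond le_eqVlt; apply/orP; left; apply/eqP.
  apply: eq_integral => x _; rewrite /= patchE indicE.
  by case: ifP => _; rewrite ?mulr1 ?mulr0.
have mgw : measurable_fun setT (fun x => g x * w x).
  by case/integrableP : intg => /measurable_EFinP.
have intgE : mu.-integrable setT (EFin \o (fun x => g x * w x * \1_E x)).
  apply: (le_integrable _ _ _ intg) => //.
    by apply/measurable_EFinP; apply: measurable_funM => //; exact: measurable_indic.
  move=> x _; rewrite /= lee_fin normrM indicE.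
  by case: (_ \in _); rewrite ?normr1 ?normr0 ?mulr1 ?mulr0.
have BE : B = \int[mu]_x (g x * w x * \1_E x).
  apply: ae_eq_Rintegral => //.
    by apply: measurable_funM => //; exact: measurable_indic.
  apply: filterS gE => x gx _; rewrite indicE.
  have [xE|/negP xE] := boolP (x \in E); first by rewrite mulr1.
  by rewrite gx ?mul0r// => Ex; apply: xE; rewrite inE.
have key : \int[mu]_x (p * l `^ (p - 1) * (g x * w x * \1_E x) -
    (p - 1) * l `^ p * (w x * \1_E x)) <= \int[mu]_x (`|g x| `^ p * w x).
  apply: le_Rintegral => //.
    rewrite (_ : _ \o _ = (EFin \o (fun x => (p * l `^ (p - 1) * (g x * w x * \1_E x))%R))
      \- (EFin \o (fun x => ((p - 1) * l `^ p * (w x * \1_E x))%R)))%E; last first.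
      by apply/funext => x.
    by apply: integrableB => //; exact: integrable_mull.
  move=> x _; have [->|xE] : \1_E x = 0 :> R \/ \1_E x = 1 :> R.
    by rewrite indicE; case: (_ \in _); [right|left].
    by rewrite !mulr0 subr0 mulr_ge0// powR_ge0.
  rewrite xE !mulr1 mulrA -mulrBl ler_wpM2r//.
  apply: le_trans (powR_tangent p1 l0 (normr_ge0 (g x))).
  rewrite lerD2r ler_wpM2l ?ler_norm// mulr_ge0 ?powR_ge0//; lra.
apply: le_trans key.
rewrite RintegralB//; last 2 first.
- exact: integrable_mull.
- exact: integrable_mull.
rewrite !RintegralZl// -BE.
have BLm : B = l * m by rewrite /l divfK// gt_eqF.
apply: (@le_trans _ _ (p * l `^ (p - 1) * B - (p - 1) * l `^ p * m)); last first.
  by rewrite lerD2l lerN2 ler_wpM2l// mulr_ge0 ?powR_ge0//; lra.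
have -> : l `^ p = l * l `^ (p - 1) by rewrite mulr_powRB1 ?(ltW l0)//; lra.
rewrite {1}BLm powRM ?(ltW l0) ?(ltW m0)// -mulrA -powR_add//.
have -> : p + (1 - p) = 1 by ring.
rewrite powRr1 ?(ltW m0)// BLm.
have -> : l `^ p = l * l `^ (p - 1) by rewrite mulr_powRB1 ?(ltW l0)//; lra.
by rewrite le_eqVlt; apply/orP; left; apply/eqP; ring.
Qed.

End jensen.

(** * Means of the initial data *)

Section data.
Context (R : realType) (n : nat).
Local Notation lebn := (@rV_lebesgue R n.+1).
Variables (r : R) (hr : 0 < r).

Lemma Rintegral_ae_ge0 (f : 'rV[R]_n.+1 -> R) : measurable_fun setT f ->
  {ae lebn, forall x, 0 <= f x} -> 0 <= \int[lebn]_x f x.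
Proof.
move=> mf f0; rewrite (@ae_eq_Rintegral _ _ _ lebn setT f (fun x => `|f x|)) //.
- exact: Rintegral_ge0.
- exact: measurableT_comp.
- by apply: filterS f0 => x fx _; rewrite ger0_norm.
Qed.

Lemma supp_rV_ae0 (f : 'rV[R]_n.+1 -> R) : compactly_supported_in_ball r f ->
  {ae lebn, forall x, r < enorm x -> f x = 0}.
Proof.
move=> [_ sf].
have H := @ess_support_ae0 R 'rV[R]_n.+1 (almost_everywhere lebn) setT f
  (@rV_base R n.+1) (rV_countable_base _ _).
have : {ae lebn, forall x, setT x -> ~ supp_rV f x -> f x = 0}.
  apply: H.
  - by move=> F aeF; apply: filterS (ae_foralln aeF) => z Fz i _; exact: Fz.
  - by move=> P Q PQ; apply: negligibleS; exact: subsetC.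
  - by rewrite /almost_everywhere setCT; exact: negligible_set0.
by apply: filterS => x hx rx; apply: hx => // /sf /=; rewrite leNgt rx.
Qed.

Lemma space_weight_L2 (rho : R) : 0 <= rho -> L2 (@space_weight R n rho).
Proof. by move=> rho0; apply: test_fun_L2; exact: test_fun_space_weight. Qed.

(** The data vanish where the two cut-offs differ. This frees the initial mass from [rho], hence
    from [t1], as constants uniform in time require. *)
Lemma pairing_space_weight (f : 'rV[R]_n.+1 -> R) rho : r <= rho ->
  L2 f -> compactly_supported_in_ball r f ->
  \int[lebn]_x (f x * space_weight rho x) = \int[lebn]_x (f x * space_weight r x).
Proof.
move=> rrho fL /supp_rV_ae0 sf.
have r0 : 0 <= r by exact: ltW.
have m c : 0 <= c -> measurable_fun setT (fun x => f x * @space_weight R n c x).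
  move=> c0; have := Lfun2_mul_integrable fL (space_weight_L2 c0).
  by case/integrableP => /measurable_EFinP.
apply: ae_eq_Rintegral => //; [by apply: m; exact: le_trans rrho|exact: m|].
apply: filterS sf => x fx _; have [xr|xr] := ltP r (enorm x).
  by rewrite fx ?mul0r.
by rewrite !space_weightE//; [exact: le_trans rrho|exact: le_trans rrho].
Qed.

Lemma pairing_space_weight_gt0 (f : 'rV[R]_n.+1 -> R) :
  L2 f -> nonneg_ae f -> compactly_supported_in_ball r f ->
  ~ {ae lebn, forall x, f x = 0} ->
  0 < \int[lebn]_x (f x * space_weight r x).
Proof.
move=> fL f0 /supp_rV_ae0 sf fn0; have r0 : 0 <= r by exact: ltW.
have intf := Lfun2_mul_integrable fL (space_weight_L2 r0).
have mf : measurable_fun setT (fun x => f x * @space_weight R n r x).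
  by case/integrableP: intf => /measurable_EFinP.
have fw0 : {ae lebn, forall x, 0 <= f x * @space_weight R n r x}.
  by apply: filterS f0 => x fx; apply: mulr_ge0 => //; exact: space_weight_ge0.
rewrite lt_neqAle Rintegral_ae_ge0// andbT; apply/negP => /eqP E0.
apply: fn0.
have : (\int[lebn]_x `|(f x * @space_weight R n r x)%:E| = 0)%E.
  rewrite -(@ae_eq_integral _ _ _ lebn setT _ (EFin \o (fun x => f x * @space_weight R n r x)))//.
  - rewrite -[LHS]fineK; last exact: integrable_fin_num.
    by congr EFin; rewrite E0.
  - by apply/measurable_EFinP.
  - by apply: measurableT_comp => //; apply/measurable_EFinP.
  - by apply: filterS fw0 => x fx _; rewrite gee0_abs ?lee_fin.
move/(ae_eq_integral_abs lebn measurableT (proj2 (measurable_EFinP _ _) mf)).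
apply: filterS2 sf => x sfx /= fwx.
have [xr|xr] := ltP r (enorm x); first exact: sfx.
have /eqP := fwx I; rewrite eqe mulf_eq0 => /orP[/eqP//|].
by rewrite space_weightE// gt_eqF ?expR_gt0.
Qed.

End data.

(** * Growth of the integrated source *)

Section growth_step.
Context (R : realType) (n : nat).
Local Notation leb := (@lebesgue_measure R).
Local Notation lebn := (@rV_lebesgue R n.+1).
Variables (T : \bar R) (v vt : R -> 'rV[R]_n.+1 -> R) (p r rho t1 C : R).
Hypotheses (hp : 1 < p) (hr : 0 < r) (t1_ge0 : 0 <= t1) (t1T : (t1%:E < T)%E)
  (t1rho : t1 + r < rho) (C_gt0 : 0 < C).
Hypotheses (cvt : C1_L2 (time_ivl T) v vt)
  (sv : supp_spacetime T v `<=` [set z | enorm z.2 <= z.1 + r])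
  (Lvt : Lloc p (spacetime T) (fun z => vt z.1 z.2))
  (mass : forall t, 0 <= t ->
    (\int[rV_lebesgue]_(x in [set x : 'rV[R]_n.+1 | (enorm x <= t + r)%R])
       (expR (x ord0 ord0))%:E <= (C * expR t * (1 + t) `^ (n%:R / 2))%:E)%E).
Local Notation F := (fun s x => `|vt s x| `^ p).
Local Notation P := (fun t => \int[leb]_(s in `[0, t]) source_functional rho F s).
Variable Y : R -> R.
Hypotheses (Y_gt0 : forall s, 0 <= s <= t1 -> 0 < Y s)
  (Y_le : forall s, 0 <= s <= t1 -> Y s <= wave_functional rho vt s)
  (Y_ndecr : forall s t, 0 <= s -> s <= t -> t <= t1 -> Y s <= Y t).

(** Jensen on the ball of radius [x + r], where the factor e^(- x) of the wave cancels the e^x of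
    its mass. It applies at almost every [x] only, since the slice of the source must be integrable.
    Monotonicity of [Y] and the negative exponent [1 - p] then allow [Y] at [s] and the weight at
    [t]. *)
Lemma source_ge s t : 0 <= s -> s <= t -> t <= t1 ->
  {ae leb, forall x, s <= x <= t ->
    Y s `^ p * (C * (1 + t) `^ (n%:R / 2)) `^ (1 - p) <= source_functional rho F x}.
Proof.
move=> s0 st tt1; have rho0 : 0 <= rho by have := t1rho; have := hr; lra.
apply: negligibleS (source_slice_integrable rho0 t1T Lvt); apply: subsetC => x /= intF.
move=> /andP[sx xt].
have x0 : 0 <= x by lra.
have xI : 0 <= x <= t1 by rewrite x0 (le_trans xt).
have Tx : time_ivl T x.
  by split=> //; apply: le_lt_trans t1T; rewrite lee_fin; case/andP: xI.
have [C0v [L2vt _] _] := cvt.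
have WL : L2 (fun y => expR (- x) * @space_weight R n rho y).
  exact: (Lfun2_scale (expR (- x)) (space_weight_L2 n rho0)).
pose E := [set y : 'rV[R]_n.+1 | enorm y <= x + r].
have mE : measurable E by exact: measurable_enorm_le.
have Bx : \int[lebn]_y (vt x y * (expR (- x) * space_weight rho y)) = wave_functional rho vt x.
  rewrite /wave_functional -RintegralZl//.
    by apply: eq_Rintegral => y _; rewrite mulrCA.
  exact: (Lfun2_mul_integrable (L2vt x Tx) (space_weight_L2 n rho0)).
have YB : Y s <= wave_functional rho vt x.
  by apply: le_trans (Y_le xI); apply: Y_ndecr => //; case/andP: xI.
have Ys : 0 < Y s by apply: Y_gt0; rewrite s0 (le_trans st).
pose m := C * (1 + x) `^ (n%:R / 2).
have m0 : 0 < m by rewrite mulr_gt0// powR_gt0//; lra.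
have := @weighted_jensen R _ _ lebn p m (vt x)
  (fun y => expR (- x) * @space_weight R n rho y) E hp m0 mE.
rewrite Bx => J.
have {J} : wave_functional rho vt x `^ p * m `^ (1 - p) <= source_functional rho F x.
  apply: J.
  - by move=> y; apply: mulr_ge0; [exact: expR_ge0|exact: space_weight_ge0].
  - exact: intF.
  - exact: (Lfun2_mul_integrable (L2vt x Tx) WL).
  - exact: Lfun2_measurable WL.
  - apply: (@le_trans _ _ (\int[lebn]_(y in E) ((expR (- x))%:E * (expR (y ord0 ord0))%:E))%E).
      have mexp : measurable_fun E (fun y : 'rV[R]_n.+1 => expR (y ord0 ord0)).
        apply: measurable_funTS.
        by apply: measurableT_comp; [exact: measurable_expR|exact: measurable_rV_coord].
      apply: ge0_le_integral => //.
      + move=> y _; rewrite lee_fin; apply: mulr_ge0; [exact: expR_ge0|exact: space_weight_ge0].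
      + by apply/measurable_EFinP; apply: measurable_funTS; exact: Lfun2_measurable WL.
      + by apply: emeasurable_funM => //; apply/measurable_EFinP.
      + move=> y _; rewrite -EFinM lee_fin ler_wpM2l ?expR_ge0//; exact: space_weight_le.
    rewrite ge0_integralZl//; last first.
      apply/measurable_EFinP; apply: measurable_funTS.
      by apply: measurableT_comp; [exact: measurable_expR|exact: measurable_rV_coord].
    apply: le_trans (lee_wpmul2l _ (mass x0)) _; first by rewrite lee_fin expR_ge0.
    rewrite -EFinM lee_fin le_eqVlt; apply/orP; left; apply/eqP.
    rewrite /m expRN; field; rewrite gt_eqF ?expR_gt0//.
  - apply: filterS (support_slice_derive C0v cvt sv Tx) => y hy /negP.
    by rewrite -ltNge.
  - exact: lt_le_trans YB.
apply: le_trans; apply: ler_pM; [exact: powR_ge0|exact: powR_ge0| |].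
  by apply: powR_le YB; [have := hp; lra|exact: ltW].
have -> : 1 - p = - (p - 1) by ring.
apply: powRN_le; [by have := hp; lra|exact: m0|].
by rewrite /m (ler_pM2l C_gt0); apply: powR_le; [rewrite divr_ge0|lra|lra].
Qed.

Lemma source_growth s t : 0 <= s -> s <= t -> t <= t1 ->
  P s + C `^ (1 - p) * (t - s) * (1 + t) `^ (- (n%:R / 2 * (p - 1))) * Y s `^ p <= P t.
Proof.
move=> s0 st tt1; have rho0 : 0 <= rho by have := t1rho; have := hr; lra.
have intS := source_integrable rho0 t1T Lvt.
have t0 : 0 <= t by exact: le_trans st.
have intSt : leb.-integrable `[0, t] (EFin \o source_functional rho F).
  by apply: integrableS intS => //; apply: subset_itvl; rewrite bnd_simp.
rewrite (Rintegral_itv_add s0 st intSt) lerD2l.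
have intSs : leb.-integrable `]s, t] (EFin \o source_functional rho F).
  apply: integrableS intSt => //.
  by move=> x /=; rewrite !in_itv/= => /andP[sx ->]; rewrite (le_trans s0)// ltW.
pose c := Y s `^ p * (C * (1 + t) `^ (n%:R / 2)) `^ (1 - p).
have cE : C `^ (1 - p) * (t - s) * (1 + t) `^ (- (n%:R / 2 * (p - 1))) * Y s `^ p = c * (t - s).
  rewrite /c powRM ?powR_ge0 ?(ltW C_gt0)// -powRrM.
  have -> : n%:R / 2 * (1 - p) = - (n%:R / 2 * (p - 1)) by ring.
  by ring.
rewrite cE.
have -> : c * (t - s) = \int[leb]_(x in `]s, t]) c.
  rewrite Rintegral_cst//; congr (_ * _).
  move: st; rewrite le_eqVlt => /predU1P[->|st].
    by rewrite subrr set_itv_ge ?measure0// bnd_simp ltxx.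
  by rewrite [X in fine X](@lebesgue_measure_itv R `]s, t]) /= lte_fin st.
have c0 : 0 <= c by rewrite mulr_ge0 ?powR_ge0.
have intc : leb.-integrable `]s, t] (EFin \o (fun=> c)).
  apply: (@integrableS _ _ _ leb `[s, t]) => //.
    by apply: subset_itvr; rewrite bnd_simp.
  apply: continuous_compact_integrable; first exact: segment_compact.
  by apply: continuous_subspaceT => x; exact: cvg_cst.
rewrite /Rintegral; apply: fine_le; [exact: integrable_fin_num|exact: integrable_fin_num|].
apply: ae_ge0_le_integral => //.
- by move=> x _; rewrite lee_fin; apply: source_functional_ge0 => a b; exact: powR_ge0.
- by case/integrableP : intSs.
- apply: negligibleS (source_ge s0 st tt1); apply: subsetC => x /= H.
  by rewrite in_itv/= => /andP[sx xt]; rewrite lee_fin; apply: H; rewrite ltW.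
Qed.

End growth_step.

(** * The functional obeying the growth inequalities *)

Section weighted_mean_lower_bound.
Context (R : realType) (n : nat).
Local Notation leb := (@lebesgue_measure R).
Local Notation lebn := (@rV_lebesgue R n.+1).
Variables (T : \bar R) (u ut vt : R -> 'rV[R]_n.+1 -> R) (p r rho t1 eps : R)
  (b : R -> R) (u0 u1 : 'rV[R]_n.+1 -> R).
Hypotheses (hr : 0 < r) (t1_ge0 : 0 <= t1) (t1T : (t1%:E < T)%E)
  (t1rho : t1 + r < rho) (eps_gt0 : 0 < eps).
Hypotheses (hb : damping b) (cu : C0_H1 (time_ivl T) u) (cut : C1_L2 (time_ivl T) u ut)
  (Lvt : Lloc p (spacetime T) (fun z => vt z.1 z.2))
  (su : supp_spacetime T u `<=` [set z | enorm z.2 <= z.1 + r])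
  (u0E : {ae lebn, forall x, u 0 x = eps * u0 x}) (u0_ge0 : nonneg_ae u0)
  (hu1 : L2 u1) (u1_ge0 : nonneg_ae u1) (su1 : compactly_supported_in_ball r u1)
  (u1_neq0 : ~ {ae lebn, forall x, u1 x = 0})
  (weak : weak_wave_eq T b (fun s x => `|vt s x| `^ p) (fun x => eps * u1 x) u ut).
Local Notation F := (fun s x => `|vt s x| `^ p).

Definition damping_factor : R := 2 * expR (\int[leb]_(s in `[0, +oo[) b s).
Definition initial_mass : R := \int[lebn]_x (u1 x * space_weight r x).
(** The X of the overview, divided by [damping_factor] so that it minorizes the mean of [ut]. Unlike
    that mean, it is nondecreasing, with increments that are exactly integrals of the source. *)
Definition lower_bound (t : R) : R :=
  (eps * initial_mass + \int[leb]_(s in `[0, t]) source_functional rho F s) / damping_factor.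

Let K0 : 0 < damping_factor.
Proof. by rewrite mulr_gt0 ?expR_gt0. Qed.

Let I0 : 0 < initial_mass.
Proof. exact: pairing_space_weight_gt0. Qed.

Let rho0 : 0 <= rho.
Proof. by have := t1rho; have := t1_ge0; have := hr; lra. Qed.

Let intS := source_integrable rho0 t1T Lvt.

Lemma lower_bound_ndecr s t : 0 <= s -> s <= t -> t <= t1 -> lower_bound s <= lower_bound t.
Proof.
move=> s0 st tt1; rewrite /lower_bound ler_pM2r ?invr_gt0// lerD2l.
have intSt : leb.-integrable `[0, t] (EFin \o source_functional rho F).
  by apply: integrableS intS => //; apply: subset_itvl; rewrite bnd_simp.
rewrite (Rintegral_itv_add s0 st intSt) lerDl; apply: Rintegral_ge0 => x _.
by apply: source_functional_ge0 => a y; exact: powR_ge0.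
Qed.

Lemma lower_bound0 : lower_bound 0 = initial_mass / damping_factor * eps.
Proof. by rewrite /lower_bound set_itv1 Rintegral_set1 addr0; ring. Qed.

Lemma lower_bound_gt0 s : 0 <= s <= t1 -> 0 < lower_bound s.
Proof.
move=> /andP[s0 st]; apply: lt_le_trans (lower_bound_ndecr (lexx 0) s0 st).
by rewrite lower_bound0 mulr_gt0 ?divr_gt0.
Qed.

Lemma lower_bound_le s : 0 <= s <= t1 -> lower_bound s <= wave_functional rho ut s.
Proof.
move=> sI.
have wE : \int[lebn]_x (eps * u1 x * space_weight rho x) = eps * initial_mass.
  have rrho : r <= rho by have := t1rho; have := t1_ge0; lra.
  rewrite /initial_mass -(pairing_space_weight hr rrho hu1 su1) -RintegralZl//.
    by apply: eq_Rintegral => x _; rewrite mulrA.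
  exact: (Lfun2_mul_integrable hu1 (space_weight_L2 n rho0)).
have T0 : time_ivl T 0.
  by split=> //; apply: le_lt_trans t1T; rewrite lee_fin.
have L2u : L2 (u 0) by have [[h _] _ _] := cut; exact: h.
have A0 : 0 <= wave_functional rho u 0.
  apply: mulr_ge0; [exact: expR_ge0|apply: Rintegral_ae_ge0].
    have := Lfun2_mul_integrable L2u (space_weight_L2 n rho0).
    by case/integrableP => /measurable_EFinP.
  apply: filterS2 u0E u0_ge0 => x -> ux.
  by apply: mulr_ge0; [rewrite mulr_ge0// ltW|exact: space_weight_ge0].
rewrite /lower_bound ler_pdivrMr// [leRHS]mulrC -wE.
apply: (wave_lower_bound hr t1_ge0 t1T t1rho cu cut su hb weak _ intS A0 _ sI).
  by move=> a x; exact: powR_ge0.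
by rewrite wE mulr_gt0.
Qed.

End weighted_mean_lower_bound.

Lemma power_growth_le (R : realType) (c c' a p t1 : R) (X Y : R -> R) : c' <= c ->
  power_growth c a p t1 X Y -> power_growth c' a p t1 X Y.
Proof.
move=> cc g s t s0 st tt1; apply: le_trans (g s t s0 st tt1).
by rewrite lerD2l !ler_wpM2r ?powR_ge0// subr_ge0.
Qed.

Section system.
Context (R : realType) (n : nat) (b1 b2 : R -> R) (hb1 : damping b1) (hb2 : damping b2)
  (p q : R) (hp : 1 < p) (hq : 1 < q) (r : R) (hr : 0 < r)
  (u0 u1 v0 v1 : 'rV[R]_n.+1 -> R) (hu1 : L2 u1) (hv1 : L2 v1)
  (u0_ge0 : nonneg_ae u0) (v0_ge0 : nonneg_ae v0)
  (u1_ge0 : nonneg_ae u1) (v1_ge0 : nonneg_ae v1)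
  (su1 : compactly_supported_in_ball r u1) (sv1 : compactly_supported_in_ball r v1)
  (u1_neq0 : ~ {ae rV_lebesgue, forall x, u1 x = 0})
  (v1_neq0 : ~ {ae rV_lebesgue, forall x, v1 x = 0}).

(** Each minorant grows by the source built from the other unknown, whose mean the other minorant
    bounds from below. The constants are fixed before [eps] and [t1]: they depend on the cone mass,
    the damping factors and the initial masses, none of which involves [rho]. *)
Lemma energy_solution_growth : exists2 c : R, 0 < c & exists2 c1 : R, 0 < c1 &
  forall eps u v (T : \bar R) t1, 0 < eps ->
  energy_solution b1 b2 p q eps u0 u1 v0 v1 T u v ->
  supp_spacetime T u `<=` [set z | enorm z.2 <= z.1 + r] ->
  supp_spacetime T v `<=` [set z | enorm z.2 <= z.1 + r] ->
  0 <= t1 -> (t1%:E < T)%E ->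
  exists X Y, [/\ power_growth c (n%:R / 2 * (p - 1)) p t1 X Y,
    power_growth c (n%:R / 2 * (q - 1)) q t1 Y X, c1 * eps <= X 0 & c1 * eps <= Y 0].
Proof.
have [C C0 mass] := plane_wave_mass n hr.
pose K1 := damping_factor b1; pose K2 := damping_factor b2.
have K10 : 0 < K1 by rewrite mulr_gt0 ?expR_gt0.
have K20 : 0 < K2 by rewrite mulr_gt0 ?expR_gt0.
have Iu : 0 < initial_mass r u1 by exact: pairing_space_weight_gt0.
have Iv : 0 < initial_mass r v1 by exact: pairing_space_weight_gt0.
pose cu := C `^ (1 - p) / K1; pose cv := C `^ (1 - q) / K2.
exists (Num.min cu cv); first by rewrite lt_min !divr_gt0 ?powR_gt0.
exists (Num.min (initial_mass r u1 / K1) (initial_mass r v1 / K2)).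
  by rewrite lt_min !divr_gt0.
move=> eps u v T t1 e0 [T0 [ut [vt [[cu0 cu1 Lu] [cv0 cv1 Lv] uE vE [wu wv]]]]] su sv t10 t1T.
pose rho := t1 + r + 1; have t1rho : t1 + r < rho by rewrite ltrDl.
exists (lower_bound vt p r rho eps b1 u1), (lower_bound ut q r rho eps b2 v1).
split.
- apply: (@power_growth_le _ cu); first by rewrite ge_min lexx.
  move=> s t s0 st tt1.
  have := source_growth hp hr t1T t1rho C0 cv1 sv Lv mass
    (lower_bound_gt0 b2 hr t10 t1T t1rho e0 Lu hv1 v1_ge0 sv1 v1_neq0)
    (lower_bound_le hr t10 t1T t1rho e0 hb2 cv0 cv1 Lu sv vE v0_ge0 hv1 v1_ge0 sv1 v1_neq0 wv)
    (lower_bound_ndecr eps b2 v1 hr t10 t1T t1rho Lu)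
    s0 st tt1.
  rewrite /lower_bound -/K1 => H; rewrite ler_pdivlMr// mulrDl divfK ?gt_eqF//.
  rewrite -addrA lerD2l; apply: le_trans H; rewrite lerD2l le_eqVlt; apply/orP; left.
  by apply/eqP; rewrite /cu; field; rewrite gt_eqF.
- apply: (@power_growth_le _ cv); first by rewrite ge_min lexx orbT.
  move=> s t s0 st tt1.
  have := source_growth hq hr t1T t1rho C0 cu1 su Lu mass
    (lower_bound_gt0 b1 hr t10 t1T t1rho e0 Lv hu1 u1_ge0 su1 u1_neq0)
    (lower_bound_le hr t10 t1T t1rho e0 hb1 cu0 cu1 Lv su uE u0_ge0 hu1 u1_ge0 su1 u1_neq0 wu)
    (lower_bound_ndecr eps b1 u1 hr t10 t1T t1rho Lv)
    s0 st tt1.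
  rewrite /lower_bound -/K2 => H; rewrite ler_pdivlMr// mulrDl divfK ?gt_eqF//.
  rewrite -addrA lerD2l; apply: le_trans H; rewrite lerD2l le_eqVlt; apply/orP; left.
  by apply/eqP; rewrite /cv; field; rewrite gt_eqF.
- by rewrite lower_bound0 ler_pM2r// ge_min lexx.
- by rewrite lower_bound0 ler_pM2r// ge_min lexx orbT.
Qed.

End system.

(** * Lifespan bounds *)

(** The dimension is [n.+1], so [n / 2] is the cone exponent and E = (pq - 1) Lambda follows by
    algebra. The bounds in the two critical cases share one constant, a maximum. *)
Lemma lifespan_bounds (R : realType) (n : nat) (p q c c1 : R) :
  1 < p -> 1 < q -> 0 < c -> 0 < c1 -> 0 <= Lambda n.+1 p q ->
  exists2 C : R, 0 < C & forall X Y eps t1,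
    0 < eps -> eps <= 1 ->
    power_growth c (n%:R / 2 * (p - 1)) p t1 X Y ->
    power_growth c (n%:R / 2 * (q - 1)) q t1 Y X ->
    c1 * eps <= X 0 -> c1 * eps <= Y 0 ->
    [/\ 0 < Lambda n.+1 p q -> t1 <= C * eps `^ (- (1 / Lambda n.+1 p q)),
        Lambda n.+1 p q = 0 -> t1 <= expR (C * eps `^ (- (p * q - 1))) &
        Lambda n.+1 p q = 0 -> p = q -> t1 <= expR (C * eps `^ (- (p - 1)))].
Proof.
move=> p1 q1 c0 c10; set L := Lambda n.+1 p q => L0.
have pq1 : 0 < p * q - 1 by nra.
set a := n%:R / 2 * (p - 1); set d := n%:R / 2 * (q - 1).
have a0 : 0 <= a by rewrite mulr_ge0 ?divr_ge0//; lra.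
have d0 : 0 <= d by rewrite mulr_ge0 ?divr_ge0//; lra.
have EL : 1 + p - (a + p * d) = (p * q - 1) * L.
  rewrite /L /Lambda /a /d -natr1; field; rewrite gt_eqF//.
move: L0; rewrite le_eqVlt => /predU1P[L0|L0].
- have E0 : 1 + p - (a + p * d) = 0 by rewrite EL -L0 mulr0.
  have [C1 C10 H1] := lifespan_critical p1 q1 a0 d0 c0 c10 E0.
  have [C2 C20 H2] := lifespan_critical_diag p1 c0 c10.
  exists (Num.max C1 C2); first by rewrite lt_max C10.
  move=> X Y eps t1 e0 e1 gX gY X0 Y0.
  have Y0' : 0 <= Y 0 by apply: le_trans Y0; rewrite mulr_ge0 ?ltW.
  split; first by rewrite -L0 ltxx.
    move=> _; apply: le_trans (H1 X Y eps t1 e0 e1 gX gY X0 Y0') _.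
    by rewrite ler_expR ler_wpM2r ?powR_ge0// le_max lexx.
  (* For p = q one has a = d and E = (1 + p) (1 - a), so the critical case forces the weight 1 / (1
     + t) of [lifespan_critical_diag]. *)
  move=> _ pq; have a1 : a = 1.
    move: E0; rewrite /a /d -pq => E0.
    have : (1 + p) * (1 - n%:R / 2 * (p - 1)) = 0 by rewrite -[RHS]E0; ring.
    by move/eqP; rewrite mulf_eq0 => /orP[/eqP|/eqP]; lra.
  have d1 : d = 1 by rewrite /d -pq.
  move: gX gY; rewrite a1 d1 -pq => gX gY.
  apply: le_trans (H2 X Y eps t1 e0 e1 gX gY X0 Y0) _.
  by rewrite ler_expR ler_wpM2r ?powR_ge0// le_max lexx orbT.
- have E0 : 0 < 1 + p - (a + p * d) by rewrite EL mulr_gt0.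
  have [C C0 H] := lifespan_subcritical p1 q1 a0 d0 c0 c10 E0.
  exists C => // X Y eps t1 e0 e1 gX gY X0 Y0.
  have Y0' : 0 <= Y 0 by apply: le_trans Y0; rewrite mulr_ge0 ?ltW.
  split=> [_|L00|L00]; [|by move: L0; rewrite L00 ltxx..].
  have := H X Y eps t1 e0 e1 gX gY X0 Y0'; rewrite EL.
  by have -> : (p * q - 1) / ((p * q - 1) * L) = 1 / L by field; rewrite !gt_eqF.
Qed.

(** If T exceeded [c], a time slightly after [c] would still lie below T; this covers an infinite T,
    so finiteness comes with the bound. *)
Lemma le_ereal_of_lt (R : realType) (T : \bar R) (c : R) : (0 < T)%E ->
  0 <= c -> (forall t, 0 <= t -> (t%:E < T)%E -> t <= c) -> (T <= c%:E)%E.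
Proof.
move=> T0 c0 H; rewrite leNgt; apply/negP => cT.
have Tc : time_ivl T c by [].
have [h h0 hT] := time_ivl_right Tc.
have [_ chT] : time_ivl T (c + h / 2) by apply: hT; lra.
have : c + h / 2 <= c by apply: H => //; lra.
lra.
Qed.

Unset Implicit Arguments.

Theorem theorem1p2 (R : realType) (n : nat) (hn : (1 <= n)%N)
  (b1 b2 : R -> R) (hb1 : damping b1) (hb2 : damping b2)
  (p q : R) (hp : 1 < p) (hq : 1 < q)
  (hpq : (n%:R - 1) / 2 <=
         Num.max ((p + 1) / (p * q - 1)) ((q + 1) / (p * q - 1)))
  (r : R) (hr : 0 < r)
  (u0 u1 v0 v1 : 'rV[R]_n -> R)
  (hu0 : H1 u0) (hv0 : H1 v0) (hu1 : L2 u1) (hv1 : L2 v1)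
  (u0_ge0 : nonneg_ae u0) (v0_ge0 : nonneg_ae v0)
  (u1_ge0 : nonneg_ae u1) (v1_ge0 : nonneg_ae v1)
  (su0 : compactly_supported_in_ball r u0)
  (sv0 : compactly_supported_in_ball r v0)
  (su1 : compactly_supported_in_ball r u1)
  (sv1 : compactly_supported_in_ball r v1)
  (u1_neq0 : ~ {ae rV_lebesgue, forall x, u1 x = 0})
  (v1_neq0 : ~ {ae rV_lebesgue, forall x, v1 x = 0}) :
  exists eps0 : R, 0 < eps0 /\ exists C : R, 0 < C /\
  forall eps : R, 0 < eps -> eps <= eps0 ->
  forall (u v : R -> 'rV[R]_n -> R) (T : \bar R),
    lifespan b1 b2 p q eps u0 u1 v0 v1 u v T ->
    supp_spacetime T u `<=` [set z | enorm z.2 <= z.1 + r] ->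
    supp_spacetime T v `<=` [set z | enorm z.2 <= z.1 + r] ->
    [/\ (T < +oo)%E,
        0 < Upsilon n p q ->
          (T <= (C * eps `^ (- (1 / Upsilon n p q)))%:E)%E,
        Upsilon n p q = 0 -> p != q ->
          (T <= (expR (C * eps `^ (- (p * q - 1))))%:E)%E &
        Upsilon n p q = 0 -> p = q ->
          (T <= (expR (C * eps `^ (- (p - 1))))%:E)%E].
Proof.
(* Writing the dimension as a successor provides the first coordinate, along which the wave
   travels. *)
case: n hn hpq u0 u1 v0 v1 hu0 hv0 hu1 hv1 u0_ge0 v0_ge0 u1_ge0 v1_ge0
  su0 sv0 su1 sv1 u1_neq0 v1_neq0 => // n _ hpq u0 u1 v0 v1 _ _ hu1 hv1
  u0_ge0 v0_ge0 u1_ge0 v1_ge0 _ _ su1 sv1 u1_neq0 v1_neq0.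
have [c c0 [c1 c10 growth]] := energy_solution_growth hb1 hb2 hp hq hr hu1 hv1
  u0_ge0 v0_ge0 u1_ge0 v1_ge0 su1 sv1 u1_neq0 v1_neq0.
have pq1 : 0 < p * q - 1 by nra.
have Ups0 : 0 <= Upsilon n.+1 p q.
  move: hpq; rewrite /Upsilon /Lambda [q * p]mulrC !le_max !subr_ge0.
  by [].
have [C C0 bounds] : exists2 C : R, 0 < C & forall eps u v T t1,
    0 < eps -> eps <= 1 ->
    energy_solution b1 b2 p q eps u0 u1 v0 v1 T u v ->
    supp_spacetime T u `<=` [set z | enorm z.2 <= z.1 + r] ->
    supp_spacetime T v `<=` [set z | enorm z.2 <= z.1 + r] ->
    0 <= t1 -> (t1%:E < T)%E ->
    [/\ 0 < Upsilon n.+1 p q -> t1 <= C * eps `^ (- (1 / Upsilon n.+1 p q)),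
        Upsilon n.+1 p q = 0 -> t1 <= expR (C * eps `^ (- (p * q - 1))) &
        Upsilon n.+1 p q = 0 -> p = q -> t1 <= expR (C * eps `^ (- (p - 1)))].
  (* The larger exponent decides which Lambda is the maximum; for p < q the two components exchange
     roles. *)
  have [qp|pq] := leP q p.
    have UE : Upsilon n.+1 p q = Lambda n.+1 p q.
      rewrite /Upsilon; apply/max_idPl; rewrite /Lambda [q * p]mulrC.
      by rewrite lerD2r ler_pM2r ?invr_gt0// lerD2r.
    rewrite UE in Ups0 *.
    have [C C0 H] := lifespan_bounds hp hq c0 c10 Ups0.
    exists C => // eps u v T t1 e0 e1 sol su sv t10 t1T.
    have [X [Y [gX gY X0 Y0]]] := growth eps u v T t1 e0 sol su sv t10 t1T.
    exact: (H X Y).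
  have UE : Upsilon n.+1 p q = Lambda n.+1 q p.
    rewrite /Upsilon; apply/max_idPr; rewrite /Lambda [q * p]mulrC.
    by rewrite lerD2r ler_pM2r ?invr_gt0// lerD2r ltW.
  rewrite UE in Ups0 *.
  have [C C0 H] := lifespan_bounds hq hp c0 c10 Ups0.
  exists C => // eps u v T t1 e0 e1 sol su sv t10 t1T.
  have [X [Y [gX gY X0 Y0]]] := growth eps u v T t1 e0 sol su sv t10 t1T.
  have [H1 H2 _] := H Y X eps t1 e0 e1 gY gX Y0 X0.
  split=> //; first by rewrite [p * q]mulrC.
  by move=> _ pqE; move: pq; rewrite pqE ltxx.
(* Smallness of [eps] serves only to make its negative powers at least 1, so the threshold 1
   suffices. *)
exists 1; split=> //; exists C; split=> // eps e0 e1 u v T [sol _] su sv.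
have T0 : (0 < T)%E by case: sol.
have B t1 := bounds eps u v T t1 e0 e1 sol su sv.
have sub : 0 < Upsilon n.+1 p q ->
    (T <= (C * eps `^ (- (1 / Upsilon n.+1 p q)))%:E)%E.
  move=> U0; apply: le_ereal_of_lt => //; first by rewrite mulr_ge0 ?powR_ge0// ltW.
  by move=> t t0 tT; have [H _ _] := B t t0 tT; exact: H.
have crit : Upsilon n.+1 p q = 0 -> (T <= (expR (C * eps `^ (- (p * q - 1))))%:E)%E.
  move=> U0; apply: le_ereal_of_lt => //.
  by move=> t t0 tT; have [_ H _] := B t t0 tT; exact: H.
split=> //.
- move: Ups0; rewrite le_eqVlt => /predU1P[U0|U0].
    by apply: le_lt_trans (crit (esym U0)) _; rewrite ltry.
  by apply: le_lt_trans (sub U0) _; rewrite ltry.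
- by move=> U0 _; exact: crit.
- move=> U0 pqE; apply: le_ereal_of_lt => //.
  by move=> t t0 tT; have [_ _ H] := B t t0 tT; exact: H.
Qed.
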